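(* For any integer $k\ge1$ and any $k$ distinct points $q^{(1)},\dots,q^{(k)}\in\mathbb{S}^3$, there exists a sequence of Morse functions $\{K_i\}\subset\mathscr{A}$ such that for some $v_i\in\mathscr{M}_{K_i}$, $\{v_i\}$ blows up at precisely the $k$ points $q^{(1)},\dots,q^{(k)}$.
   Context: Throughout $n=3$, $\sigma=1/2$, $g_0$ is the standard metric on the unit sphere $\mathbb{S}^3$, $d(\cdot,\cdot)$ its geodesic distance, and $P_\sigma=\sqrt{-\Delta_{g_0}+1}$ (the conformal operator $\frac{\Gamma(B+\frac12+\sigma)}{\Gamma(B+\frac12-\sigma)}$, $B=\sqrt{-\Delta_{g_0}+1}$, with $\sigma=1/2$). For $K\in C^2(\mathbb{S}^3)$: $\mathscr{K}=\{q:\nabla_{g_0}K(q)=0\}$, $\mathscr{K}^+=\{q\in\mathscr{K}:\Delta_{g_0}K(q)>0\}$, $\mathscr{K}^-=\{q\in\mathscr{K}:\Delta_{g_0}K(q)<0\}$, and $\mathscr{M}_K=\{v\in C^2(\mathbb{S}^3): v>0,\ P_\sigma v=Kv^2\text{ on }\mathbb{S}^3\}$. For distinct $q^{(1)},\dots,q^{(k)}\in\mathscr{K}\setminus\mathscr{K}^+$, $M=M(q^{(1)},\dots,q^{(k)})$ is the real symmetric $k\times k$ matrix $$M_{ii}=-\frac{\Delta_{g_0}K(q^{(i)})}{K(q^{(i)})^3},\qquad M_{ij}=-6\,\frac{G_{q^{(i)}}(q^{(j)})}{K(q^{(i)})K(q^{(j)})}\ (i\ne j),\qquad G_p(q)=\frac{1}{1-\cos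 d(p,q)},$$ and $\mu(M)$ is its smallest eigenvalue. $\mathscr{A}$ is the set of $K\in C^2(\mathbb{S}^3)$ such that $K>0$ on $\mathbb{S}^3$, $\Delta_{g_0}K\ne0$ on $\mathscr{K}$, and $\mu(M(q^{(1)},\dots,q^{(k)}))\neq0$ for all distinct $q^{(1)},\dots,q^{(k)}\in\mathscr{K}^-$, $k\ge2$. A point $\bar q\in\mathbb{S}^3$ is a blow up point of $\{v_i\}$ if there exist $q_i\to\bar q$ with $v_i(q_i)\to\infty$; ''$\{v_i\}$ blows up at precisely the $k$ points'' means that the set of its blow up points is $\{q^{(1)},\dots,q^{(k)}\}$. *)

(* Defs.v *)
From HB Require Import structures.
From mathcomp Require Export all_boot all_order all_algebra.
From mathcomp Require Export all_classical all_reals all_analysis.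
Export Order.TTheory GRing.Theory Num.Theory.
Export numFieldNormedType.Exports.

#[export] Set Implicit Arguments.
#[export] Unset Strict Implicit.
#[export] Unset Printing Implicit Defensive.

Local Open Scope classical_set_scope.
Local Open Scope ring_scope.

Section Sphere.
Variable R : realType.

(* A function on S^3 is represented by a function on R^4 of which only the
   values on S^3 matter: every definition below depends on f only through its
   restriction to S^3. *)
Local Notation E := 'rV[R]_4.

Definition dot (x y : E) : R := \sum_i x 0 i * y 0 i.

(* The library norm on 'rV[R]_4 is the sup norm, hence this one. *)
Definition enorm (x : E) : R := Num.sqrt (dot x x).

Definition S3 : set E := [set x | enorm x = 1].

Definition gdist (p q : E) : R := acos (dot p q).

(* The extension of f|_{S^3} to R^4 \ {0} that is constant along rays. Near
   S^3 its Euclidean gradient and Laplacian restrict on S^3 to the gradient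
   and the Laplace-Beltrami operator of the round metric, and its Euclidean
   Hessian restricts on T_q S^3 to the Riemannian Hessian. *)
Definition rext (f : E -> R) (x : E) : R := f ((enorm x)^-1 *: x).

Definition pd (i : 'I_4) (F : E -> R) (x : E) : R := 'D_(delta_mx 0 i) F x.

Definition C2_S3 (f : E -> R) : Prop :=
  forall x : E, x != 0 ->
  [/\ {for x, continuous (rext f)},
      forall i, derivable (rext f) x (delta_mx 0 i) /\
                {for x, continuous (pd i (rext f))}
    & forall i j, derivable (pd i (rext f)) x (delta_mx 0 j) /\
                  {for x, continuous (pd j (pd i (rext f)))}].

Definition grad (f : E -> R) (q : E) : E := \row_i pd i (rext f) q.

Definition laplacian (f : E -> R) (q : E) : R :=
  \sum_i pd i (pd i (rext f)) q.

Definition tangent (q : E) : set E := [set u | dot q u = 0].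

Definition hessian (f : E -> R) (q u w : E) : R :=
  \sum_i \sum_j u 0 i * w 0 j * pd j (pd i (rext f)) q.

Definition crit (K : E -> R) : set E := [set q | S3 q /\ grad K q = 0].

Definition crit_neg (K : E -> R) : set E :=
  [set q | crit K q /\ laplacian K q < 0].

Definition morse (K : E -> R) : Prop :=
  C2_S3 K /\
  forall q, crit K q -> forall u, tangent q u ->
    (forall w, tangent q w -> hessian K q u w = 0) -> u = 0.

Definition hopf (eta xi1 xi2 : R) : E :=
  \row_(i < 4) [:: cos eta * cos xi1; cos eta * sin xi1;
                   sin eta * cos xi2; sin eta * sin xi2]`_i.

(* Integral over S^3 of a continuous function for the Riemannian volume, which
   is sin eta cos eta d(eta) d(xi1) d(xi2) in Hopf coordinates. *)
Definition integral_S3 (f : E -> R) : R :=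
  \int[lebesgue_measure]_(eta in `[0, pi / 2])
    \int[lebesgue_measure]_(xi1 in `[0, 2 * pi])
      \int[lebesgue_measure]_(xi2 in `[0, 2 * pi])
        (f (hopf eta xi1 xi2) * (sin eta * cos eta)).

(* Y belongs to the eigenspace of - Delta + 1 for lam. *)
Definition eigenfunction (lam : R) (Y : E -> R) : Prop :=
  C2_S3 Y /\ forall x, S3 x -> - laplacian Y x + Y x = lam * Y x.

(* w = sqrt (- Delta + 1) v on S^3, by the spectral theorem: the square root
   multiplies by sqrt lam the component of v in the eigenspace of - Delta + 1
   for lam. The eigenfunctions span a dense subspace of L^2(S^3), so v
   determines the continuous function w on S^3. *)
Definition is_Psigma (v w : E -> R) : Prop :=
  {within S3, continuous w} /\
  forall lam Y, eigenfunction lam Y ->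
    integral_S3 (fun x => w x * Y x) =
    Num.sqrt lam * integral_S3 (fun x => v x * Y x).

Definition solutions (K : E -> R) : set (E -> R) :=
  [set v | [/\ C2_S3 v, forall x, S3 x -> 0 < v x
             & is_Psigma v (fun x => K x * v x ^+ 2)]].

Definition green (p q : E) : R := (1 - cos (gdist p q))^-1.

Definition Mmx (K : E -> R) (k : nat) (q : 'I_k -> E) : 'M[R]_k :=
  \matrix_(i, j)
    if i == j then - (laplacian K (q i) / K (q i) ^+ 3)
    else - 6 * (green (q i) (q j) / (K (q i) * K (q j))).

(* For k >= 1 the spectrum of a symmetric matrix is finite and nonempty, so
   the infimum is the smallest eigenvalue. *)
Definition min_eigenvalue (k : nat) (A : 'M[R]_k) : R :=
  inf [set a | eigenvalue A a].

Definition classA : set (E -> R) :=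
  [set K | [/\ C2_S3 K, forall x, S3 x -> 0 < K x,
               forall q, crit K q -> laplacian K q != 0
             & forall (k : nat) (q : 'I_k -> E), (2 <= k)%N ->
                 injective q -> (forall i, crit_neg K (q i)) ->
                 min_eigenvalue (Mmx K q) != 0]].

Definition blowup_points (v : nat -> E -> R) : set E :=
  [set qbar | S3 qbar /\
     exists q : nat -> E, [/\ forall i, S3 (q i), q i @[i --> \oo] --> qbar
                            & v i (q i) @[i --> \oo] --> +oo]].

End Sphere.

(* Main.v *)
Require Import Defs.
From mathcomp Require Import ring lra.

(** The functions K are explicit. For a small z > 0 put s = z^4, A = z^7 and
    c = sqrt (1 + s^2), and write P for the square root of - Delta + 1. The bubble
    u_j (x) = 1 / (c - <q_j, x>) satisfies P u_j = s u_j^2, constants satisfy P 1 = 1,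
    and a traceless quadratic form Q restricted to the sphere satisfies P Q = 3 Q.
    Hence
      v = 1 + Q + A sum_j u_j,   f = P v = 1 + 3 Q + s A sum_j u_j^2,   K = f / v^2
    gives a positive solution v of P v = K v^2, with K > 0 if Q is small. As z -> 0,
    v (q_j) >= A / (c - 1) >= 2 / z tends to infinity, while v stays bounded away from
    the q_j, so the blow up points are exactly the q_j (lemmas [vz_solution] and
    [blowup_vz]).

    The identity P u_j = s u_j^2 is tested against an eigenfunction Y for lam
    ([psi_bubble]). With c = cosh eta and s = sinh eta, let a (eta) be the integral of
    u Y and b (eta) that of s u^2 Y. Then a' = - b, and b' = - lam a because
    - d/deta (s u^2) = (- Delta + 1) u and Green's identity moves the Laplacian to Y.
    Both decay like exp (- eta), which forces b = sqrt lam * a. Green's identity itself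
    is an integration of exact derivatives in Hopf coordinates ([green_identity]).

    It remains to see that K is a Morse function in class A for all small z, with Q
    fixed. All critical points are located by inequalities. Q is diagonal with four
    distinct nonzero eigenvalues of sum 0, in a frame turned so that no q_j is an
    eigenvector, that is, grad Q (q_j) <> 0.
    - Away from the q_j, K is C^2 close to (1 + 3 Q) / (1 + Q)^2, whose gradient is a
      positive multiple of grad Q. Its critical points are near the eigenvectors of Q,
      so they are nondegenerate, Delta K <> 0, and - Delta K / K <= 1 ([crit_far]).
    - Near q_j let V and F be v and f without the j-th bubble u, and let p be the
      tangential part of q_j. A critical point satisfies, up to small terms,
      T p = - (V grad F - 2 F grad V) with T = 2 A u^2 (s u V - F). The right side is
      bounded below because grad Q (q_j) <> 0. This forces s u >= 100 ([near_core]),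
      and then either |p| <= 17 z^8, where K has a nondegenerate maximum and
      - Delta K / K is between z^-7 and 8 z^-7 (a peak), or u |p|^2 >= 9/5, where K is
      nondegenerate and Delta K > 0 (a saddle): [near_cases], [crit_near].
    So a critical point with Delta K < 0 is either far from the bubbles or a peak under
    one of them. The matrix M is congruent to the matrix m with m_ii = - Delta K / K and
    m_ij = - 6 G_ij. If two of the points are of the same kind (both far, or peaks under
    the same bubble) then m_ii m_jj < 36 G_ij^2 and the smallest eigenvalue is negative.
    If all kinds differ there are at most k + 1 points, at most one of them far, the G_ij
    stay bounded while m_ii m_jj >= z^-7 / 20, and M is positive definite
    ([Kz_classA]). *)

Local Open Scope classical_set_scope.
Local Open Scope ring_scope.

(** * Functions with explicit first and second derivatives *)

Section Jets.
Variable R : realType.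
Local Notation E := 'rV[R]_4.
Local Notation e_ i := (delta_mx 0 i : E).

(** Reduces directional derivatives to one real variable, where the chain rule is
    available. *)
Lemma is_derive_line (f : E -> R) (x v : E) (d : R) :
  is_derive x v f d <-> is_derive (0 : R) 1 (fun h : R => f (h *: v + x)) d.
Proof.
have eqq : (fun h : R => h^-1 *: ((f \o shift x) (h *: v) - f x)) =
  (fun h : R => h^-1 *: (((fun h : R => f (h *: v + x)) \o shift 0) (h *: 1)
     - f (0 *: v + x))).
  by apply/funext => h /=; rewrite addr0 scale0r add0r [h *: 1]mulr1.
split=> -[dv e]; split.
- by move: dv; rewrite /derivable eqq.
- by move: e; rewrite /derive eqq.
- by move: dv; rewrite /derivable eqq.
- by move: e; rewrite /derive eqq.
Qed.

Lemma is_derive_scomp (f : E -> R) (g : R -> R) (x v : E) (df dg : R) :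
  is_derive x v f df -> is_derive (f x) 1 g dg ->
  is_derive x v (fun y => g (f y)) (dg * df).
Proof.
move=> /is_derive_line hf hg; apply/is_derive_line.
apply: (@is_derive1_comp _ g (fun h : R => f (h *: v + x))) => //.
by rewrite scale0r add0r.
Qed.

(** Carrying the first and second derivatives explicitly makes sums, products and
    compositions one computation each, free of iterated directional derivatives. The origin is excluded because [rext f] is not differentiable there. *)
Definition jet (F : E -> R) (G : 'I_4 -> E -> R) (H : 'I_4 -> 'I_4 -> E -> R) :=
  forall x : E, x != 0 ->
  [/\ {for x, continuous F},
      forall i, is_derive x (e_ i) F (G i x) /\ {for x, continuous (G i)}
    & forall i j, is_derive x (e_ j) (G i) (H i j x) /\
                  {for x, continuous (H i j)}].

Lemma near_neq0 (x : E) : x != 0 -> \forall y \near x, y != 0.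
Proof.
move=> x0; suff : nbhs x (~` [set 0 : E]) by apply: filterS => y /eqP.
apply: open_nbhs_nbhs; split; last by move/eqP: x0.
apply: closed_openC; apply: accessible_closed_set1.
exact/hausdorff_accessible/norm_hausdorff.
Qed.

Lemma C2_jet (F : E -> R) :
  (forall x : E, x != 0 ->
  [/\ {for x, continuous F},
      forall i, derivable F x (e_ i) /\ {for x, continuous (pd i F)}
    & forall i j, derivable (pd i F) x (e_ j) /\
                  {for x, continuous (pd j (pd i F))}]) ->
  jet F (fun i => pd i F) (fun i j => pd j (pd i F)).
Proof.
move=> h x x0; have [c d e] := h x x0; split=> // [i|i j].
  by have [? ?] := d i; split => //; apply: DeriveDef.
by have [? ?] := e i j; split => //; apply: DeriveDef.
Qed.

Lemma jet_pd F G H i (x : E) : jet F G H -> x != 0 -> pd i F x = G i x.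
Proof. by move=> h x0; have [_ /(_ i)[[]]] := h x x0. Qed.

Lemma near_pd F G H i (x : E) : jet F G H -> x != 0 ->
  \forall y \near x, pd i F y = G i y.
Proof.
by move=> h x0; near=> y; apply: (jet_pd _ h); near: y; exact: near_neq0.
Unshelve. all: by end_near. Qed.

(** [pd i F] agrees with [G i] only off the origin; being an equality near x, this can
    still be differentiated once more. *)
Lemma jet_pd2 F G H i j (x : E) : jet F G H -> x != 0 ->
  pd j (pd i F) x = H i j x.
Proof.
move=> h x0; rewrite /pd (near_eq_derive _ (near_pd i h x0)).
by have [_ _ /(_ i j)[[]]] := h x x0.
Qed.

Lemma near_cont (f g : E -> R) x :
  (\forall y \near x, f y = g y) -> {for x, continuous g} -> {for x, continuous f}.
Proof.
move=> fg cg; rewrite /prop_for /continuous_at (nbhs_singleton fg).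
apply: cvg_trans cg; have gf : {near x, g =1 f} by near do apply/esym.
exact: near_eq_cvg gf.
Unshelve. all: by end_near. Qed.

Lemma jet_C2 F G H : jet F G H ->
  forall x : E, x != 0 ->
  [/\ {for x, continuous F},
      forall i, derivable F x (e_ i) /\ {for x, continuous (pd i F)}
    & forall i j, derivable (pd i F) x (e_ j) /\
                  {for x, continuous (pd j (pd i F))}].
Proof.
move=> h x x0; have [c d e] := h x x0; split=> // [i|i j].
  have [[? _] ?] := d i; split => //; apply: near_cont (near_pd i h x0) _.
  by [].
have [[dG _] cH] := e i j; split.
  apply: near_eq_derivable dG.
  have gf := near_pd i h x0.
  by near do apply/esym.
apply: near_cont cH; have n0 := near_neq0 x0.
by near do apply: (jet_pd2 _ _ h).
Unshelve. all: by end_near. Qed.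

Lemma jet_cst (a : R) : jet (fun=> a) (fun _ _ => 0) (fun _ _ _ => 0).
Proof.
move=> x x0; split=> [|i|i j]; first exact: cst_continuous.
  by split; [exact: is_derive_cst|exact: cst_continuous].
by split; [exact: is_derive_cst|exact: cst_continuous].
Qed.

Lemma jet_coord l : jet (fun x => x 0 l) (fun i _ => (l == i)%:R) (fun _ _ _ => 0).
Proof.
move=> x x0; split=> [|i|i j].
- exact: coord_continuous.
- split; last exact: cst_continuous.
  apply/is_derive_line; rewrite (_ : (fun h : R => _) =
    (fun h => h * (l == i)%:R + x 0 l)); last first.
    by apply/funext => h; rewrite !mxE eqxx /= eq_sym.
  apply: is_derive_eq; rewrite /= addr0 scaler1 scaler0 add0r.
  by [].
- by split; [exact: is_derive_cst|exact: cst_continuous].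
Qed.

Lemma jet_add F G H F' G' H' : jet F G H -> jet F' G' H' ->
  jet (fun x => F x + F' x) (fun i x => G i x + G' i x)
      (fun i j x => H i j x + H' i j x).
Proof.
move=> h h' x x0; have [c d e] := h x x0; have [c' d' e'] := h' x x0.
split=> [|i|i j].
- exact: (cvgD c c').
- have [d1 d2] := d i; have [d1' d2'] := d' i; split; last exact: (cvgD d2 d2').
  exact: is_deriveD.
- have [d1 d2] := e i j; have [d1' d2'] := e' i j.
  split; last exact: (cvgD d2 d2').
  exact: is_deriveD.
Qed.

Lemma jet_mul F G H F' G' H' : jet F G H -> jet F' G' H' ->
  jet (fun x => F x * F' x) (fun i x => F x * G' i x + F' x * G i x)
   (fun i j x => F x * H' i j x + F' x * H i j x + (G j x * G' i x + G' j x * G i x)).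
Proof.
move=> h h' x x0; have [c d e] := h x x0; have [c' d' e'] := h' x x0.
split=> [|i|i j].
- exact: (cvgM c c').
- have [d1 d2] := d i; have [d1' d2'] := d' i; split.
    exact: is_deriveM.
  exact: (cvgD (cvgM c d2') (cvgM c' d2)).
- have [d1 d2] := d i; have [d1' d2'] := d' i.
  have [d3 d4] := d j; have [d3' d4'] := d' j.
  have [d5 d6] := e i j; have [d5' d6'] := e' i j.
  split; last first.
    apply: cvgD (cvgD (cvgM c d6') (cvgM c' d6)) (cvgD (cvgM d4 d2') (cvgM d4' d2)).
  apply: is_derive_eq (is_deriveD (is_deriveM d3 d5') (is_deriveM d3' d5)) _.
  rewrite /GRing.scale /=; ring.
Qed.

Lemma jet_comp (g g1 g2 : R -> R) F G H : jet F G H ->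
  (forall x : E, x != 0 -> [/\ is_derive (F x) 1 g (g1 (F x)),
     is_derive (F x) 1 g1 (g2 (F x)) & {for F x, continuous g2}]) ->
  jet (fun x => g (F x)) (fun i x => g1 (F x) * G i x)
   (fun i j x => g2 (F x) * (G i x * G j x) + g1 (F x) * H i j x).
Proof.
move=> h hg x x0; have [c d e] := h x x0; have [g01 g12 cg2] := hg x x0.
have cg : {for F x, continuous g}.
  by apply/differentiable_continuous/derivable1_diffP; case: g01.
have cg1 : {for F x, continuous g1}.
  by apply/differentiable_continuous/derivable1_diffP; case: g12.
have c1 : {for x, continuous (fun x => g1 (F x))} by apply: continuous_comp c cg1.
have c2 : {for x, continuous (fun x => g2 (F x))} by apply: continuous_comp c cg2.
split=> [|i|i j].
- exact: continuous_comp c cg.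
- have [d1 d2] := d i; split; last exact: (cvgM c1 d2).
  exact: is_derive_scomp d1 g01.
- have [d1 d2] := d i; have [d3 d4] := d j; have [d5 d6] := e i j.
  split; last exact: (cvgD (cvgM c2 (cvgM d2 d4)) (cvgM c1 d6)).
  apply: is_derive_eq (is_deriveM (is_derive_scomp d3 g12) d5) _.
  rewrite /GRing.scale /=; ring.
Qed.

Lemma jet_ext F G H G' H' : jet F G H ->
  (forall x : E, x != 0 -> (forall i, G i x = G' i x) /\ forall i j, H i j x = H' i j x) ->
  jet F G' H'.
Proof.
move=> h e x x0; have [c d f] := h x x0; have [e1 e2] := e x x0.
split=> // [i|i j]; rewrite -?e1 -?e2; [have [d1 d2] := d i|have [d1 d2] := f i j].
  split => //; apply: near_cont d2; near=> y; apply/esym.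
  have /e[//] : y != 0 by near: y; exact: near_neq0.
split.
  have nG : \forall y \near x, G i y = G' i y.
    near=> y; have /e[//] : y != 0 by near: y; exact: near_neq0.
  by apply: (near_eq_is_derive nG).
apply: near_cont d2; near=> y; apply/esym.
have /e[//] : y != 0 by near: y; exact: near_neq0.
Unshelve. all: by end_near. Qed.

End Jets.

(** * The inner product of R^4 and functions of linear forms *)

Section Dot.
Variable R : realType.
Local Notation E := 'rV[R]_4.
Implicit Types x y z : E.

Lemma dotC x y : dot x y = dot y x.
Proof. by apply: eq_bigr => i _; rewrite mulrC. Qed.

Lemma dotDl x y z : dot (x + y) z = dot x z + dot y z.
Proof. by rewrite /dot -big_split; apply: eq_bigr => i _; rewrite mxE mulrDl. Qed.

Lemma dotZl a x z : dot (a *: x) z = a * dot x z.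
Proof. by rewrite /dot mulr_sumr; apply: eq_bigr => i _; rewrite mxE mulrA. Qed.

Lemma dotDr x y z : dot x (y + z) = dot x y + dot x z.
Proof. by rewrite dotC dotDl 2!(dotC _ x). Qed.

Lemma dotZr a x z : dot x (a *: z) = a * dot x z.
Proof. by rewrite dotC dotZl dotC. Qed.

Lemma dotNl x z : dot (- x) z = - dot x z.
Proof. by rewrite -scaleN1r dotZl mulN1r. Qed.

Lemma dotNr x z : dot x (- z) = - dot x z.
Proof. by rewrite dotC dotNl dotC. Qed.

Lemma dotBl x y z : dot (x - y) z = dot x z - dot y z.
Proof. by rewrite dotDl dotNl. Qed.

Lemma dotBr x y z : dot x (y - z) = dot x y - dot x z.
Proof. by rewrite dotDr dotNr. Qed.

Lemma dot0l z : dot 0 z = 0.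
Proof. by rewrite -(scale0r 0) dotZl mul0r. Qed.

Lemma dot0r z : dot z 0 = 0.
Proof. by rewrite dotC dot0l. Qed.

Definition dotE := (dotDl, dotDr, dotNl, dotNr, dotZl, dotZr).

Lemma dot_ge0 x : 0 <= dot x x.
Proof. by apply: sumr_ge0 => i _; rewrite -expr2 sqr_ge0. Qed.

Lemma dot_eq0 x : (dot x x == 0) = (x == 0).
Proof.
apply/idP/eqP => [|->]; last by rewrite dot0l.
rewrite psumr_eq0 => [/allP h|i _]; last by rewrite -expr2 sqr_ge0.
apply/rowP => i; rewrite mxE; apply/eqP.
by have := h i (mem_index_enum _); rewrite -expr2 sqrf_eq0.
Qed.

Lemma dot_gt0 x : (0 < dot x x) = (x != 0).
Proof. by rewrite lt_neqAle dot_ge0 andbT eq_sym dot_eq0. Qed.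

Lemma cauchy_sqr x y : dot x y ^+ 2 <= dot x x * dot y y.
Proof.
have [->|y0] := eqVneq y 0; first by rewrite !dot0r expr0n mulr0.
have := dot_ge0 (dot y y *: x - dot x y *: y).
rewrite -dot_gt0 in y0; rewrite !dotE (dotC y x) => h.
have : 0 <= dot y y * (dot x x * dot y y - dot x y ^+ 2) by apply: le_trans h _; nra.
by rewrite pmulr_rge0 // subr_ge0.
Qed.

Lemma enorm_ge0 x : 0 <= enorm x. Proof. exact: sqrtr_ge0. Qed.

Lemma sqr_enorm x : enorm x ^+ 2 = dot x x.
Proof. by rewrite sqr_sqrtr ?dot_ge0. Qed.

Lemma enorm_eq0 x : (enorm x == 0) = (x == 0).
Proof. by rewrite -sqrf_eq0 sqr_enorm dot_eq0. Qed.

Lemma cauchy x y : `|dot x y| <= enorm x * enorm y.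
Proof.
rewrite -ler_sqr ?nnegrE ?mulr_ge0 ?enorm_ge0 // real_normK ?num_real //.
by rewrite exprMn !sqr_enorm cauchy_sqr.
Qed.

Lemma S3P x : S3 x <-> dot x x = 1.
Proof.
split=> [h|h]; first by rewrite -sqr_enorm (h : enorm x = 1) expr1n.
by rewrite /S3 /= /enorm h sqrtr1.
Qed.

Lemma S3_neq0 x : S3 x -> x != 0.
Proof. by move=> /S3P h; rewrite -dot_gt0 h. Qed.

Lemma rext_S3 (f : E -> R) x : S3 x -> rext f x = f x.
Proof. by move=> h; rewrite /rext (h : enorm x = 1) invr1 scale1r. Qed.

Lemma S3_unit x : x != 0 -> S3 ((enorm x)^-1 *: x).
Proof.
move=> x0; apply/S3P; rewrite dotZl dotZr -sqr_enorm.
by rewrite mulrA -expr2 -exprMn mulVf ?expr1n // enorm_eq0.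
Qed.

Lemma dot_unit_bound x y : S3 x -> S3 y -> - 1 <= dot x y <= 1.
Proof.
move=> hx hy; have := cauchy x y; rewrite (hx : enorm x = 1) (hy : enorm y = 1).
by rewrite mulr1 ler_norml.
Qed.

Lemma sum_dlt (f : 'I_4 -> R) (i : 'I_4) : \sum_l f l * (l == i)%:R = f i.
Proof.
rewrite (bigD1 i) //= eqxx mulr1 big1 ?addr0 // => l /negPf ->.
by rewrite mulr0.
Qed.

Lemma sum_dlt' (f : 'I_4 -> R) (i : 'I_4) : \sum_l f l * (i == l)%:R = f i.
Proof. by rewrite -[RHS]sum_dlt; apply: eq_bigr => l _; rewrite eq_sym. Qed.

End Dot.

Section Jets.
Variable R : realType.
Local Notation E := 'rV[R]_4.

Lemma jet_sum n (F : 'I_n -> E -> R) G H : (forall l, jet (F l) (G l) (H l)) ->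
  jet (fun x => \sum_l F l x) (fun i x => \sum_l G l i x)
      (fun i j x => \sum_l H l i j x).
Proof.
elim: n => [|n IHn] in F G H * => h.
  have -> : (fun x => \sum_(l < 0) F l x) = fun=> 0.
    by apply/funext => x; rewrite big_ord0.
  apply: jet_ext (jet_cst _) _ => x _; split=> [i|i j]; by rewrite big_ord0.
have -> : (fun x => \sum_l F l x) = fun x => F ord0 x + \sum_l F (lift ord0 l) x.
  by apply/funext => x; rewrite big_ord_recl.
apply: jet_ext (jet_add (h ord0) (IHn _ _ _ (fun l => h (lift ord0 l)))) _.
by move=> x _; split=> [i|i j]; rewrite big_ord_recl.
Qed.

Lemma jet_dot (p : E) : jet (dot p) (fun i _ => p 0 i) (fun _ _ _ => 0).
Proof.
have h := jet_sum (fun l => jet_mul (jet_cst (p 0 l)) (@jet_coord R l)).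
apply: jet_ext h _ => x _; split=> [i|i j].
  under eq_bigr do rewrite mulr0 addr0.
  by rewrite sum_dlt.
by rewrite big1 // => l _; rewrite !(mulr0, mul0r, addr0).
Qed.

Lemma jet_sqrnorm : jet (fun x : E => dot x x) (fun i x => 2 * x 0 i)
  (fun i j _ => 2 * (i == j)%:R).
Proof.
have h := jet_sum (fun l => jet_mul (@jet_coord R l) (@jet_coord R l)).
apply: jet_ext h _ => x _; split=> [i|i j].
  by rewrite big_split /= sum_dlt; ring.
rewrite (eq_bigr (fun l => 2 * (l == j)%:R * (l == i)%:R)); last first.
  by move=> l _; ring.
by rewrite sum_dlt.
Qed.

Lemma is_derive_rsqrt (t : R) : 0 < t ->
  is_derive t 1 (fun t => (Num.sqrt t)^-1) (- 2^-1 * (Num.sqrt t) ^- 3).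
Proof.
move=> t0; have s0 : Num.sqrt t != 0 by rewrite gt_eqF // sqrtr_gt0.
apply: is_derive_eq (is_deriveV s0 (is_derive1_sqrt t0)) _.
by rewrite /GRing.scale /=; field.
Qed.

Lemma is_derive_rsqrt3 (t : R) : 0 < t ->
  is_derive t 1 (fun t => - 2^-1 * (Num.sqrt t) ^- 3)
   (3 / 4 * (Num.sqrt t) ^- 5).
Proof.
move=> t0; have s0 : Num.sqrt t != 0 by rewrite gt_eqF // sqrtr_gt0.
have h := is_deriveX 3 (is_derive_rsqrt t0).
have h2 := is_deriveZ (- 2^-1) h.
have -> : (fun t => - 2^-1 * (Num.sqrt t) ^- 3) =
   - 2^-1 \*: ((fun t : R => (Num.sqrt t)^-1) ^+ 3).
  by apply/funext => y; rewrite /= /GRing.scale /= -exprVn.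
apply: is_derive_eq h2 _.
by rewrite /GRing.scale /=; field.
Qed.

(** [rext] divides by the norm, so this is the one ingredient of the derivatives
    of [rext (dot p)] that is not polynomial. *)
Lemma jet_rnorm : jet (fun x : E => (enorm x)^-1)
  (fun i x => - (enorm x) ^- 3 * x 0 i)
  (fun i j x => 3 * (enorm x) ^- 5 * (x 0 i * x 0 j) - (enorm x) ^- 3 * (i == j)%:R).
Proof.
have h := @jet_comp R (fun t => (Num.sqrt t)^-1)
   (fun t => - 2^-1 * (Num.sqrt t) ^- 3) (fun t => 3 / 4 * (Num.sqrt t) ^- 5)
   _ _ _ jet_sqrnorm.
apply: jet_ext (h _) _ => [x x0|x x0].
  rewrite -dot_gt0 in x0; split; [exact: is_derive_rsqrt|exact: is_derive_rsqrt3|].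
  have sx : Num.sqrt (dot x x) != 0 by rewrite gt_eqF // sqrtr_gt0.
  apply: cvgM; first exact: cst_continuous.
  apply: cvgV; first by rewrite expf_neq0.
  apply: (@continuous_comp _ _ _ Num.sqrt (fun y : R => y ^+ 5)).
    exact: sqrt_continuous.
  exact: exprn_continuous.
rewrite -/(enorm x); split=> [i|i j]; first by field; rewrite enorm_eq0.
by field; rewrite enorm_eq0.
Qed.

Lemma jet_rlin (p : E) : jet (rext (dot p))
  (fun i x => (enorm x)^-1 * p 0 i + dot p x * (- (enorm x) ^- 3 * x 0 i))
  (fun i j x => dot p x * (3 * (enorm x) ^- 5 * (x 0 i * x 0 j)
      - (enorm x) ^- 3 * (i == j)%:R)
    - (enorm x) ^- 3 * (x 0 j * p 0 i + x 0 i * p 0 j)).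
Proof.
have -> : rext (dot p) = fun x => (enorm x)^-1 * dot p x.
  by apply/funext => x; rewrite /rext dotZr.
apply: jet_ext (jet_mul jet_rnorm (jet_dot p)) _ => x x0.
by split=> [i|i j]; ring.
Qed.

Lemma C2_S3_jet (f : E -> R) : C2_S3 f ->
  jet (rext f) (fun i => pd i (rext f)) (fun i j => pd j (pd i (rext f))).
Proof. exact: C2_jet. Qed.

End Jets.

(** * Gradients and second-order operators on the sphere *)

Section Calculus.
Variable R : realType.
Local Notation E := 'rV[R]_4.

(** [op2 (Mhess a b)] is the Hessian at (a, b) and [op2 1%:M] the Laplacian: with M
    arbitrary, each estimate on second derivatives is proved once for both. *)
Definition op2 (M : 'M[R]_4) (f : E -> R) (x : E) : R :=
  \sum_i \sum_j M i j * pd j (pd i (rext f)) x.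

(** The symmetric form for which [2 * bil M (grad f) (grad g)] is the cross term of
    [op2 M (f * g)]. *)
Definition bil (M : 'M[R]_4) (g h : E) : R :=
  \sum_i \sum_j M i j * ((g 0 i * h 0 j + h 0 i * g 0 j) / 2).

Lemma gradE (f : E -> R) G H x : jet (rext f) G H -> S3 x ->
  grad f x = \row_i G i x.
Proof.
by move=> h hx; apply/rowP => i; rewrite !mxE (jet_pd _ h) // S3_neq0.
Qed.

Lemma op2E (f : E -> R) G H M x : jet (rext f) G H -> S3 x ->
  op2 M f x = \sum_i \sum_j M i j * H i j x.
Proof.
move=> h hx; apply: eq_bigr => i _; apply: eq_bigr => j _.
by rewrite (jet_pd2 _ _ h) // S3_neq0.
Qed.

Lemma bilC M (g h : E) : bil M g h = bil M h g.
Proof. by apply: eq_bigr => i _; apply: eq_bigr => j _; ring. Qed.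

Lemma bilDl M (g h k : E) : bil M (g + h) k = bil M g k + bil M h k.
Proof.
rewrite /bil -big_split; apply: eq_bigr => i _; rewrite -big_split.
by apply: eq_bigr => j _; rewrite !mxE /=; ring.
Qed.

Lemma bilZl M a (g k : E) : bil M (a *: g) k = a * bil M g k.
Proof.
rewrite /bil mulr_sumr; apply: eq_bigr => i _; rewrite mulr_sumr.
by apply: eq_bigr => j _; rewrite !mxE /=; ring.
Qed.

Lemma bil0l M (k : E) : bil M 0 k = 0.
Proof. by rewrite -(scale0r (0 : E)) bilZl mul0r. Qed.

Lemma bilDr M (g h k : E) : bil M k (g + h) = bil M k g + bil M k h.
Proof. by rewrite !(bilC _ k) bilDl. Qed.

Lemma bilZr M a (g k : E) : bil M k (a *: g) = a * bil M k g.
Proof. by rewrite !(bilC _ k) bilZl. Qed.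

Lemma C2_cst (a : R) : C2_S3 (fun=> a).
Proof. by move: (jet_C2 (jet_cst a)). Qed.

Lemma C2_lin (p : E) : C2_S3 (dot p).
Proof. exact: (jet_C2 (jet_rlin p)). Qed.

Lemma C2_add (f g : E -> R) : C2_S3 f -> C2_S3 g -> C2_S3 (fun x => f x + g x).
Proof. by move=> /C2_S3_jet hf /C2_S3_jet hg; exact: jet_C2 (jet_add hf hg). Qed.

Lemma C2_mul (f g : E -> R) : C2_S3 f -> C2_S3 g -> C2_S3 (fun x => f x * g x).
Proof. by move=> /C2_S3_jet hf /C2_S3_jet hg; exact: jet_C2 (jet_mul hf hg). Qed.

Lemma C2_scale a (f : E -> R) : C2_S3 f -> C2_S3 (fun x => a * f x).
Proof. by move=> hf; exact: C2_mul (C2_cst a) hf. Qed.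

Lemma C2_sum n (f : 'I_n -> E -> R) : (forall l, C2_S3 (f l)) ->
  C2_S3 (fun x => \sum_l f l x).
Proof.
move=> h; exact: (jet_C2 (jet_sum (fun l => C2_S3_jet (h l)))).
Qed.

Lemma jet_inv (F : E -> R) G H : jet F G H -> (forall x, x != 0 -> F x != 0) ->
  jet (fun x => (F x)^-1) (fun i x => - (F x) ^- 2 * G i x)
   (fun i j x => 2 * (F x) ^- 3 * (G i x * G j x) - (F x) ^- 2 * H i j x).
Proof.
move=> h F0.
have id (t : R) : is_derive t 1 id 1 by exact: is_derive_id.
have h1 (t : R) : t != 0 -> is_derive t 1 (fun t : R => t^-1) (- t ^- 2).
  move=> t0; apply: is_derive_eq (is_deriveV (f := fun t => t) t0 (id t)) _.
  by rewrite /GRing.scale /= mulr1.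
have h2 (t : R) : t != 0 -> is_derive t 1 (fun t : R => - t ^- 2) (2 * t ^- 3).
  move=> t0; have hh := is_deriveN (is_deriveX 2 (h1 t t0)).
  rewrite (_ : (fun t : R => - t ^- 2) = - ((fun t : R => t^-1) ^+ 2)).
    by apply: is_derive_eq hh _; rewrite /GRing.scale /=; field.
  by apply/funext => y /=; rewrite -exprVn.
have hc := @jet_comp R (fun t => t^-1) (fun t => - t ^- 2) (fun t => 2 * t ^- 3) _ _ _ h.
apply: jet_ext (hc _) _ => [x x0|x x0].
  have Fx := F0 x x0; split; [exact: h1|exact: h2|].
  apply: cvgM; first exact: cst_continuous.
  apply: cvgV; first by rewrite expf_neq0.
  exact: exprn_continuous.
by split=> [i|i j]; ring.
Qed.

Lemma rext_neq0 (f : E -> R) : (forall x, S3 x -> f x != 0) ->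
  forall x, x != 0 -> rext f x != 0.
Proof. by move=> h x x0; apply: h; exact: S3_unit. Qed.

Lemma C2_inv (f : E -> R) : C2_S3 f -> (forall x, S3 x -> f x != 0) ->
  C2_S3 (fun x => (f x)^-1).
Proof.
move=> /C2_S3_jet hf f0; exact: jet_C2 (jet_inv hf (rext_neq0 f0)).
Qed.

Section Values.
Variables (x : E) (hx : S3 x).

Lemma grad_cst a : grad (fun=> a) x = 0.
Proof. by rewrite (gradE (jet_cst a)) //; apply/rowP => i; rewrite !mxE. Qed.

Lemma grad_lin p : grad (dot p) x = p - dot p x *: x.
Proof.
rewrite (gradE (jet_rlin p)) //; apply/rowP => i; rewrite !mxE.
by rewrite (hx : enorm x = 1) !expr1n invr1; ring.
Qed.

Lemma grad_add f g : C2_S3 f -> C2_S3 g ->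
  grad (fun y => f y + g y) x = grad f x + grad g x.
Proof.
move=> /C2_S3_jet hf /C2_S3_jet hg; rewrite (gradE (jet_add hf hg)) //.
by apply/rowP => i; rewrite !mxE.
Qed.

Lemma grad_mul f g : C2_S3 f -> C2_S3 g ->
  grad (fun y => f y * g y) x = f x *: grad g x + g x *: grad f x.
Proof.
move=> /C2_S3_jet hf /C2_S3_jet hg; rewrite (gradE (jet_mul hf hg)) //.
by apply/rowP => i; rewrite !mxE !rext_S3.
Qed.

Lemma grad_scale a f : C2_S3 f -> grad (fun y => a * f y) x = a *: grad f x.
Proof.
by move=> hf; rewrite (grad_mul (C2_cst a) hf) grad_cst scaler0 addr0.
Qed.

Lemma grad_sum n (f : 'I_n -> E -> R) : (forall l, C2_S3 (f l)) ->
  grad (fun x => \sum_l f l x) x = \sum_l grad (f l) x.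
Proof.
move=> h; rewrite (gradE (jet_sum (fun l => C2_S3_jet (h l)))) //.
by apply/rowP => i; rewrite mxE summxE; apply: eq_bigr => l _; rewrite mxE.
Qed.

Lemma grad_inv f : C2_S3 f -> (forall y, S3 y -> f y != 0) ->
  grad (fun y => (f y)^-1) x = - (f x) ^- 2 *: grad f x.
Proof.
move=> /C2_S3_jet hf f0; rewrite (gradE (jet_inv hf (rext_neq0 f0))) //.
by apply/rowP => i; rewrite !mxE !rext_S3.
Qed.

Variable M : 'M[R]_4.

Lemma op2_cst a : op2 M (fun=> a) x = 0.
Proof.
rewrite (op2E _ (jet_cst a)) // big1 // => i _; rewrite big1 // => j _.
by rewrite mulr0.
Qed.

Lemma op2_add f g : C2_S3 f -> C2_S3 g ->
  op2 M (fun y => f y + g y) x = op2 M f x + op2 M g x.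
Proof.
move=> /C2_S3_jet hf /C2_S3_jet hg; rewrite (op2E _ (jet_add hf hg)) //.
rewrite /op2 -big_split; apply: eq_bigr => i _; rewrite -big_split.
by apply: eq_bigr => j _ /=; exact: mulrDr.
Qed.

Lemma op2_mul f g : C2_S3 f -> C2_S3 g ->
  op2 M (fun y => f y * g y) x =
  f x * op2 M g x + g x * op2 M f x + 2 * bil M (grad f x) (grad g x).
Proof.
move=> /C2_S3_jet hf /C2_S3_jet hg; rewrite (op2E _ (jet_mul hf hg)) //.
rewrite /op2 /bil !mulr_sumr -!big_split; apply: eq_bigr => i _ /=.
rewrite !mulr_sumr -!big_split; apply: eq_bigr => j _ /=.
rewrite !mxE !rext_S3 //.
move: (pd j (pd i (rext f)) x) (pd j (pd i (rext g)) x) => *.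
move: (pd i (rext f) x) (pd j (rext f) x) (pd i (rext g) x) (pd j (rext g) x) => *.
by move: (f x) (g x) (M i j) => *; field.
Qed.

Lemma op2_scale a f : C2_S3 f -> op2 M (fun y => a * f y) x = a * op2 M f x.
Proof.
move=> hf; rewrite (op2_mul (C2_cst a) hf) op2_cst grad_cst bil0l.
by rewrite !mulr0 !addr0.
Qed.

Lemma op2_sum n (f : 'I_n -> E -> R) : (forall l, C2_S3 (f l)) ->
  op2 M (fun x => \sum_l f l x) x = \sum_l op2 M (f l) x.
Proof.
move=> h; rewrite (op2E _ (jet_sum (fun l => C2_S3_jet (h l)))) //.
rewrite [RHS]exchange_big; apply: eq_bigr => i _; rewrite [RHS]exchange_big.
by apply: eq_bigr => j _; rewrite mulr_sumr.
Qed.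

Lemma op2_inv f : C2_S3 f -> (forall y, S3 y -> f y != 0) ->
  op2 M (fun y => (f y)^-1) x =
  2 * (f x) ^- 3 * bil M (grad f x) (grad f x) - (f x) ^- 2 * op2 M f x.
Proof.
move=> /C2_S3_jet hf f0; rewrite (op2E _ (jet_inv hf (rext_neq0 f0))) //.
rewrite /op2 /bil !mulr_sumr -sumrB; apply: eq_bigr => i _ /=.
rewrite !mulr_sumr -sumrB; apply: eq_bigr => j _ /=.
rewrite !mxE !rext_S3 //.
have := f0 x hx; move: (f x) (pd j (pd i (rext f)) x).
move: (pd i (rext f) x) (pd j (rext f) x) (M i j) => *.
by field.
Qed.

End Values.

Definition Mhess (a b : E) : 'M[R]_4 := \matrix_(i, j) (a 0 i * b 0 j).

Lemma hessianE f x a b : hessian f x a b = op2 (Mhess a b) f x.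
Proof. by apply: eq_bigr => i _; apply: eq_bigr => j _; rewrite mxE. Qed.

Lemma laplacianE f x : laplacian f x = op2 1%:M f x.
Proof.
apply: eq_bigr => i _; rewrite (eq_bigr (fun j => pd j (pd i (rext f)) x * (j == i)%:R)).
  by rewrite sum_dlt.
by move=> j _; rewrite mxE eq_sym mulrC.
Qed.

Lemma dot_sum2 (a b c d : E) :
  \sum_i \sum_j (a 0 i * b 0 i) * (c 0 j * d 0 j) = dot a b * dot c d.
Proof.
rewrite /dot mulr_suml; apply: eq_bigr => i _.
by rewrite mulr_sumr.
Qed.

Lemma bil_hess (a b g h : E) :
  bil (Mhess a b) g h = (dot a g * dot b h + dot a h * dot b g) / 2.
Proof.
rewrite -!dot_sum2 -big_split mulr_suml; apply: eq_bigr => i _.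
rewrite -big_split mulr_suml; apply: eq_bigr => j _.
by rewrite mxE /=; ring.
Qed.

Lemma bil_lap (g h : E) : bil 1%:M g h = dot g h.
Proof.
apply: eq_bigr => i _.
rewrite (eq_bigr (fun j => ((g 0 i * h 0 j + h 0 i * g 0 j) / 2) * (j == i)%:R)).
  by rewrite sum_dlt; field.
by move=> j _; rewrite mxE eq_sym mulrC.
Qed.

(** On the sphere the Hessian of a linear form p is - p times the metric. Bubbles and
    quadratic forms are functions of linear forms, so N and [bil M] determine what M does
    to them. *)
Definition linear_trace (M : 'M[R]_4) (x : E) (N : R) :=
  forall p, op2 M (dot p) x = - N * dot p x.

Lemma linear_trace_hess x (a b : E) : S3 x -> tangent x a -> tangent x b ->
  linear_trace (Mhess a b) x (dot a b).
Proof.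
move=> hx ta tb p; rewrite (op2E _ (jet_rlin p)) // (hx : enorm x = 1) !expr1n invr1.
have dab : dot a b = \sum_i \sum_j a 0 i * b 0 j * (i == j)%:R.
  by apply: eq_bigr => i _; rewrite (sum_dlt' (fun j => a 0 i * b 0 j)).
move: (dot p x) => t; have -> : \sum_i \sum_j Mhess a b i j *
  (t * (3 * 1 * (x 0 i * x 0 j) - 1 * (i == j)%:R) -
    1 * (x 0 j * p 0 i + x 0 i * p 0 j)) =
  3 * t * (dot x a * dot x b) - t * dot a b
   - (dot p a * dot x b + dot x a * dot p b).
  rewrite dab -!dot_sum2.
  rewrite !mulr_sumr -!sumrB -big_split -sumrB; apply: eq_bigr => i _ /=.
  rewrite !mulr_sumr -!sumrB -big_split -sumrB; apply: eq_bigr => j _ /=.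
  by rewrite mxE; ring.
by rewrite (ta : dot x a = 0) (tb : dot x b = 0); ring.
Qed.

Lemma linear_trace_lap x : S3 x -> linear_trace 1%:M x 3.
Proof.
move=> hx p; rewrite (op2E _ (jet_rlin p)) // (hx : enorm x = 1) !expr1n invr1.
transitivity (\sum_i (dot p x * 3 * (x 0 i * x 0 i) - dot p x - 2 * (p 0 i * x 0 i))).
  apply: eq_bigr => i _.
  rewrite (eq_bigr (fun j =>
    (dot p x * (3 * 1 * (x 0 i * x 0 j) - 1 * (i == j)%:R) -
    1 * (x 0 j * p 0 i + x 0 i * p 0 j)) * (j == i)%:R)).
    by rewrite sum_dlt eqxx /=; ring.
  by move=> j _; rewrite mxE eq_sym mulrC.
rewrite !sumrB -!mulr_sumr -/(dot p x) sumr_const card_ord.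
have -> : \sum_i x 0 i * x 0 i = 1 by move/S3P: hx.
by ring.
Qed.

End Calculus.

(** * Integrals over a segment depending on a parameter *)

Lemma pair_cont (A T U : topologicalType) (f : A -> T) (g : A -> U) y :
  {for y, continuous f} -> {for y, continuous g} ->
  {for y, continuous (fun y' => (f y', g y'))}.
Proof. by move=> cf cg; exact: (cvg_pair cf cg). Qed.

Lemma sum_cont (R : realType) (T : topologicalType) n (f : 'I_n -> T -> R) (t : T) :
  (forall i, {for t, continuous (f i)}) -> {for t, continuous (fun z => \sum_i f i z)}.
Proof.
elim: n => [|n IHn] in f * => h.
  have -> : (fun z => \sum_(i < 0) f i z) = fun=> 0.
    by apply/funext => x; rewrite big_ord0.
  exact: cst_continuous.
have -> : (fun z => \sum_i f i z) = fun z => f ord0 z + \sum_i f (lift ord0 i) z.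
  by apply/funext => x; rewrite big_ord_recl.
by apply: continuousD; [exact: h|apply: IHn => i; exact: h].
Qed.

Section Integral.
Variable R : realType.
Local Notation mu := (@lebesgue_measure R).

Definition itg1 (a b : R) (f : R -> R) : R := \int[mu]_(x in `[a, b]) f x.

Lemma is_derive_cont (f : R -> R) (t d : R) : is_derive t 1 f d -> {for t, continuous f}.
Proof. by case=> h _; apply/differentiable_continuous/derivable1_diffP. Qed.

Lemma cont_integrable a b (f : R -> R) : continuous f ->
  mu.-integrable `[a, b] (EFin \o f).
Proof.
move=> cf; apply: continuous_compact_integrable; first exact: segment_compact.
exact: continuous_subspaceT.
Qed.

Lemma itg1_add a b (f g : R -> R) : continuous f -> continuous g ->
  itg1 a b (fun x => f x + g x) = itg1 a b f + itg1 a b g.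
Proof. by move=> cf cg; rewrite /itg1 RintegralD //; exact: cont_integrable. Qed.

Lemma itg1_scale a b r (f : R -> R) : continuous f -> itg1 a b (fun x => r * f x) = r * itg1 a b f.
Proof. by move=> cf; rewrite /itg1 RintegralZl //; exact: cont_integrable. Qed.

Lemma itg1_cst a b C : a <= b -> itg1 a b (cst C) = C * (b - a).
Proof.
move=> ab; rewrite /itg1 Rintegral_cst //; congr (_ * _).
have := lebesgue_measure_itv (`[a, b] : interval R) => /= ->.
rewrite lte_fin; case: ltP => //= ba.
by rewrite (le_anti (introT andP (conj ab ba))) subrr.
Qed.

Lemma itg1_le a b (f : R -> R) C : a <= b -> continuous f -> (forall x, `|f x| <= C) ->
  `|itg1 a b f| <= C * (b - a).
Proof.
move=> ab cf fC; have cfn : continuous (fun x => `|f x|).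
  by move=> x; apply: (continuous_comp (cf x)); exact: norm_continuous.
apply: le_trans (le_normr_Rintegral _ _) _ => //; first exact: cont_integrable.
apply: le_trans (@le_Rintegral _ _ _ _ _ _ (cst C) _ _ _ _) _ => //.
- exact: cont_integrable.
- by apply: cont_integrable => x; exact: cst_continuous.
- by rewrite -/(itg1 _ _ _) itg1_cst.
Qed.

Section Param.
Variable T : topologicalType.

(** Compactness of the segment makes joint continuity uniform in y. Continuity and
    differentiability of parametric integrals both come from this. *)
Lemma unif_near (g : T -> R -> R) (a b : R) (t0 : T) (e : R) :
  continuous (fun p : T * R => g p.1 p.2) -> 0 < e ->
  \forall t \near t0, forall y, y \in `[a, b] -> `|g t y - g t0 y| < e.
Proof.
move=> cg e0.
have cov : forall y, `[a, b]%classic y -> \forall y' \near y & t \near t0, `|g t y' - g t0 y'| < e.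
  move=> y _; have e20 : 0 < e / 2 by rewrite divr_gt0.
  have /cvgrPdist_lt/(_ _ e20) h1 := cg (t0, y).
  have c2 : {for y, continuous (fun y' => g t0 y')}.
    apply: (@continuous_comp _ _ _ (fun y' => (t0, y')) (fun p : T * R => g p.1 p.2)).
      by apply: pair_cont => //; exact: cst_continuous.
    exact: cg.
  have /cvgrPdist_lt/(_ _ e20) h2 := c2.
  case: h1 => [[U V]] [/= hU hV] UV.
  exists (V `&` (fun y' => `|g t0 y - g t0 y'| < e / 2), U) => /=.
    by split => //; apply: filterI.
  move=> [y' t] /= [[Vy h] Ut].
  have := UV (t, y') (conj Ut Vy) => /= h'.
  rewrite (_ : g t y' - g t0 y' = (g t0 y - g t0 y') - (g t0 y - g t y')); last by ring.
  by rewrite (le_lt_trans (ler_normB _ _)) // [e]splitr ltrD.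
have /compact_near_coveringP/(_ _ (nbhs t0) (fun t y => `|g t y - g t0 y| < e) _ cov) :=
  @segment_compact R a b.
by apply: filterS => t h y yab; exact: h.
Qed.

Lemma sect_cont (g : T -> R -> R) t :
  continuous (fun p : T * R => g p.1 p.2) -> continuous (g t).
Proof.
move=> cg y; apply: (@continuous_comp _ _ _ (fun y' => (t, y')) (fun p : T * R => g p.1 p.2)).
  by apply: pair_cont => //; exact: cst_continuous.
exact: cg.
Qed.

Lemma itg1_cont (g : T -> R -> R) a b : a <= b ->
  continuous (fun p : T * R => g p.1 p.2) -> continuous (fun t => itg1 a b (g t)).
Proof.
move=> ab cg t0; apply/cvgrPdist_lt => e e0.
pose d := e / (b - a + 1).
have d0 : 0 < d by rewrite divr_gt0 // ltr_pwDr // subr_ge0.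
near=> t.
have h : forall y, y \in `[a, b] -> `|g t y - g t0 y| < d.
  by near: t; exact: unif_near.
have cgt := sect_cont (t:=t) cg; have cg0 := sect_cont (t:=t0) cg.
rewrite /itg1 distrC -RintegralB //; try exact: cont_integrable.
have cf : continuous (fun y => g t y - g t0 y).
  by move=> y; apply: cvgB; [exact: cgt|exact: cg0].
have cfn : continuous (fun x => `|g t x - g t0 x|).
  by move=> x; apply: (continuous_comp (cf x)); exact: norm_continuous.
apply: le_lt_trans (le_normr_Rintegral _ _) _ => //; first exact: cont_integrable.
apply: le_lt_trans (@le_Rintegral _ _ _ _ _ _ (cst d) _ _ _ _) _ => //.
- exact: cont_integrable.
- by apply: cont_integrable => x; exact: cst_continuous.
- by move=> x xab; apply/ltW/h.
- rewrite -/(itg1 _ _ _) itg1_cst //.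
  rewrite /d -mulrA gtr_pMr // mulrC ltr_pdivrMr ?mul1r; first by rewrite ltrDl.
  by rewrite ltr_pwDr // subr_ge0.
Unshelve. all: by end_near. Qed.

End Param.

(** For s near s0, [`|g' s0 y| + 1] dominates [g' s y] by [unif_near]. *)
Lemma itg1_deriv (g g' : R -> R -> R) (a b s0 : R) : a <= b ->
  continuous (fun p : R * R => g p.1 p.2) ->
  continuous (fun p : R * R => g' p.1 p.2) ->
  (forall s y : R, is_derive s 1 (g^~ y) (g' s y)) ->
  is_derive s0 1 (fun s => itg1 a b (g s)) (itg1 a b (g' s0)).
Proof.
move=> ab cg cg' dg.
have /nbhs_ballP[d /= d0 hd] := @unif_near _ g' a b s0 1 cg' ltr01.
have p1 x y : partial1of2 g x y = g' x y.
  by rewrite partial1of2E; have [_ ->] := dg x y.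
have cG : continuous (fun y => `|g' s0 y| + 1).
  move=> y; apply: cvgD; last exact: cst_continuous.
  by apply: (continuous_comp (@sect_cont _ g' s0 cg' y)); exact: norm_continuous.
have h : h^-1 *: (itg1 a b (g (h + s0)) - itg1 a b (g s0)) @[h --> 0^'] --> itg1 a b (g' s0).
  have -> : itg1 a b (g' s0) = \int[mu]_(y in `[a, b]) partial1of2 g s0 y.
    by apply: eq_Rintegral => y _; rewrite p1.
  apply: (@cvg_differentiation_under_integral R _ _ mu g `[a, b] _ s0 (s0 - d) (s0 + d) _ _ _
   (fun y => `|g' s0 y| + 1) _ (cont_integrable a b cG)) => //.
  - by rewrite /= in_itv /=; apply/andP; split; lra.
  - by move=> x _; apply: cont_integrable; exact: (@sect_cont _ g).
  - move=> x y; rewrite /= in_itv /= => /andP[x1 x2] yab; rewrite p1.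
    have hx : ball s0 d x by rewrite -ball_normE /= ltr_distlC; apply/andP; split; lra.
    have /ltW h := hd x hx y yab.
    by rewrite -[g' x y](subrK (g' s0 y)) (le_trans (ler_normD _ _)) // addrC lerD2l.
apply: DeriveDef.
  by apply/cvg_ex; exists (itg1 a b (g' s0)); move: h; under eq_fun do rewrite -[X in g (X + _)]mulr1.
by apply/cvg_lim => //; move: h; under eq_fun do rewrite -[X in g (X + _)]mulr1.
Qed.

Lemma itg1_FTC a b (F f : R -> R) : a < b -> (forall x : R, is_derive x 1 F (f x)) ->
  continuous f -> itg1 a b f = F b - F a.
Proof.
move=> ab dF cf; have cF x : {for x, continuous F} := is_derive_cont (dF x).
rewrite /itg1 /Rintegral (@continuous_FTC2 _ f F a b) //.
- exact: continuous_subspaceT.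
- split.
  + by move=> x _; have [] := dF x.
  + exact/cvg_at_right_filter/cF.
  + exact/cvg_at_left_filter/cF.
- by move=> x _; rewrite derive1E; have [_ ->] := dF x.
Qed.

End Integral.

(** * Integrals over the box of Hopf coordinates *)

Section Box.
Variable R : realType.

Definition cont3 (X : R -> R -> R -> R) :=
  continuous (fun p : R * R * R => X p.1.1 p.1.2 p.2).

Definition itg3 (X : R -> R -> R -> R) : R :=
  itg1 0 (pi / 2) (fun t => itg1 0 (2 * pi) (fun a => itg1 0 (2 * pi) (X t a))).

Let pi2_gt0 : 0 < pi / 2 :> R. Proof. by rewrite divr_gt0 ?pi_gt0. Qed.
Let twopi_gt0 : 0 < 2 * pi :> R. Proof. by rewrite mulr_gt0 ?pi_gt0. Qed.
Let pi2_ge0 : 0 <= pi / 2 :> R := ltW pi2_gt0.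
Let twopi_ge0 : 0 <= 2 * pi :> R := ltW twopi_gt0.

Lemma fst_cont (T U : topologicalType) : continuous (@fst T U).
Proof. by move=> [x y]; exact: cvg_fst. Qed.
Lemma snd_cont (T U : topologicalType) : continuous (@snd T U).
Proof. by move=> [x y]; exact: cvg_snd. Qed.

Lemma cont3_in X : cont3 X ->
  continuous (fun p : R * R => itg1 0 (2 * pi) (X p.1 p.2)).
Proof.
move=> cX; exact: (@itg1_cont _ _ (fun p : R * R => X p.1 p.2) 0 (2 * pi)).
Qed.

Lemma cont3_in2 X : cont3 X ->
  continuous (fun t : R => itg1 0 (2 * pi) (fun a => itg1 0 (2 * pi) (X t a))).
Proof.
move=> cX; apply: (@itg1_cont _ _ (fun (t : R) (a : R) => itg1 0 (2 * pi) (X t a))) => //.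
exact: cont3_in.
Qed.

Lemma cont3_s1 X t : cont3 X -> continuous (fun a => itg1 0 (2 * pi) (X t a)).
Proof. by move=> /cont3_in; exact: (@sect_cont _ _ (fun t a => itg1 0 (2 * pi) (X t a))). Qed.

Lemma cont3_s2 X t a : cont3 X -> continuous (X t a).
Proof. exact: (@sect_cont _ _ (fun p : R * R => X p.1 p.2) (t, a)). Qed.

Lemma cont3_s12 X t : cont3 X -> continuous (fun p : R * R => X t p.1 p.2).
Proof.
move=> cX p; apply: (@continuous_comp _ _ _ (fun p : R * R => (t, p.1, p.2))
  (fun p : R * R * R => X p.1.1 p.1.2 p.2)); last exact: cX.
apply: pair_cont; last exact: snd_cont.
by apply: pair_cont; [exact: cst_continuous|exact: fst_cont].
Qed.

Lemma cont3_s13 X a : cont3 X -> continuous (fun p : R * R => X p.1 a p.2).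
Proof.
move=> cX p; apply: (@continuous_comp _ _ _ (fun p : R * R => (p.1, a, p.2))
  (fun p : R * R * R => X p.1.1 p.1.2 p.2)); last exact: cX.
apply: pair_cont; last exact: snd_cont.
by apply: pair_cont; [exact: fst_cont|exact: cst_continuous].
Qed.

Lemma itg3_add X Y : cont3 X -> cont3 Y ->
  itg3 (fun t a b => X t a b + Y t a b) = itg3 X + itg3 Y.
Proof.
move=> cX cY; rewrite /itg3 -itg1_add; try exact: cont3_in2.
congr itg1; apply/funext => t; rewrite -itg1_add; try exact: cont3_s1.
congr itg1; apply/funext => a; rewrite -itg1_add //; exact: cont3_s2.
Qed.

Lemma itg3_scale r X : cont3 X -> itg3 (fun t a b => r * X t a b) = r * itg3 X.
Proof.
move=> cX; rewrite /itg3 -itg1_scale; last exact: cont3_in2.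
congr itg1; apply/funext => t; rewrite -itg1_scale; last exact: cont3_s1.
congr itg1; apply/funext => a; rewrite -itg1_scale //; exact: cont3_s2.
Qed.

Lemma itg3_le X (C : R) : cont3 X -> (forall t a b, `|X t a b| <= C) ->
  `|itg3 X| <= C * (2 * pi) ^+ 2 * (pi / 2).
Proof.
move=> cX hX; rewrite /itg3.
have h1 t a : `|itg1 0 (2 * pi) (X t a)| <= C * (2 * pi).
  by rewrite -[X in _ <= _ * X]subr0; apply: itg1_le => //; exact: cont3_s2.
have h2 t : `|itg1 0 (2 * pi) (fun a => itg1 0 (2 * pi) (X t a))| <= C * (2 * pi) ^+ 2.
  rewrite (_ : C * _ = C * (2 * pi) * (2 * pi - 0)); last by rewrite subr0 expr2 mulrA.
  by apply: itg1_le => //; exact: cont3_s1.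
rewrite -[X in _ <= _ * X]subr0.
by apply: itg1_le => //; exact: cont3_in2.
Qed.

(** An exact derivative in the outer variable integrates to boundary terms. The derivative
    is taken under the inner integrals, so the order of integration never changes. *)
Lemma itg3_d0 X X' : cont3 X -> cont3 X' ->
  (forall t a b : R, is_derive t 1 (fun t => X t a b) (X' t a b)) ->
  (forall a b, X 0 a b = 0) -> (forall a b, X (pi / 2) a b = 0) ->
  itg3 X' = 0.
Proof.
move=> cX cX' d X0 X1.
pose F t := itg1 0 (2 * pi) (fun a => itg1 0 (2 * pi) (X t a)).
have dF (t : R) : is_derive t 1 F (itg1 0 (2 * pi) (fun a => itg1 0 (2 * pi) (X' t a))).
  apply: (@itg1_deriv _ (fun t a => itg1 0 (2 * pi) (X t a)) (fun t a => itg1 0 (2 * pi) (X' t a))) => //.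
  - exact: cont3_in.
  - exact: cont3_in.
  - move=> s a; apply: (@itg1_deriv _ (fun s b => X s a b) (fun s b => X' s a b)) => //.
    + exact: cont3_s13.
    + exact: cont3_s13.
rewrite /itg3 (itg1_FTC pi2_gt0 dF) ?/F; last exact: cont3_in2.
have z (Z : R -> R -> R) : (forall a b, Z a b = 0) ->
   itg1 0 (2 * pi) (fun a => itg1 0 (2 * pi) (Z a)) = 0.
  move=> h; have z0 : (fun=> 0 : R) = cst 0 by [].
  have -> : (fun a => itg1 0 (2 * pi) (Z a)) = cst 0.
    apply/funext => a; have -> : Z a = cst 0 by apply/funext.
    by rewrite itg1_cst // mul0r.
  by rewrite itg1_cst // mul0r.
by rewrite !z // subrr.
Qed.

Lemma itg3_d1 X X' : cont3 X -> cont3 X' ->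
  (forall t a b : R, is_derive a 1 (fun a => X t a b) (X' t a b)) ->
  (forall t b, X t 0 b = X t (2 * pi) b) -> itg3 X' = 0.
Proof.
move=> cX cX' d Xp; rewrite /itg3.
have -> : (fun t => itg1 0 (2 * pi) (fun a => itg1 0 (2 * pi) (X' t a))) = cst 0.
  apply/funext => t /=.
  have dF (a : R) : is_derive a 1 (fun a => itg1 0 (2 * pi) (X t a)) (itg1 0 (2 * pi) (X' t a)).
    apply: (@itg1_deriv _ (fun a b => X t a b) (fun a b => X' t a b)) => //.
    + exact: cont3_s12.
    + exact: cont3_s12.
  rewrite (itg1_FTC twopi_gt0 dF); last exact: cont3_s1.
  have -> : X t (2 * pi) = X t 0 by apply/funext => b; rewrite Xp.
  by rewrite subrr.
by rewrite itg1_cst // mul0r.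
Qed.

Lemma itg3_d2 X X' : cont3 X' ->
  (forall t a b : R, is_derive b 1 (X t a) (X' t a b)) ->
  (forall t a, X t a 0 = X t a (2 * pi)) -> itg3 X' = 0.
Proof.
move=> cX' d Xp; rewrite /itg3.
have -> : (fun t => itg1 0 (2 * pi) (fun a => itg1 0 (2 * pi) (X' t a))) = cst 0.
  apply/funext => t; have -> : (fun a => itg1 0 (2 * pi) (X' t a)) = cst 0.
    apply/funext => a.
    by rewrite (itg1_FTC twopi_gt0 (d t a)) ?Xp ?subrr //; exact: cont3_s2.
  by rewrite itg1_cst // mul0r.
by rewrite itg1_cst // mul0r.
Qed.

Definition cont4 (X : R -> R -> R -> R -> R) :=
  continuous (fun p : R * R * R * R => X p.1.1.1 p.1.1.2 p.1.2 p.2).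

Lemma itg3_deriv X X' (s0 : R) : cont4 X -> cont4 X' ->
  (forall s t a b : R, is_derive s 1 (fun s => X s t a b) (X' s t a b)) ->
  is_derive s0 1 (fun s => itg3 (X s)) (itg3 (X' s0)).
Proof.
move=> cX cX' d.
have c3 (Z : R -> R -> R -> R -> R) : cont4 Z ->
   cont3 (fun s t a => itg1 0 (2 * pi) (Z s t a)).
  by move=> cZ; exact: (@itg1_cont _ _ (fun p : R * R * R => Z p.1.1 p.1.2 p.2)).
have c2 (Z : R -> R -> R -> R -> R) : cont4 Z -> continuous (fun p : R * R =>
   itg1 0 (2 * pi) (fun a => itg1 0 (2 * pi) (Z p.1 p.2 a))).
  move=> cZ; exact: (@itg1_cont _ _ (fun (p : R * R) a => itg1 0 (2 * pi) (Z p.1 p.2 a)) _ _ _ (c3 _ cZ)).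
have s14 (Z : R -> R -> R -> R -> R) t a : cont4 Z ->
   continuous (fun p : R * R => Z p.1 t a p.2).
  move=> cZ p; apply: (@continuous_comp _ _ _ (fun p : R * R => (p.1, t, a, p.2))
     (fun p : R * R * R * R => Z p.1.1.1 p.1.1.2 p.1.2 p.2)); last exact: cZ.
  apply: pair_cont; last exact: snd_cont.
  apply: pair_cont; last exact: cst_continuous.
  by apply: pair_cont; [exact: fst_cont|exact: cst_continuous].
apply: (@itg1_deriv _ (fun s t => itg1 0 (2 * pi) (fun a => itg1 0 (2 * pi) (X s t a)))
   (fun s t => itg1 0 (2 * pi) (fun a => itg1 0 (2 * pi) (X' s t a)))) => //.
- exact: c2.
- exact: c2.
move=> s t; apply: (@itg1_deriv _ (fun s a => itg1 0 (2 * pi) (X s t a))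
   (fun s a => itg1 0 (2 * pi) (X' s t a))) => //.
- exact: (@cont3_s13 (fun s t a => itg1 0 (2 * pi) (X s t a)) t (c3 _ cX)).
- exact: (@cont3_s13 (fun s t a => itg1 0 (2 * pi) (X' s t a)) t (c3 _ cX')).
move=> s' a; apply: (@itg1_deriv _ (fun s b => X s t a b) (fun s b => X' s t a b)) => //.
- exact: s14.
- exact: s14.
Qed.

End Box.

(** * Derivatives along curves *)

Section Chain.
Variable R : realType.
Local Notation E := 'rV[R]_4.
Local Notation e_ i := (delta_mx 0 i : E).

(* the path from x to y that changes one coordinate at a time *)
Let mix (m : nat) (x y : E) : E := \row_i if (i < m)%N then y 0 i else x 0 i.

Let mix_S (m : 'I_4) x y : mix m.+1 x y = (y 0 m - x 0 m) *: e_ m + mix m x y.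
Proof.
apply/rowP => i; rewrite !mxE /= ltnS leq_eqVlt.
have [->|im] := eqVneq i m; first by rewrite !eqxx ltnn /=; ring.
by rewrite ?andbF mulr0 add0r (_ : (i == m :> nat) = false) //; exact: negbTE.
Qed.

Let ball_mix (m : 'I_4) (x y : E) (d s : R) : ball x d y -> 0 <= s <= 1 ->
  ball x d (s *: ((y 0 m - x 0 m) *: e_ m) + mix m x y).
Proof.
move=> [d0 h] /andP[s0 s1]; split => // i0 i; rewrite ord1 => {i0}; rewrite !mxE /=.
have hi := h 0 i; move: hi; rewrite -ball_normE /= => hi.
have [->|im] := eqVneq i m; last first.
  rewrite ?andbF !mulr0 add0r; case: ifP => // _.
  by rewrite subrr normr0.
have := h 0 m; rewrite -ball_normE /= => hm.
rewrite ltnn mulr1 (_ : _ - _ = s * (x 0 m - y 0 m)); last by ring.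
rewrite normrM ger0_norm // (le_lt_trans _ hm) // ler_piMl //.
Qed.

Lemma is_derive_ray (F : E -> R) (v w : E) (r d : R) :
  is_derive (r *: v + w) v F d -> is_derive r 1 (fun r => F (r *: v + w)) d.
Proof.
move=> /is_derive_line h.
have -> : (fun r => F (r *: v + w)) =
   (fun h => F (h *: v + (r *: v + w))) \o (fun r' => r' - r).
  by apply/funext => r' /=; rewrite addrA -scalerDl subrK.
rewrite -[d]mulr1; apply: is_derive1_comp.
  by rewrite subrr.
by apply: is_derive_eq; rewrite subr0.
Qed.

Lemma mx_cont (T : topologicalType) (g : T -> E) (t : T) :
  (forall i, {for t, continuous (fun s => g s 0 i)}) -> {for t, continuous g}.
Proof.
move=> h; apply/cvg_ballP => e e0.
have : \forall s \near t, forall i, ball (g t 0 i) e (g s 0 i).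
  by apply: filter_forall => i; have /cvg_ballP := h i; exact.
by apply: filterS => s hs; split => // i0 i; rewrite ord1.
Qed.

Lemma cont_epsP (f : E -> R) (x : E) :
  {for x, continuous f} <-> forall e : R, 0 < e -> \forall y \near x, `|f x - f y| < e.
Proof. exact: (@cvgrPdist_lt R R _ (nbhs x) _ f (f x)). Qed.

(** The increment from x to y is split into steps along the coordinate axes, and the
    mean value theorem on each step turns the quotient into a partial derivative at an
    intermediate point, continuous at x. In this form the chain rule is algebra. *)
Lemma caratheodory (F : E -> R) (G : 'I_4 -> E -> R) (x : E) : x != 0 ->
  (forall (y : E) (i : 'I_4), y != 0 -> is_derive y (e_ i) F (G i y)) ->
  (forall i, {for x, continuous (G i)}) ->
  exists Phi : 'I_4 -> E -> R,
   [/\ forall y, F y - F x = \sum_i Phi i y * (y 0 i - x 0 i),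
       forall i, {for x, continuous (Phi i)} & forall i, Phi i x = G i x].
Proof.
move=> x0 dF cG.
pose Phi (i : 'I_4) (y : E) := if y 0 i == x 0 i then G i x
   else (F (mix i.+1 x y) - F (mix i x y)) / (y 0 i - x 0 i).
have PhiE (i : 'I_4) (y : E) : F (mix i.+1 x y) - F (mix i x y) = Phi i y * (y 0 i - x 0 i).
  rewrite /Phi; case: eqP => [e|/eqP ne]; last by rewrite divfK // subr_eq0.
  by rewrite mix_S e subrr scale0r add0r subrr mulr0.
exists Phi; split=> [y|i|i]; last by rewrite /Phi eqxx.
- rewrite -(eq_bigr _ (fun i _ => PhiE i y)).
  rewrite -(big_mkord xpredT (fun i => F (mix i.+1 x y) - F (mix i x y))).
  rewrite telescope_sumr //; congr (F _ - F _).
    by apply/rowP => i; rewrite mxE ltn_ord.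
  by apply/rowP => i; rewrite mxE ltn0.
apply/cont_epsP => e e0.
have h1 : \forall y \near x, `|G i x - G i y| < e.
  by move: e e0; apply/cont_epsP; exact: cG.
have h2 : \forall y \near x, `|G i x - G i y| < e /\ y != 0.
  by apply: filterS2 h1 (near_neq0 x0).
have /nbhs_ballP[d /= d0 hd] := h2.
apply/nbhs_ballP; exists d => //= y bxy.
rewrite {1}/Phi eqxx.
have [yx|yx] := eqVneq (y 0 i) (x 0 i); first by rewrite /Phi yx eqxx subrr normr0.
pose g s := F (s *: ((y 0 i - x 0 i) *: e_ i) + mix i x y).
pose pt s := s *: ((y 0 i - x 0 i) *: e_ i) + mix i x y.
have dg (s : R) : 0 <= s <= 1 -> is_derive s 1 g (G i (pt s) * (y 0 i - x 0 i)).
  move=> s01; have [_ ps0] := hd _ (ball_mix i bxy s01).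
  have h := dF (pt s) i ps0.
  pose g0 r := F (r *: e_ i + mix i x y).
  have -> : g = g0 \o (fun s => s * (y 0 i - x 0 i)).
    by apply/funext => s' /=; rewrite /g /g0 scalerA.
  apply: is_derive1_comp; first by apply: is_derive_ray; rewrite -scalerA.
  by apply: is_derive_eq; rewrite /= scaler0 add0r /GRing.scale /= mulr1.
have [| |c c01] := @MVT_segment R g (fun s => G i (pt s) * (y 0 i - x 0 i)) 0 1 ler01.
- by move=> s s01; apply: dg; have := subset_itv_oo_cc s01; rewrite in_itv.
- apply: derivable_within_continuous => s s01.
  by have [] := dg s; rewrite in_itv /= in s01.
rewrite subr0 mulr1 {1 2}/g scale1r scale0r add0r -mix_S PhiE => eqP.
have -> : Phi i y = G i (pt c) by apply: (mulIf _ eqP); rewrite subr_eq0.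
have [|h _] := hd (pt c) _; last exact: h.
by apply: ball_mix; rewrite // in_itv /= in c01.
Qed.

Lemma chain (F : E -> R) (G : 'I_4 -> E -> R) (g : R -> E) (t : R) (dg : E) :
  g t != 0 ->
  (forall (y : E) (i : 'I_4), y != 0 -> is_derive y (e_ i) F (G i y)) ->
  (forall i, {for g t, continuous (G i)}) ->
  (forall i, is_derive t 1 (fun s => g s 0 i) (dg 0 i)) ->
  is_derive t 1 (fun s => F (g s)) (\sum_i G i (g t) * dg 0 i).
Proof.
move=> g0 dF cG dgi; have [Phi [h1 h2 h3]] := caratheodory g0 dF cG.
have /choice[k hk] : forall i, exists k : R -> R,
   [/\ forall z, g z 0 i - g t 0 i = k z * (z - t), {for t, continuous k} & k t = dg 0 i].
  by move=> i; apply/is_derive1_caratheodory.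
have cg : {for t, continuous g} by apply: mx_cont => i; exact: is_derive_cont (dgi i).
apply/is_derive1_caratheodory; exists (fun z => \sum_i Phi i (g z) * k i z); split.
- move=> z; rewrite h1 mulr_suml; apply: eq_bigr => i _.
  by have [-> _ _] := hk i; rewrite mulrA.
- apply: sum_cont => i; have [_ ck _] := hk i; apply: continuousM => //.
  exact: continuous_comp cg (h2 i).
- by apply: eq_bigr => i _; have [_ _ ->] := hk i; rewrite h3.
Qed.

Section Curve.
Variables (f : E -> R) (hf : C2_S3 f).

Lemma rext_curve (g : R -> E) (t : R) (dg : E) : g t != 0 ->
  (forall i, is_derive t 1 (fun s => g s 0 i) (dg 0 i)) ->
  is_derive t 1 (fun s => rext f (g s)) (dot (grad f (g t)) dg).
Proof.
move=> g0 dgi; have h := C2_S3_jet hf.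
apply: is_derive_eq (chain (G := fun i => pd i (rext f)) g0 _ _ dgi) _.
- by move=> y i y0; have [_ /(_ i)[]] := h y y0.
- by move=> i; have [_ /(_ i)[]] := h _ g0.
- by apply: eq_bigr => i _; rewrite mxE.
Qed.

Lemma grad_curve (g w : R -> E) (t : R) (dg dw : E) : g t != 0 ->
  (forall i, is_derive t 1 (fun s => g s 0 i) (dg 0 i)) ->
  (forall i, is_derive t 1 (fun s => w s 0 i) (dw 0 i)) ->
  is_derive t 1 (fun s => dot (grad f (g s)) (w s))
   (hessian f (g t) (w t) dg + dot (grad f (g t)) dw).
Proof.
move=> g0 dgi dwi; have h := C2_S3_jet hf.
have d1 i : is_derive t 1 (fun s => pd i (rext f) (g s))
    (\sum_j pd j (pd i (rext f)) (g t) * dg 0 j).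
  apply: (chain (G := fun j => pd j (pd i (rext f)))) => //.
  - by move=> y j y0; have [_ _ /(_ i j)[]] := h y y0.
  - by move=> j; have [_ _ /(_ i j)[]] := h _ g0.
have d2 := is_derive_sum (fun i => is_deriveM (d1 i) (dwi i)).
have -> : (fun s => dot (grad f (g s)) (w s)) =
   \sum_(i < 4) ((fun s => pd i (rext f) (g s)) * (fun s => w s 0 i)).
  apply/funext => s; rewrite fct_sumE; apply: eq_bigr => i _.
  by rewrite /grad mxE.
apply: is_derive_eq d2 _.
rewrite /hessian /dot -big_split; apply: eq_bigr => i _ /=.
rewrite mxE addrC /GRing.scale /= mulr_sumr; congr (_ + _).
by apply: eq_bigr => j _; ring.
Qed.

Let ray (x : E) (s : R) : E := s *: x.

Let ray_deriv x i (t : R) : is_derive t 1 (fun s => ray x s 0 i) (x 0 i).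
Proof.
rewrite /ray (_ : (fun s => _) = fun s => s * x 0 i); last by apply/funext => s; rewrite mxE.
by apply: is_derive_eq; rewrite /= scaler0 add0r /GRing.scale /= mulr1.
Qed.

Lemma rext_ray x s : 0 < s -> rext f (s *: x) = rext f x.
Proof.
move=> s0; rewrite /rext; have -> : enorm (s *: x) = s * enorm x.
  rewrite /enorm dotZl dotZr mulrA -expr2 sqrtrM ?sqr_ge0 // sqrtr_sqr.
  by rewrite gtr0_norm.
by rewrite scalerA invfM -mulrA mulrC -mulrA divff ?mulr1 // gt_eqF.
Qed.

Let near1 : \forall s \near (1 : R), 0 < s.
Proof. exact: lt_nbhsr. Qed.

(** [rext f] is constant along rays. *)
Lemma euler1 x : x != 0 -> dot (grad f x) x = 0.
Proof.
move=> x0; have h := @rext_curve (ray x) 1 x; rewrite /ray scale1r in h.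
have [_ <-] := h x0 (fun i => ray_deriv x i 1).
rewrite (@near_eq_derive _ _ _ _ (cst (rext f x))) ?derive_cst //.
by apply: filterS near1 => s s0; exact: rext_ray.
Qed.

Lemma euler2 x : x != 0 -> hessian f x x x = 0.
Proof.
move=> x0; have h := @grad_curve (ray x) (ray x) 1 x x; rewrite /ray scale1r in h.
have [_ ] := h x0 (fun i => ray_deriv x i 1) (fun i => ray_deriv x i 1).
rewrite (@near_eq_derive _ _ _ _ (cst 0)) ?derive_cst; last first.
  apply: filterS near1 => s s0; apply: euler1.
  by rewrite scaler_eq0 negb_or x0 gt_eqF.
by rewrite euler1 // addr0 => <-.
Qed.

End Curve.

End Chain.

(** * The Hopf frame *)

Section Hopf.
Variable R : realType.
Local Notation E := 'rV[R]_4.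

Lemma forall_ord4 (P : 'I_4 -> Prop) :
  P (Ordinal (isT : (0 < 4)%N)) -> P (Ordinal (isT : (1 < 4)%N)) ->
  P (Ordinal (isT : (2 < 4)%N)) -> P (Ordinal (isT : (3 < 4)%N)) -> forall i, P i.
Proof.
move=> p0 p1 p2 p3 [[|[|[|[|m]]]] hm] //; by rewrite (bool_irrelevance hm isT).
Qed.

Lemma sum4 (F : 'I_4 -> R) : \sum_i F i =
  F (Ordinal (isT : (0 < 4)%N)) + F (Ordinal (isT : (1 < 4)%N)) +
  F (Ordinal (isT : (2 < 4)%N)) + F (Ordinal (isT : (3 < 4)%N)).
Proof.
rewrite !big_ord_recl big_ord0 addr0 !addrA.
by congr (_ + _ + _ + _); congr F; exact: val_inj.
Qed.

Definition row4 (a b c d : R) : E := \row_(i < 4) [:: a; b; c; d]`_i.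

Definition heta (t a b : R) := row4 (- sin t * cos a) (- sin t * sin a)
  (cos t * cos b) (cos t * sin b).
Definition tang1 (a : R) := row4 (- sin a) (cos a) 0 0.
Definition tang2 (b : R) := row4 0 0 (- sin b) (cos b).
Definition nor1 (a : R) := row4 (cos a) (sin a) 0 0.
Definition nor2 (b : R) := row4 0 0 (cos b) (sin b).

Lemma hopfE t a b : hopf t a b = cos t *: nor1 a + sin t *: nor2 b.
Proof.
by apply/rowP; apply: forall_ord4; rewrite !mxE /= ?mulr0 ?addr0 ?add0r.
Qed.

Lemma hetaE t a b : heta t a b = - sin t *: nor1 a + cos t *: nor2 b.
Proof.
by apply/rowP; apply: forall_ord4; rewrite !mxE /= ?mulr0 ?addr0 ?add0r.
Qed.

Lemma hopf_S3 (t a b : R) : S3 (hopf t a b).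
Proof.
apply/S3P; rewrite /dot sum4 !mxE /=.
have h1 := cos2Dsin2 t; have h2 := cos2Dsin2 a; have h3 := cos2Dsin2 b.
transitivity (cos t ^+ 2 * (cos a ^+ 2 + sin a ^+ 2) + sin t ^+ 2 * (cos b ^+ 2 + sin b ^+ 2)).
  ring.
by rewrite h2 h3 !mulr1.
Qed.

Lemma hopf_neq0 (t a b : R) : hopf t a b != 0. Proof. exact/S3_neq0/hopf_S3. Qed.

Lemma hopf_frame (t a b : R) : 1%:M = Mhess (hopf t a b) (hopf t a b) +
  Mhess (heta t a b) (heta t a b) + Mhess (tang1 a) (tang1 a) + Mhess (tang2 b) (tang2 b).
Proof.
have h1 : sin t ^+ 2 = 1 - cos t ^+ 2 by rewrite -(cos2Dsin2 t); ring.
have h2 : sin a ^+ 2 = 1 - cos a ^+ 2 by rewrite -(cos2Dsin2 a); ring.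
have h3 : sin b ^+ 2 = 1 - cos b ^+ 2 by rewrite -(cos2Dsin2 b); ring.
apply/matrixP => i j; move: i; apply: forall_ord4; move: j;
  apply: forall_ord4; rewrite !mxE /=; ring: h1 h2 h3.
Qed.

Lemma hessianZr (f : E -> R) x u k w : hessian f x u (k *: w) = k * hessian f x u w.
Proof.
rewrite /hessian mulr_sumr; apply: eq_bigr => i _; rewrite mulr_sumr.
by apply: eq_bigr => j _; rewrite mxE; ring.
Qed.

Lemma op2D M N (f : E -> R) x : op2 (M + N) f x = op2 M f x + op2 N f x.
Proof.
rewrite /op2 -big_split; apply: eq_bigr => i _; rewrite -big_split.
by apply: eq_bigr => j _ /=; rewrite mxE mulrDl.
Qed.

(** The second derivative along the ray vanishes by [euler2], which leaves the three
    tangent vectors of the orthonormal frame. *)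
Lemma hopf_laplacian f t a b : C2_S3 f -> let h := hopf t a b in
  laplacian f h = hessian f h (heta t a b) (heta t a b) +
   hessian f h (tang1 a) (tang1 a) + hessian f h (tang2 b) (tang2 b).
Proof.
move=> hf h; rewrite laplacianE (hopf_frame t a b) !op2D -!hessianE.
by rewrite euler2 ?add0r //; exact: hopf_neq0.
Qed.

Ltac entries := apply: forall_ord4; under eq_fun do rewrite mxE /=;
  rewrite !mxE /=; apply: is_derive_eq; rewrite /GRing.scale /=; ring.

Lemma dhopf_t (t a b : R) i :
  is_derive t 1 (fun s => hopf s a b 0 i) (heta t a b 0 i).
Proof. by move: i; entries. Qed.

Lemma dheta_t (t a b : R) i :
  is_derive t 1 (fun s => heta s a b 0 i) ((- hopf t a b) 0 i).
Proof. by move: i; entries. Qed.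

Lemma dhopf_a (t a b : R) i :
  is_derive a 1 (fun s => hopf t s b 0 i) ((cos t *: tang1 a) 0 i).
Proof. by move: i; entries. Qed.

Lemma dhopf_b (t a b : R) i :
  is_derive b 1 (fun s => hopf t a s 0 i) ((sin t *: tang2 b) 0 i).
Proof. by move: i; entries. Qed.

Lemma dtang1 (a : R) i : is_derive a 1 (fun s => tang1 s 0 i) ((- nor1 a) 0 i).
Proof. by move: i; entries. Qed.

Lemma dtang2 (b : R) i : is_derive b 1 (fun s => tang2 s 0 i) ((- nor2 b) 0 i).
Proof. by move: i; entries. Qed.

End Hopf.

(** * Green's identity on the sphere *)

Section Green.
Variable R : realType.
Local Notation E := 'rV[R]_4.

Section Continuity.
Variables (T : topologicalType) (p : T).

Lemma eq_cont (g g' : T -> R) : g' =1 g -> {for p, continuous g} ->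
  {for p, continuous g'}.
Proof. by move=> /funext ->. Qed.

Lemma entry_cont (g : T -> E) i : {for p, continuous g} ->
  {for p, continuous (fun s => g s 0 i)}.
Proof.
move=> cg; apply: (@continuous_comp _ _ _ g (fun y : E => y 0 i)) => //.
exact: coord_continuous.
Qed.

Lemma dot_cont (g w : T -> E) : {for p, continuous g} -> {for p, continuous w} ->
  {for p, continuous (fun s => dot (g s) (w s))}.
Proof.
by move=> cg cw; apply: sum_cont => i; apply: continuousM; exact: entry_cont.
Qed.

Lemma row4_cont (a b c d : T -> R) : {for p, continuous a} ->
  {for p, continuous b} -> {for p, continuous c} -> {for p, continuous d} ->
  {for p, continuous (fun s => row4 (a s) (b s) (c s) (d s))}.
Proof.
move=> ca cb cc cd; apply: mx_cont; apply: forall_ord4.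
- by apply: (eq_cont (g := a)) => // s; rewrite mxE.
- by apply: (eq_cont (g := b)) => // s; rewrite mxE.
- by apply: (eq_cont (g := c)) => // s; rewrite mxE.
- by apply: (eq_cont (g := d)) => // s; rewrite mxE.
Qed.

Lemma cos_cont (g : T -> R) : {for p, continuous g} ->
  {for p, continuous (fun s => cos (g s))}.
Proof. by move=> cg; apply: (continuous_comp cg); exact: continuous_cos. Qed.

Lemma sin_cont (g : T -> R) : {for p, continuous g} ->
  {for p, continuous (fun s => sin (g s))}.
Proof. by move=> cg; apply: (continuous_comp cg); exact: continuous_sin. Qed.

Variables (f : E -> R) (hf : C2_S3 f).

Lemma rext_cont (g : T -> E) : {for p, continuous g} -> g p != 0 ->
  {for p, continuous (fun s => rext f (g s))}.
Proof. by move=> cg g0; apply: (continuous_comp cg); have [] := hf g0. Qed.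

Lemma grad_cont (g w : T -> E) : {for p, continuous g} -> g p != 0 ->
  {for p, continuous w} -> {for p, continuous (fun s => dot (grad f (g s)) (w s))}.
Proof.
move=> cg g0 cw; apply: dot_cont => //; apply: mx_cont => i.
apply: (eq_cont (g := fun s => pd i (rext f) (g s))) => [s|]; first by rewrite mxE.
by apply: (continuous_comp cg); have [_ /(_ i)[]] := hf g0.
Qed.

Lemma hessian_cont (g w : T -> E) : {for p, continuous g} -> g p != 0 ->
  {for p, continuous w} -> {for p, continuous (fun s => hessian f (g s) (w s) (w s))}.
Proof.
move=> cg g0 cw; have ci i : {for p, continuous (fun s => w s 0 i)} by exact: entry_cont.
apply: sum_cont => i; apply: sum_cont => j; apply: continuousM.
  by apply: continuousM.
by apply: (continuous_comp cg); have [_ _ /(_ i j)[]] := hf g0.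
Qed.

End Continuity.

Lemma cont_C2 (f : E -> R) : C2_S3 f -> cont3 (fun t a b => f (hopf t a b)).
Proof.
move=> hf p; have -> : (fun p : R * R * R => f (hopf p.1.1 p.1.2 p.2)) =
   fun p => rext f (hopf p.1.1 p.1.2 p.2).
  by apply/funext => q; rewrite rext_S3 //; exact: hopf_S3.
have c1 : {for p, continuous (fun p : R * R * R => p.1.1)}.
  by apply: (@continuous_comp _ _ _ fst fst); exact: fst_cont.
have c2 : {for p, continuous (fun p : R * R * R => p.1.2)}.
  by apply: (@continuous_comp _ _ _ fst snd); [exact: fst_cont|exact: snd_cont].
have c3 : {for p, continuous (fun p : R * R * R => p.2)} by exact: snd_cont.
apply: (@rext_cont _ _ _ hf (fun p : R * R * R => hopf p.1.1 p.1.2 p.2)); last exact: hopf_neq0.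
apply: (@row4_cont _ p (fun p => cos p.1.1 * cos p.1.2) (fun p => cos p.1.1 * sin p.1.2)
  (fun p => sin p.1.1 * cos p.2) (fun p => sin p.1.1 * sin p.2));
  by apply: continuousM; do ?[exact: cos_cont|exact: sin_cont].
Qed.

Lemma cont3_mul (A B : R -> R -> R -> R) : cont3 A -> cont3 B ->
  cont3 (fun t a b => A t a b * B t a b).
Proof. by move=> cA cB p; apply: continuousM; [exact: cA|exact: cB]. Qed.

Lemma cont3_add (A B : R -> R -> R -> R) : cont3 A -> cont3 B ->
  cont3 (fun t a b => A t a b + B t a b).
Proof. by move=> cA cB p; apply: continuousD; [exact: cA|exact: cB]. Qed.

Lemma cont3_sub (A B : R -> R -> R -> R) : cont3 A -> cont3 B ->
  cont3 (fun t a b => A t a b - B t a b).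
Proof. by move=> cA cB p; apply: continuousB; [exact: cA|exact: cB]. Qed.

Lemma cont3_t (g : R -> R) : continuous g -> cont3 (fun t _ _ => g t).
Proof.
move=> cg p; apply: (@continuous_comp _ _ _ (fun p : R * R * R => p.1.1) g).
  by apply: (@continuous_comp _ _ _ fst fst); exact: fst_cont.
exact: cg.
Qed.

(** DVi, SVi and NVi stand for the first and second derivatives of V along the frame
    and its components along the normal vectors, which appear because the frame rotates.
    The integrand is the sum of three exact derivatives. The boundary terms vanish, in t
    because sin t cos t does, in a and b by periodicity; the NVi cancel against the
    derivative of sin t cos t since the gradient has no radial part. *)
Lemma box_green (V DV0 DV1 DV2 NV1 NV2 SV0 SV1 SV2
   W DW0 DW1 DW2 NW1 NW2 SW0 SW1 SW2 : R -> R -> R -> R) :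
  [/\ cont3 V, cont3 DV0, cont3 DV1, cont3 DV2 & cont3 NV1] ->
  [/\ cont3 NV2, cont3 SV0, cont3 SV1 & cont3 SV2] ->
  [/\ cont3 W, cont3 DW0, cont3 DW1, cont3 DW2 & cont3 NW1] ->
  [/\ cont3 NW2, cont3 SW0, cont3 SW1 & cont3 SW2] ->
  (forall t a b : R, [/\ is_derive t 1 (fun s => V s a b) (DV0 t a b),
     is_derive a 1 (fun s => V t s b) (cos t * DV1 t a b) &
     is_derive b 1 (fun s => V t a s) (sin t * DV2 t a b)]) ->
  (forall t a b : R, [/\ is_derive t 1 (fun s => DV0 s a b) (SV0 t a b),
     is_derive a 1 (fun s => DV1 t s b) (cos t * SV1 t a b - NV1 t a b) &
     is_derive b 1 (fun s => DV2 t a s) (sin t * SV2 t a b - NV2 t a b)]) ->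
  (forall t a b : R, [/\ is_derive t 1 (fun s => W s a b) (DW0 t a b),
     is_derive a 1 (fun s => W t s b) (cos t * DW1 t a b) &
     is_derive b 1 (fun s => W t a s) (sin t * DW2 t a b)]) ->
  (forall t a b : R, [/\ is_derive t 1 (fun s => DW0 s a b) (SW0 t a b),
     is_derive a 1 (fun s => DW1 t s b) (cos t * SW1 t a b - NW1 t a b) &
     is_derive b 1 (fun s => DW2 t a s) (sin t * SW2 t a b - NW2 t a b)]) ->
  (forall t a b : R, (cos t ^+ 2 - sin t ^+ 2) * DV0 t a b =
     sin t * NV1 t a b + cos t * NV2 t a b) ->
  (forall t a b : R, (cos t ^+ 2 - sin t ^+ 2) * DW0 t a b =
     sin t * NW1 t a b + cos t * NW2 t a b) ->
  (forall t b : R, [/\ V t 0 b = V t (2 * pi) b, W t 0 b = W t (2 * pi) b,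
     DV1 t 0 b = DV1 t (2 * pi) b & DW1 t 0 b = DW1 t (2 * pi) b]) ->
  (forall t a : R, [/\ V t a 0 = V t a (2 * pi), W t a 0 = W t a (2 * pi),
     DV2 t a 0 = DV2 t a (2 * pi) & DW2 t a 0 = DW2 t a (2 * pi)]) ->
  itg3 (fun t a b => (V t a b * (SW0 t a b + SW1 t a b + SW2 t a b) -
      W t a b * (SV0 t a b + SV1 t a b + SV2 t a b)) * (sin t * cos t)) = 0.
Proof.
move=> [cV cD0 cD1 cD2 cN1] [cN2 cS0 cS1 cS2] [cW cE0 cE1 cE2 cM1] [cM2 cT0 cT1 cT2].
move=> dV dD dW dE radV radW per1 per2.
have cc : cont3 (fun t _ _ => cos t : R) by apply: cont3_t; exact: continuous_cos.
have cs : cont3 (fun t _ _ => sin t : R) by apply: cont3_t; exact: continuous_sin.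
pose X0 t a b := (sin t * cos t) * (V t a b * DW0 t a b - W t a b * DV0 t a b).
pose X0' t a b := (cos t * cos t - sin t * sin t) *
   (V t a b * DW0 t a b - W t a b * DV0 t a b) +
   (sin t * cos t) * (V t a b * SW0 t a b - W t a b * SV0 t a b).
pose X1 t a b := sin t * (V t a b * DW1 t a b - W t a b * DV1 t a b).
pose X1' t a b := sin t * (V t a b * (cos t * SW1 t a b - NW1 t a b)
   - W t a b * (cos t * SV1 t a b - NV1 t a b)).
pose X2 t a b := cos t * (V t a b * DW2 t a b - W t a b * DV2 t a b).
pose X2' t a b := cos t * (V t a b * (sin t * SW2 t a b - NW2 t a b)
   - W t a b * (sin t * SV2 t a b - NV2 t a b)).
have cX0 : cont3 X0
  := (cont3_mul (cont3_mul cs cc) (cont3_sub (cont3_mul cV cE0) (cont3_mul cW cD0))).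
have cX0' : cont3 X0'
  := (cont3_add (cont3_mul (cont3_sub (cont3_mul cc cc) (cont3_mul cs cs))
      (cont3_sub (cont3_mul cV cE0) (cont3_mul cW cD0)))
    (cont3_mul (cont3_mul cs cc) (cont3_sub (cont3_mul cV cT0) (cont3_mul cW cS0)))).
have cX1 : cont3 X1
  := (cont3_mul cs (cont3_sub (cont3_mul cV cE1) (cont3_mul cW cD1))).
have cX1' : cont3 X1'
  := (cont3_mul cs (cont3_sub (cont3_mul cV (cont3_sub (cont3_mul cc cT1) cM1))
    (cont3_mul cW (cont3_sub (cont3_mul cc cS1) cN1)))).
have cX2' : cont3 X2'
  := (cont3_mul cc (cont3_sub (cont3_mul cV (cont3_sub (cont3_mul cs cT2) cM2))
    (cont3_mul cW (cont3_sub (cont3_mul cs cS2) cN2)))).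
have J0 : itg3 X0' = 0.
  apply: (itg3_d0 cX0 cX0').
  - move=> t a b; have [v _ _] := dV t a b; have [w _ _] := dW t a b.
    have [v' _ _] := dD t a b; have [w' _ _] := dE t a b.
    apply: is_derive_eq (is_deriveM (is_deriveM (is_derive_sin t) (is_derive_cos t))
      (is_deriveB (is_deriveM v w') (is_deriveM w v'))) _.
    by rewrite /X0' /GRing.scale /= !fctE; ring.
  - by move=> a b; rewrite /X0 sin0 !mul0r.
  - by move=> a b; rewrite /X0 cos_pihalf mulr0 mul0r.
have J1 : itg3 X1' = 0.
  apply: (itg3_d1 cX1 cX1').
  - move=> t a b; have [_ v _] := dV t a b; have [_ w _] := dW t a b.
    have [_ v' _] := dD t a b; have [_ w' _] := dE t a b.
    apply: is_derive_eq (is_deriveM (is_derive_cst (sin t) a 1)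
      (is_deriveB (is_deriveM v w') (is_deriveM w v'))) _.
    by rewrite /X1' /GRing.scale /= !fctE; ring.
  - by move=> t b; rewrite /X1; have [-> -> -> ->] := per1 t b.
have J2 : itg3 X2' = 0.
  apply: (@itg3_d2 _ X2 X2' cX2').
  - move=> t a b; have [_ _ v] := dV t a b; have [_ _ w] := dW t a b.
    have [_ _ v'] := dD t a b; have [_ _ w'] := dE t a b.
    apply: is_derive_eq (is_deriveM (is_derive_cst (cos t) b 1)
      (is_deriveB (is_deriveM v w') (is_deriveM w v'))) _.
    by rewrite /X2' /GRing.scale /= !fctE; ring.
  - by move=> t a; rewrite /X2; have [-> -> -> ->] := per2 t a.
rewrite (_ : (fun t a b => _) = (fun t a b => X0' t a b + X1' t a b + X2' t a b)).
  rewrite (@itg3_add _ (fun t a b => X0' t a b + X1' t a b) X2') //.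
    by rewrite itg3_add // J0 J1 J2 !addr0.
  exact: cont3_add.
apply/funext => t; apply/funext => a; apply/funext => b; rewrite /X0' /X1' /X2' -!expr2.
rewrite [(cos t ^+ 2 - _) * _](_ : _ = V t a b * ((cos t ^+ 2 - sin t ^+ 2) * DW0 t a b)
    - W t a b * ((cos t ^+ 2 - sin t ^+ 2) * DV0 t a b)); last by ring.
by rewrite radV radW; ring.
Qed.

Section GreenIdentity.
Variables (f Y : E -> R) (hf : C2_S3 f) (hY : C2_S3 Y).

Let V (f : E -> R) (t a b : R) := f (hopf t a b).
Let D0 (f : E -> R) (t a b : R) := dot (grad f (hopf t a b)) (heta t a b).
Let D1 (f : E -> R) (t a b : R) := dot (grad f (hopf t a b)) (tang1 a).
Let D2 (f : E -> R) (t a b : R) := dot (grad f (hopf t a b)) (tang2 b).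
Let N1 (f : E -> R) (t a b : R) := dot (grad f (hopf t a b)) (nor1 a).
Let N2 (f : E -> R) (t a b : R) := dot (grad f (hopf t a b)) (nor2 b).
Let S0 (f : E -> R) (t a b : R) := hessian f (hopf t a b) (heta t a b) (heta t a b).
Let S1 (f : E -> R) (t a b : R) := hessian f (hopf t a b) (tang1 a) (tang1 a).
Let S2 (f : E -> R) (t a b : R) := hessian f (hopf t a b) (tang2 b) (tang2 b).

Section One.
Variables (F : E -> R) (hF : C2_S3 F).

Let VE : V F = fun t a b => rext F (hopf t a b).
Proof.
apply/funext => t; apply/funext => a; apply/funext => b.
by rewrite rext_S3 //; exact: hopf_S3.
Qed.

Lemma dV_t (t a b : R) : is_derive t 1 (fun s => V F s a b) (D0 F t a b).
Proof.
rewrite VE; apply: (rext_curve hF (g := fun s => hopf s a b)); first exact: hopf_neq0.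
exact: dhopf_t.
Qed.

Lemma dV_a (t a b : R) : is_derive a 1 (fun s => V F t s b) (cos t * D1 F t a b).
Proof.
rewrite VE /D1 -dotZr.
apply: (rext_curve hF (g := fun s => hopf t s b)); first exact: hopf_neq0.
exact: dhopf_a.
Qed.

Lemma dV_b (t a b : R) : is_derive b 1 (fun s => V F t a s) (sin t * D2 F t a b).
Proof.
rewrite VE /D2 -dotZr.
apply: (rext_curve hF (g := fun s => hopf t a s)); first exact: hopf_neq0.
exact: dhopf_b.
Qed.

Lemma dD0 (t a b : R) : is_derive t 1 (fun s => D0 F s a b) (S0 F t a b).
Proof.
have := grad_curve hF (g := fun s => hopf s a b) (w := fun s => heta s a b)
  (hopf_neq0 t a b) (dhopf_t t a b) (dheta_t t a b).
by rewrite dotNr euler1 ?oppr0 ?addr0 //; exact: hopf_neq0.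
Qed.

Lemma dD1 (t a b : R) :
  is_derive a 1 (fun s => D1 F t s b) (cos t * S1 F t a b - N1 F t a b).
Proof.
have := grad_curve hF (g := fun s => hopf t s b) (w := fun s => tang1 s)
  (hopf_neq0 t a b) (dhopf_a t a b) (dtang1 a).
by rewrite hessianZr dotNr.
Qed.

Lemma dD2 (t a b : R) :
  is_derive b 1 (fun s => D2 F t a s) (sin t * S2 F t a b - N2 F t a b).
Proof.
have := grad_curve hF (g := fun s => hopf t a s) (w := fun s => tang2 s)
  (hopf_neq0 t a b) (dhopf_b t a b) (dtang2 b).
by rewrite hessianZr dotNr.
Qed.

(** grad F is orthogonal to hopf = cos t nor1 + sin t nor2. *)
Lemma radial (t a b : R) : (cos t ^+ 2 - sin t ^+ 2) * D0 F t a b =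
  sin t * N1 F t a b + cos t * N2 F t a b.
Proof.
have h0 : cos t * N1 F t a b + sin t * N2 F t a b = 0.
  by rewrite -!dotZr -dotDr -hopfE euler1 //; exact: hopf_neq0.
have h1 := cos2Dsin2 t.
have -> : D0 F t a b = - sin t * N1 F t a b + cos t * N2 F t a b.
  by rewrite /D0 hetaE dotDr !dotZr.
apply/eqP; rewrite -subr_eq0; apply/eqP.
transitivity (- 2 * sin t * cos t * (cos t * N1 F t a b + sin t * N2 F t a b)
  + (sin t * N1 F t a b + cos t * N2 F t a b) * (cos t ^+ 2 + sin t ^+ 2 - 1)).
  ring.
by rewrite h0 h1 subrr !mulr0 addr0.
Qed.

Lemma cont_V : cont3 (V F). Proof. exact: cont_C2. Qed.

Section At.
Variable p : R * R * R.
Let c1 : {for p, continuous (fun p : R * R * R => p.1.1)}.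
Proof. by apply: (@continuous_comp _ _ _ fst fst); exact: fst_cont. Qed.
Let c2 : {for p, continuous (fun p : R * R * R => p.1.2)}.
Proof. by apply: (@continuous_comp _ _ _ fst snd); [exact: fst_cont|exact: snd_cont]. Qed.
Let c3 : {for p, continuous (fun p : R * R * R => p.2)}.
Proof. exact: snd_cont. Qed.
Let ch : {for p, continuous (fun p : R * R * R => hopf p.1.1 p.1.2 p.2)}.
Proof.
apply: (@row4_cont _ p (fun p => cos p.1.1 * cos p.1.2) (fun p => cos p.1.1 * sin p.1.2)
  (fun p => sin p.1.1 * cos p.2) (fun p => sin p.1.1 * sin p.2));
  by apply: continuousM; do ?[exact: cos_cont|exact: sin_cont].
Qed.
Let cn1 : {for p, continuous (fun p : R * R * R => nor1 p.1.2)}.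
Proof.
by apply: row4_cont; do ?[exact: cos_cont|exact: sin_cont|exact: cst_continuous].
Qed.
Let cn2 : {for p, continuous (fun p : R * R * R => nor2 p.2)}.
Proof.
by apply: row4_cont; do ?[exact: cos_cont|exact: sin_cont|exact: cst_continuous].
Qed.
Let ct1 : {for p, continuous (fun p : R * R * R => tang1 p.1.2)}.
Proof.
apply: row4_cont; do ?[exact: cos_cont|exact: cst_continuous].
by apply: continuousN; exact: sin_cont.
Qed.
Let ct2 : {for p, continuous (fun p : R * R * R => tang2 p.2)}.
Proof.
apply: row4_cont; do ?[exact: cos_cont|exact: cst_continuous].
by apply: continuousN; exact: sin_cont.
Qed.
Let che : {for p, continuous (fun p : R * R * R => heta p.1.1 p.1.2 p.2)}.
Proof.
apply: row4_cont; apply: continuousM; do ?[exact: cos_cont|exact: sin_cont];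
  by apply: continuousN; exact: sin_cont.
Qed.

Lemma cont_at : {for p, continuous (fun p : R * R * R => D0 F p.1.1 p.1.2 p.2)} /\
  {for p, continuous (fun p : R * R * R => D1 F p.1.1 p.1.2 p.2)} /\
  {for p, continuous (fun p : R * R * R => D2 F p.1.1 p.1.2 p.2)} /\
  {for p, continuous (fun p : R * R * R => N1 F p.1.1 p.1.2 p.2)} /\
  {for p, continuous (fun p : R * R * R => N2 F p.1.1 p.1.2 p.2)} /\
  {for p, continuous (fun p : R * R * R => S0 F p.1.1 p.1.2 p.2)} /\
  {for p, continuous (fun p : R * R * R => S1 F p.1.1 p.1.2 p.2)} /\
  {for p, continuous (fun p : R * R * R => S2 F p.1.1 p.1.2 p.2)}.
Proof.
have h0 := hopf_neq0 p.1.1 p.1.2 p.2.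
pose h (p : R * R * R) := hopf p.1.1 p.1.2 p.2.
split; first exact: (@grad_cont _ p F hF h _ ch h0 che).
split; first exact: (@grad_cont _ p F hF h _ ch h0 ct1).
split; first exact: (@grad_cont _ p F hF h _ ch h0 ct2).
split; first exact: (@grad_cont _ p F hF h _ ch h0 cn1).
split; first exact: (@grad_cont _ p F hF h _ ch h0 cn2).
split; first exact: (@hessian_cont _ p F hF h _ ch h0 che).
split; first exact: (@hessian_cont _ p F hF h _ ch h0 ct1).
exact: (@hessian_cont _ p F hF h _ ch h0 ct2).
Qed.

End At.

End One.

Theorem green_identity :
  integral_S3 (fun x => f x * laplacian Y x - Y x * laplacian f x) = 0.
Proof.
have k1 (F : E -> R) : C2_S3 F ->
    [/\ cont3 (V F), cont3 (D0 F), cont3 (D1 F), cont3 (D2 F) & cont3 (N1 F)].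
  by move=> hF; split; first exact: cont_V; move=> p; have [? [? [? [? _]]]] := cont_at hF p.
have k2 (F : E -> R) : C2_S3 F ->
    [/\ cont3 (N2 F), cont3 (S0 F), cont3 (S1 F) & cont3 (S2 F)].
  by move=> hF; split; move=> p; have [? [? [? [? [? [? [? ?]]]]]]] := cont_at hF p.
have p1 t b : hopf t 0 b = hopf t (2 * pi) b :> E.
  by apply/rowP; apply: forall_ord4; rewrite !mxE //= mulr_natl ?cos0 ?sin0 ?cos2pi ?sin2pi.
have p2 : tang1 0 = tang1 (2 * pi) :> E.
  by apply/rowP; apply: forall_ord4; rewrite !mxE //= mulr_natl ?cos0 ?sin0 ?cos2pi ?sin2pi.
have p3 t a : hopf t a 0 = hopf t a (2 * pi) :> E.
  by apply/rowP; apply: forall_ord4; rewrite !mxE //= mulr_natl ?cos0 ?sin0 ?cos2pi ?sin2pi.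
have p4 : tang2 0 = tang2 (2 * pi) :> E.
  by apply/rowP; apply: forall_ord4; rewrite !mxE //= mulr_natl ?cos0 ?sin0 ?cos2pi ?sin2pi.
have h := box_green (k1 f hf) (k2 f hf) (k1 Y hY) (k2 Y hY)
  (fun t a b => And3 (dV_t hf t a b) (dV_a hf t a b) (dV_b hf t a b))
  (fun t a b => And3 (dD0 hf t a b) (dD1 hf t a b) (dD2 hf t a b))
  (fun t a b => And3 (dV_t hY t a b) (dV_a hY t a b) (dV_b hY t a b))
  (fun t a b => And3 (dD0 hY t a b) (dD1 hY t a b) (dD2 hY t a b))
  (radial hf) (radial hY) _ _.
rewrite -[RHS]h.
- rewrite /integral_S3 -/(itg1 _ _ _) /itg3; congr itg1; apply/funext => t.
  congr itg1; apply/funext => a; congr itg1; apply/funext => b.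
  by rewrite !hopf_laplacian.
- by move=> t b; rewrite /V /D1 p1 p2.
- by move=> t a; rewrite /V /D2 p3 p4.
Qed.

End GreenIdentity.

End Green.

(** * Calculus of the operator P *)

Section Psi.
Variable R : realType.
Local Notation E := 'rV[R]_4.

Definition S3cont (f : E -> R) := cont3 (fun t a b => f (hopf t a b)).

Lemma cont_sc : cont3 (fun t _ _ => sin t * cos t : R).
Proof.
exact: cont3_mul (cont3_t (@continuous_sin R)) (cont3_t (@continuous_cos R)).
Qed.

Lemma S3cont_mul (f g : E -> R) : S3cont f -> S3cont g -> S3cont (fun x => f x * g x).
Proof. exact: cont3_mul. Qed.

Lemma integral_S3E (f : E -> R) :
  integral_S3 f = itg3 (fun t a b => f (hopf t a b) * (sin t * cos t)).
Proof. by []. Qed.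

Lemma eq_integral_S3 (f g : E -> R) : (forall x, S3 x -> f x = g x) ->
  integral_S3 f = integral_S3 g.
Proof.
move=> h; rewrite !integral_S3E; congr itg3.
apply/funext => t; apply/funext => a; apply/funext => b.
by rewrite h //; exact: hopf_S3.
Qed.

Lemma integral_S3_add (f g : E -> R) : S3cont f -> S3cont g ->
  integral_S3 (fun x => f x + g x) = integral_S3 f + integral_S3 g.
Proof.
move=> cf cg; rewrite !integral_S3E -itg3_add; try exact: cont3_mul cont_sc.
congr itg3; apply/funext => t; apply/funext => a; apply/funext => b.
exact: mulrDl.
Qed.

Lemma integral_S3_scale r (f : E -> R) : S3cont f ->
  integral_S3 (fun x => r * f x) = r * integral_S3 f.
Proof.
move=> cf; rewrite !integral_S3E -itg3_scale; last exact: cont3_mul cont_sc.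
congr itg3; apply/funext => t; apply/funext => a; apply/funext => b.
exact: esym (mulrA _ _ _).
Qed.

Lemma eigen_pairing (u w Y : E -> R) (lam : R) : C2_S3 u -> S3cont w ->
  (forall x, S3 x -> - laplacian u x + u x = w x) -> eigenfunction lam Y ->
  integral_S3 (fun x => w x * Y x) = lam * integral_S3 (fun x => u x * Y x).
Proof.
move=> hu cw hw [hY eY].
have cY : S3cont Y by exact: cont_C2.
have cu : S3cont u by exact: cont_C2.
apply/eqP; rewrite -subr_eq0 -mulNr -integral_S3_scale; last exact: S3cont_mul.
rewrite -integral_S3_add; last 2 first.
- exact: S3cont_mul.
- apply: S3cont_mul (S3cont_mul cu cY).
  exact: cont_C2 (C2_cst _).
rewrite -(green_identity hu hY); apply/eqP/eq_integral_S3 => x hx.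
rewrite -(hw x hx) mulNr mulrCA -(eY x hx).
by move: (laplacian u x) (laplacian Y x) (u x) (Y x) => *; ring.
Qed.

Lemma C2_within (w : E -> R) : C2_S3 w -> {within S3 (R := R), continuous w}.
Proof.
move=> hw; apply: (@subspace_eq_continuous _ _ _ (rext w)).
  by move=> x /set_mem hx; rewrite /from_subspace /= rext_S3.
apply: continuous_in_subspaceT => x /set_mem /S3_neq0 x0.
by have [] := hw x x0.
Qed.

Lemma psi_add (v w v' w' : E -> R) : C2_S3 v -> C2_S3 w -> C2_S3 v' -> C2_S3 w' ->
  is_Psigma v w -> is_Psigma v' w' ->
  is_Psigma (fun x => v x + v' x) (fun x => w x + w' x).
Proof.
move=> hv hw hv' hw' [_ p] [_ p']; split; first exact: C2_within (C2_add hw hw').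
move=> lam Y hY; have cY := cont_C2 hY.1.
have e (f g : E -> R) : C2_S3 f -> C2_S3 g ->
  integral_S3 (fun x => (f x + g x) * Y x) =
  integral_S3 (fun x => f x * Y x) + integral_S3 (fun x => g x * Y x).
  move=> hf hg; rewrite -integral_S3_add.
  - by apply: eq_integral_S3 => x _; rewrite mulrDl.
  - exact: S3cont_mul (cont_C2 hf) cY.
  - exact: S3cont_mul (cont_C2 hg) cY.
by rewrite !e // (p _ _ hY) (p' _ _ hY) mulrDr.
Qed.

Lemma psi_scale r (v w : E -> R) : C2_S3 v -> C2_S3 w -> is_Psigma v w ->
  is_Psigma (fun x => r * v x) (fun x => r * w x).
Proof.
move=> hv hw [_ p]; split; first exact: C2_within (C2_scale r hw).
move=> lam Y hY; have cY := cont_C2 hY.1.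
have e (f : E -> R) : C2_S3 f ->
  integral_S3 (fun x => r * f x * Y x) = r * integral_S3 (fun x => f x * Y x).
  move=> hf; rewrite -integral_S3_scale; last exact: S3cont_mul (cont_C2 hf) cY.
  by apply: eq_integral_S3 => x _; rewrite mulrA.
by rewrite !e // (p _ _ hY) mulrCA.
Qed.

(** u pairs to 0 with eigenfunctions for any other eigenvalue than n^2. *)
Lemma psi_eigen (u : E -> R) (n : R) : 0 <= n -> C2_S3 u ->
  (forall x, S3 x -> - laplacian u x + u x = n ^+ 2 * u x) ->
  is_Psigma u (fun x => n * u x).
Proof.
move=> n0 hu eu; split; first exact: C2_within (C2_scale n hu).
move=> lam Y hY; have cuY := S3cont_mul (cont_C2 hu) (cont_C2 hY.1).
have h := eigen_pairing hu (cont_C2 (C2_scale _ hu)) eu hY.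
have e r : integral_S3 (fun x => r * u x * Y x) = r * integral_S3 (fun x => u x * Y x).
  rewrite -(integral_S3_scale r cuY).
  by apply: eq_integral_S3 => x _; rewrite mulrA.
rewrite e; rewrite e in h.
have [->|I0] := eqVneq (integral_S3 (fun x => u x * Y x)) 0; first by rewrite !mulr0.
by rewrite -(mulIf I0 h) sqrtr_sqr ger0_norm.
Qed.

(** Applied with y = ln eta, where eta ranges over the positive reals. *)
Lemma const_decay (f : R -> R) (C : R) : (forall y : R, is_derive y 1 f 0) ->
  (forall y, 0 <= y -> `|f y| <= C * expR (- y)) -> forall y, f y = 0.
Proof.
move=> df fC y; apply/eqP/negPn/negP => fy0.
have C0 : 0 <= C by have := fC 0 (lexx _); rewrite oppr0 expR0 mulr1; apply: le_trans.
have fy : 0 < `|f y| by rewrite normr_gt0.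
pose y0 := C / `|f y|.
have y00 : 0 <= y0 by rewrite divr_ge0.
have := fC y0 y00; rewrite (is_derive_0_is_cst y0 y df) leNgt => /negP; apply.
rewrite expRN ltr_pdivrMr ?expR_gt0 //.
have := expR_ge1Dx y0; rewrite -(ler_pM2l fy); apply: lt_le_trans.
by rewrite mulrDr mulr1 /y0 mulrCA divff ?gt_eqF // mulr1 ltrDr.
Qed.

End Psi.

(** * Rayleigh quotients *)

Section Sphere.
Variables (R : realType).

Definition nsq n (x : 'rV[R]_n) : R := \sum_i x 0 i * x 0 i.

Lemma nsq_cont n : continuous (@nsq n).
Proof.
move=> x; apply: sum_cont => i.
exact: continuousM (@coord_continuous _ _ _ 0 i x) (@coord_continuous _ _ _ 0 i x).
Qed.

Lemma nsq_ge0 n (x : 'rV[R]_n) : 0 <= nsq x.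
Proof. by apply: sumr_ge0 => i _; rewrite -expr2 sqr_ge0. Qed.

Lemma sphere_compact n : compact [set x : 'rV[R]_n | nsq x = 1].
Proof.
have cb := @rV_compact R n (fun=> `[-1, 1]%classic) (fun _ => @segment_compact R _ _).
apply: subclosed_compact cb _.
  have -> : [set x : 'rV[R]_n | nsq x = 1] = @nsq n @^-1` [set 1] by [].
  apply: closed_comp => [x _|]; first exact: nsq_cont.
  exact: closed_eq.
move=> x /= hx i; rewrite in_itv /= -ler_norml -ler_sqr ?nnegrE // expr1n.
rewrite real_normK ?num_real // -hx /nsq (bigD1 i) //= expr2 lerDl.
by apply: sumr_ge0 => j _; rewrite -expr2 sqr_ge0.
Qed.

Section Rayleigh.
Variables (k : nat) (hk : (0 < k)%N) (A : 'M[R]_k).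
Hypothesis symA : forall i j, A i j = A j i.

Definition qf (x y : 'rV[R]_k) : R := \sum_i \sum_j x 0 i * A i j * y 0 j.

Let ei : 'rV[R]_k := delta_mx 0 (Ordinal hk).

Lemma qf_mul x y : qf x y = \sum_j (x *m A) 0 j * y 0 j.
Proof.
rewrite /qf exchange_big; apply: eq_bigr => j _; rewrite mxE mulr_suml.
by [].
Qed.

Lemma qfC x y : qf x y = qf y x.
Proof.
rewrite /qf exchange_big; apply: eq_bigr => j _; apply: eq_bigr => i _.
by rewrite symA; ring.
Qed.

Lemma qfDl x y z : qf (x + y) z = qf x z + qf y z.
Proof.
rewrite !qf_mul mulmxDl -big_split; apply: eq_bigr => j _.
by rewrite mxE mulrDl.
Qed.

Lemma qfZl a x z : qf (a *: x) z = a * qf x z.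
Proof.
rewrite !qf_mul -scalemxAl mulr_sumr; apply: eq_bigr => j _.
by rewrite mxE mulrA.
Qed.

Lemma qfDr x y z : qf z (x + y) = qf z x + qf z y.
Proof. by rewrite !(qfC z) qfDl. Qed.

Lemma qfZr a x z : qf z (a *: x) = a * qf z x.
Proof. by rewrite !(qfC z) qfZl. Qed.

Lemma qf_cont : continuous (fun x => qf x x).
Proof.
move=> x; apply: sum_cont => i; apply: sum_cont => j.
apply: continuousM; last exact: coord_continuous.
apply: continuousM; first exact: coord_continuous.
exact: cst_continuous.
Qed.

Lemma nsqZ a (x : 'rV[R]_k) : nsq (a *: x) = a ^+ 2 * nsq x.
Proof. by rewrite /nsq mulr_sumr; apply: eq_bigr => i _; rewrite mxE; ring. Qed.

Lemma nsq_eq0 (x : 'rV[R]_k) : nsq x = 0 -> x = 0.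
Proof.
move=> /eqP; rewrite psumr_eq0 => [/allP h|i _]; last by rewrite -expr2 sqr_ge0.
apply/rowP => i; rewrite mxE; apply/eqP.
by have := h i (mem_index_enum _); rewrite -expr2 sqrf_eq0.
Qed.

(** A minimiser c of the quadratic form on the compact unit sphere is an eigenvector by the
    first order condition along c + t z, and its eigenvalue bounds all others below. *)
Lemma rayleigh : exists2 y : 'rV[R]_k, nsq y = 1 /\ min_eigenvalue A = qf y y &
  forall x, min_eigenvalue A * nsq x <= qf x x.
Proof.
have [||c] := @EVT_min_rV R k (fun x => qf x x) [set x | nsq x = 1] _ (@sphere_compact k).
- exists ei; rewrite /= /nsq (bigD1 (Ordinal hk)) //= big1 ?addr0 => [|i ni].
    by rewrite mxE !eqxx mulr1.
  by rewrite mxE eqxx /= (negbTE ni) mulr0.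
- exact: continuous_subspaceT qf_cont.
move=> /set_mem /= c1 hmin; pose m := qf c c.
have ge x : m * nsq x <= qf x x.
  have [n0|n0] := eqVneq (nsq x) 0.
    by rewrite n0 mulr0 (nsq_eq0 n0) -(scale0r (0 : 'rV[R]_k)) qfZl mul0r.
  have np : 0 < nsq x by rewrite lt_neqAle eq_sym n0 nsq_ge0.
  have s0 : Num.sqrt (nsq x) != 0 by rewrite gt_eqF // sqrtr_gt0.
  have := hmin ((Num.sqrt (nsq x))^-1 *: x).
  rewrite inE /= nsqZ exprVn sqr_sqrtr ?nsq_ge0 // mulVf // => /(_ erefl).
  rewrite qfZl qfC qfZl mulrA -expr2 exprVn sqr_sqrtr ?nsq_ge0 //.
  by rewrite -/m mulrC ler_pdivlMr.
have eig : c *m A = m *: c.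
  (* t = - d / C minimises 2 t d + t^2 C, a bound of qf - m nsq at c + t z *)
  have key z : qf c z = m * \sum_j c 0 j * z 0 j.
    set b := \sum_j _.
    have nD t : nsq (c + t *: z) = 1 + 2 * t * b + t ^+ 2 * nsq z.
      rewrite -[X in X + _ + _]c1 /nsq /b !mulr_sumr -!big_split; apply: eq_bigr => j _ /=.
      by rewrite !mxE; ring.
    have qD t : qf (c + t *: z) (c + t *: z) = m + 2 * t * qf c z + t ^+ 2 * qf z z.
      rewrite qfDl !qfDr !qfZl !qfZr (qfC z c) -/m.
      ring.
    apply/eqP; rewrite -subr_eq0; apply/eqP; set d := _ - _.
    pose C := `|qf z z| + `|m * nsq z| + 1.
    have C0 : 0 < C by rewrite ltr_pwDr // addr_ge0.
    have h t : 0 <= 2 * t * d + t ^+ 2 * C.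
      have := ge (c + t *: z); rewrite nD qD => g.
      have : qf z z - m * nsq z <= C.
        have := ler_norm (qf z z); have := ler_norm (- (m * nsq z)); rewrite normrN /C; lra.
      move=> /(ler_wpM2l (sqr_ge0 t)) g2; rewrite /d; nra.
    have := h (- d / C); rewrite (_ : 2 * _ * d + _ = - (d ^+ 2 / C)); last first.
      by field; rewrite gt_eqF.
    rewrite oppr_ge0 pmulr_lle0 ?invr_gt0 // => d2.
    by apply/eqP; rewrite -sqrf_eq0 eq_le d2 sqr_ge0.
  apply/rowP => j; rewrite [RHS]mxE.
  have := key (delta_mx 0 j); rewrite qf_mul.
  have s (f : 'I_k -> R) : \sum_i f i * (delta_mx 0 j : 'rV[R]_k) 0 i = f j.
    rewrite (bigD1 j) //= mxE !eqxx mulr1 big1 ?addr0 // => i ni.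
    by rewrite mxE eqxx /= (negbTE ni) mulr0.
  by rewrite !s.
have c0 : c != 0.
  by apply/eqP => c0; move: c1; rewrite c0 /nsq big1 => [/eqP|i _]; rewrite ?mxE ?mul0r // eq_sym oner_eq0.
have eig_ge a : eigenvalue A a -> m <= a.
  move=> /eigenvalueP[x xA x0]; have := ge x; rewrite qf_mul xA.
  have -> : \sum_j (a *: x) 0 j * x 0 j = a * nsq x.
    by rewrite /nsq mulr_sumr; apply: eq_bigr => j _; rewrite mxE mulrA.
  rewrite ler_pM2r // lt_neqAle nsq_ge0 andbT eq_sym.
  by apply: contraNneq x0 => /nsq_eq0 ->.
have meq : min_eigenvalue A = m.
  apply/eqP; rewrite eq_le; apply/andP; split.
    apply: ge_inf; last by apply/eigenvalueP; exists c.
    by exists m => a; exact: eig_ge.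
  apply: lb_le_inf; first by exists m; apply/eigenvalueP; exists c.
  by move=> a; exact: eig_ge.
by rewrite meq; exists c.
Qed.

Lemma min_eigenvalue_neg x : qf x x < 0 -> min_eigenvalue A < 0.
Proof.
move=> hx; have [_ _ h] := rayleigh; have := le_lt_trans (h x) hx.
by apply: contraTT; rewrite -!leNgt => m0; rewrite mulr_ge0 // nsq_ge0.
Qed.

Lemma min_eigenvalue_pos : (forall x, x != 0 -> 0 < qf x x) -> 0 < min_eigenvalue A.
Proof.
move=> h; have [y [y1 ->] _] := rayleigh; apply: h.
apply/eqP => c0; move: y1; rewrite c0 /nsq big1 => [/eqP|i _]; rewrite ?mxE ?mul0r //.
by rewrite eq_sym oner_eq0.
Qed.

End Rayleigh.
End Sphere.

(** * Bubbles *)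

Section Bubble.
Variable R : realType.
Local Notation E := 'rV[R]_4.

Definition bub (q : E) (c : R) (x : E) : R := (c - dot q x)^-1.

Section Fixed.
Variables (q : E) (hq : S3 q) (c : R) (c1 : 1 < c).

Lemma den_gt0 x : S3 x -> 0 < c - dot q x.
Proof.
move=> hx; have /andP[_ h] := dot_unit_bound hq hx.
by rewrite subr_gt0 (le_lt_trans h).
Qed.

Let den x := c + (- 1) * dot q x.

Let denE : bub q c = fun x => (den x)^-1.
Proof. by apply/funext => x; rewrite /bub /den mulN1r. Qed.

Let C2_den : C2_S3 den.
Proof. exact: C2_add (C2_cst c) (C2_scale _ (C2_lin q)). Qed.

Let den_neq0 x : S3 x -> den x != 0.
Proof. by move=> /den_gt0; rewrite /den mulN1r => /gt_eqF ->. Qed.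

Lemma bub_gt0 x : S3 x -> 0 < bub q c x.
Proof. by move=> hx; rewrite invr_gt0 den_gt0. Qed.

Lemma C2_bub : C2_S3 (bub q c).
Proof. by rewrite denE; apply: C2_inv. Qed.

Let grad_den x : S3 x -> grad den x = - (q - dot q x *: x).
Proof.
move=> hx; rewrite (grad_add hx (C2_cst c) (C2_scale (- 1) (C2_lin q))).
rewrite (grad_cst hx) add0r (grad_scale hx (- 1) (C2_lin q)) (grad_lin hx).
by rewrite scaleN1r.
Qed.

Lemma grad_bub x : S3 x -> grad (bub q c) x = bub q c x ^+ 2 *: (q - dot q x *: x).
Proof.
move=> hx; rewrite denE (grad_inv hx C2_den den_neq0) (grad_den hx) scaleNr scalerN opprK.
by rewrite exprVn.
Qed.

Lemma op2_bub M x N : S3 x -> linear_trace M x N -> op2 M (bub q c) x =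
  2 * bub q c x ^+ 3 * bil M (q - dot q x *: x) (q - dot q x *: x)
  - N * dot q x * bub q c x ^+ 2.
Proof.
move=> hx hM; rewrite denE (op2_inv hx _ C2_den den_neq0) (grad_den hx) -scaleN1r bilZl bilZr.
rewrite (op2_add hx _ (C2_cst c) (C2_scale (- 1) (C2_lin q))).
rewrite (op2_cst hx) (op2_scale hx _ (- 1) (C2_lin q)) hM !exprVn.
set b := bil _ _ _; move: b (den x) (dot q x) => b d t.
by ring.
Qed.

Lemma sqr_proj x : S3 x ->
  dot (q - dot q x *: x) (q - dot q x *: x) = 1 - dot q x ^+ 2.
Proof.
move=> /S3P hx; move/S3P: (hq) => hq'.
by rewrite !dotE hx hq' (dotC x q); ring.
Qed.

Lemma bubble_pde x : S3 x -> - laplacian (bub q c) x + bub q c x =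
  2 * (c ^+ 2 - 1) * bub q c x ^+ 3 - c * bub q c x ^+ 2.
Proof.
move=> hx; rewrite laplacianE (op2_bub hx (linear_trace_lap hx)) bil_lap sqr_proj //.
have := den_gt0 hx; rewrite /bub; move: (dot q x) => t /gt_eqF/negbT h.
by field.
Qed.

End Fixed.

Section Family.
Variables (q : E) (hq : S3 q).

(* c = cosh eta and s = sinh eta for eta = exp y, which is positive for every real y *)
Let z (y : R) := expR (expR y).
Let c (y : R) := (z y + (z y)^-1) / 2.
Let s (y : R) := (z y - (z y)^-1) / 2.

Let z_gt1 y : 1 < z y. Proof. by rewrite expR_gt1 expR_gt0. Qed.
Let z_gt0 y : 0 < z y. Proof. exact: expR_gt0. Qed.

Let c_gt1 y : 1 < c y.
Proof.
have h0 := z_gt0 y; have h1 := z_gt1 y.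
rewrite -subr_gt0 (_ : c y - 1 = (z y - 1) ^+ 2 / (2 * z y)).
  by rewrite divr_gt0 ?mulr_gt0 ?exprn_gt0 // subr_gt0.
by rewrite /c; field; rewrite gt_eqF.
Qed.

Let s_gt0 y : 0 < s y.
Proof.
have h0 := z_gt0 y; have h1 := z_gt1 y.
by rewrite divr_gt0 // subr_gt0 (lt_trans _ h1) // invf_lt1.
Qed.

Let cs y : c y ^+ 2 - 1 = s y ^+ 2.
Proof. by rewrite /c /s; field; rewrite gt_eqF. Qed.

Let dz (y : R) : is_derive y 1 z (expR y * z y).
Proof.
have := is_derive1_comp (is_derive_expR (expR y)) (is_derive_expR y).
by rewrite mulrC.
Qed.

Let dzV (y : R) : is_derive y 1 (fun y => (z y)^-1) (- expR y * (z y)^-1).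
Proof.
apply: is_derive_eq (is_deriveV _ (dz y)) _; first by rewrite gt_eqF.
by rewrite /GRing.scale /=; field; rewrite gt_eqF.
Qed.

Let dc (y : R) : is_derive y 1 c (expR y * s y).
Proof.
rewrite (_ : c = fun y => 2^-1 * (z y + (z y)^-1)); last first.
  by apply/funext => t; rewrite /c mulrC.
apply: is_derive_eq (is_deriveZ 2^-1 (is_deriveD (dz y) (dzV y))) _.
by rewrite /GRing.scale /s /=; field; rewrite gt_eqF.
Qed.

Let ds (y : R) : is_derive y 1 s (expR y * c y).
Proof.
rewrite (_ : s = fun y => 2^-1 * (z y - (z y)^-1)); last first.
  by apply/funext => t; rewrite /s mulrC.
apply: is_derive_eq (is_deriveZ 2^-1 (is_deriveB (dz y) (dzV y))) _.
by rewrite /GRing.scale /c /=; field; rewrite gt_eqF.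
Qed.

Let cc : continuous c. Proof. by move=> y; exact: is_derive_cont (dc y). Qed.
Let csn : continuous s. Proof. by move=> y; exact: is_derive_cont (ds y). Qed.

Let u y t a b := bub q (c y) (hopf t a b).

Section Cont4.
Variable p : R * R * R * R.

Lemma cont4_1 (g : R -> R) : continuous g ->
  {for p, continuous (fun p : R * R * R * R => g p.1.1.1)}.
Proof.
move=> cg; apply: (@continuous_comp _ _ _ (fun p : R * R * R * R => p.1.1.1) g); last exact: cg.
apply: (@continuous_comp _ _ _ (fun p : R * R * R * R => p.1.1) fst); last exact: fst_cont.
by apply: (@continuous_comp _ _ _ fst fst); exact: fst_cont.
Qed.

Lemma cont4_3 (X : R -> R -> R -> R) : cont3 X ->
  {for p, continuous (fun p : R * R * R * R => X p.1.1.2 p.1.2 p.2)}.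
Proof.
move=> cX; apply: (@continuous_comp _ _ _ (fun p : R * R * R * R => (p.1.1.2, p.1.2, p.2))
   (fun p : R * R * R => X p.1.1 p.1.2 p.2)); last exact: cX.
apply: pair_cont; last exact: snd_cont.
apply: pair_cont; last by apply: (@continuous_comp _ _ _ fst snd); [exact: fst_cont|exact: snd_cont].
apply: (@continuous_comp _ _ _ (fun p : R * R * R * R => p.1.1) snd); last exact: snd_cont.
by apply: (@continuous_comp _ _ _ fst fst); exact: fst_cont.
Qed.

Lemma cont4_u : {for p, continuous (fun p : R * R * R * R => u p.1.1.1 p.1.1.2 p.1.2 p.2)}.
Proof.
apply: continuousV; last first.
  apply: continuousB; first exact: cont4_1.
  by apply: (@cont4_3 (fun t a b => dot q (hopf t a b))); exact: cont_C2 (C2_lin q).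
by rewrite gt_eqF // den_gt0 //; exact: hopf_S3.
Qed.

End Cont4.

Let du (y t a b : R) : is_derive y 1 (fun y => u y t a b) (- (expR y * s y) * u y t a b ^+ 2).
Proof.
set d := dot q (hopf t a b).
have h : is_derive y 1 (fun y => c y - d) (expR y * s y - 0).
  exact: is_deriveB (dc y) (is_derive_cst d y 1).
have D0 : (fun y => c y - d) y != 0.
  by rewrite gt_eqF // den_gt0 //; exact: hopf_S3.
have hV := is_deriveV (f := fun y => c y - d) D0 h.
rewrite (_ : - _ * _ = - (c y - d) ^- 2 *: (expR y * s y - 0)) //.
by rewrite /GRing.scale /= subr0 /u /bub -/d exprVn mulrC mulrN mulNr.
Qed.

Section Pairing.
Variables (lam : R) (Y : E -> R) (hY : eigenfunction lam Y).

Let W t a b := Y (hopf t a b) * (sin t * cos t).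
Let cW : cont3 W. Proof. exact: cont3_mul (cont_C2 hY.1) (@cont_sc R). Qed.

Let A y := integral_S3 (fun x => bub q (c y) x * Y x).
Let Bb y := integral_S3 (fun x => s y * bub q (c y) x ^+ 2 * Y x).

(* du/deta = - s u^2, and deta/dy = exp y *)
Let dA (y : R) : is_derive y 1 A (- expR y * Bb y).
Proof.
have -> : - expR y * Bb y = itg3 (fun t a b => - (expR y * s y) * u y t a b ^+ 2 * W t a b).
  rewrite /Bb integral_S3E -itg3_scale.
    congr itg3; apply/funext => t; apply/funext => a; apply/funext => b.
    by rewrite /W /u; move: (bub _ _ _) (Y _) (expR y) (s y) (sin t) (cos t) => *; ring.
  apply: cont3_mul (@cont_sc R); apply: cont3_mul (cont_C2 hY.1).
  exact: (cont_C2 (C2_scale (s y) (C2_mul (C2_bub hq (c_gt1 y)) (C2_bub hq (c_gt1 y))))).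
have -> : A = fun y => itg3 (fun t a b => u y t a b * W t a b).
  apply/funext => y'; rewrite /A integral_S3E; congr itg3.
  apply/funext => t; apply/funext => a; apply/funext => b.
  by rewrite /W [RHS]mulrA.
apply: (@itg3_deriv _ (fun y t a b => u y t a b * W t a b)
   (fun y t a b => - (expR y * s y) * u y t a b ^+ 2 * W t a b)).
- by move=> p; exact: continuousM (cont4_u (p := p)) (cont4_3 (p := p) cW).
- move=> p; have cu := cont4_u (p := p).
  have ce : continuous (fun y => - (expR y * s y)).
    by move=> y'; exact: continuousN (continuousM (@continuous_expR _ y') (@csn y')).
  exact: continuousM (continuousM (cont4_1 (p := p) ce) (continuousM cu cu)) (cont4_3 (p := p) cW).
- move=> y' t a b; apply: is_derive_eq (is_deriveM (du y' t a b) (is_derive_cst (W t a b) y' 1)) _.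
  by rewrite /GRing.scale /= mulr0 add0r mulrC.
Qed.

(* d(s u^2)/deta = c u^2 - 2 s^2 u^3 is minus the right side of [bubble_pde] *)
Let dB (y : R) : is_derive y 1 Bb (- expR y * (lam * A y)).
Proof.
have C2_rhs : C2_S3 (fun x => 2 * s y ^+ 2 * bub q (c y) x ^+ 3 - c y * bub q (c y) x ^+ 2).
  have h2 := C2_mul (C2_bub hq (c_gt1 y)) (C2_bub hq (c_gt1 y)).
  have h3 := C2_mul (C2_bub hq (c_gt1 y)) h2.
  have := C2_add (C2_scale (2 * s y ^+ 2) h3) (C2_scale (- c y) h2).
  by congr C2_S3; apply/funext => x; rewrite mulNr.
have hp : integral_S3 (fun x => (2 * s y ^+ 2 * bub q (c y) x ^+ 3 - c y * bub q (c y) x ^+ 2) * Y x) =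
   lam * A y.
  apply: eigen_pairing (C2_bub hq (c_gt1 y)) _ _ hY; last first.
    by move=> x hx; rewrite bubble_pde // cs.
  exact: cont_C2 C2_rhs.
have -> : - expR y * (lam * A y) = itg3 (fun t a b =>
    expR y * (c y * u y t a b ^+ 2 - 2 * s y ^+ 2 * u y t a b ^+ 3) * W t a b).
  rewrite -hp integral_S3E -itg3_scale.
    congr itg3; apply/funext => t; apply/funext => a; apply/funext => b.
    rewrite /W /u; set b1 := bub _ _ _; set y1 := Y _.
    by move: b1 y1 (s y) (c y) => b1 y1 s1 c1; ring.
  apply: cont3_mul (@cont_sc R); apply: cont3_mul (cont_C2 hY.1).
  exact: cont_C2 C2_rhs.
have -> : Bb = fun y => itg3 (fun t a b => s y * u y t a b ^+ 2 * W t a b).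
  apply/funext => y'; rewrite /Bb integral_S3E; congr itg3.
  apply/funext => t; apply/funext => a; apply/funext => b.
  by rewrite /W [RHS]mulrA.
apply: (@itg3_deriv _ (fun y t a b => s y * u y t a b ^+ 2 * W t a b)
   (fun y t a b => expR y * (c y * u y t a b ^+ 2 - 2 * s y ^+ 2 * u y t a b ^+ 3) * W t a b)).
- move=> p; have cu := cont4_u (p := p).
  exact: continuousM (continuousM (cont4_1 (p := p) csn) (continuousM cu cu)) (cont4_3 (p := p) cW).
- move=> p; have cu := cont4_u (p := p).
  have cu2 := continuousM cu cu.
  have cu3 := continuousM cu cu2.
  have cs2 : continuous (fun y => 2 * s y ^+ 2).
    move=> y'; apply: cvgM; first exact: cst_continuous.
    exact: cvgM (@csn y') (@csn y').
  exact: continuousM (continuousM (cont4_1 (p := p) (@continuous_expR R))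
    (continuousB (continuousM (cont4_1 (p := p) cc) cu2) (continuousM (cont4_1 (p := p) cs2) cu3)))
    (cont4_3 (p := p) cW).
- move=> y' t a b.
  apply: is_derive_eq (is_deriveM (is_deriveM (ds y') (is_deriveM (du y' t a b) (du y' t a b)))
    (is_derive_cst (W t a b) y' 1)) _.
  rewrite /GRing.scale /= !fctE mulr0 add0r.
  by move: (u _ _ _ _) (W _ _ _) (expR y') (s y') (c y') => *; ring.
Qed.

Let W_bounded : exists C, forall t a b, `|W t a b| <= C.
Proof.
have cS := @sphere_compact R 4.
have hS x : nsq x = 1 -> S3 x by move=> h; apply/S3P.
have cY : {within [set x : E | nsq x = 1], continuous (fun x => `|rext Y x|)}.
  apply: continuous_in_subspaceT => x /set_mem /hS /S3_neq0 x0.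
  have [cr _ _] := hY.1 x x0.
  by apply: (@continuous_comp _ _ _ (rext Y) (fun y : R => `|y|)) => //; exact: norm_continuous.
have [|m _ hm] := EVT_max_rV _ cS cY.
  by exists q; apply/S3P.
exists `|rext Y m| => t a b; rewrite /W normrM -[X in _ <= X]mulr1.
apply: ler_pM => //.
  rewrite -(rext_S3 Y (hopf_S3 t a b)); apply: hm; rewrite inE.
  by apply/S3P; exact: hopf_S3.
by rewrite normrM -[X in _ <= X]mulr1; apply: ler_pM; rewrite ?normr_ge0 ?sin_max ?cos_max.
Qed.

Let u_bound y t a b : `|u y t a b| <= (c y - 1)^-1.
Proof.
have hS := hopf_S3 t a b; have c1 := c_gt1 y.
rewrite gtr0_norm ?(bub_gt0 hq) // /u /bub lef_pV2 ?posrE ?subr_gt0 //.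
  by have /andP[_ h] := dot_unit_bound hq hS; rewrite lerB.
by have := den_gt0 hq c1 hS; rewrite subr_gt0.
Qed.

(* u is at most 1 / (c - 1), of order exp (- eta), and eta = exp y >= y *)
Let decay : exists C, forall y, 0 <= y -> `|A y| <= C * expR (- y) /\ `|Bb y| <= C * expR (- y).
Proof.
have [C hC] := W_bounded.
have C0 : 0 <= C by apply: le_trans (hC 0 0 0).
pose v : R := (2 * pi) ^+ 2 * (pi / 2).
have v0 : 0 <= v by rewrite mulr_ge0 ?sqr_ge0 // divr_ge0 // pi_ge0.
exists (32 * C * v) => y y0.
have zy : (z y)^-1 <= expR (- y).
  rewrite expRN lef_pV2 ?posrE ?expR_gt0 // /z ler_expR.
  by have := expR_ge1Dx y; lra.
have z2 : 2 <= z y.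
  have := expR_ge1Dx (expR y); have := expR_ge1Dx y; rewrite -/(z y); lra.
have z0 := z_gt0 y; have s0 := s_gt0 y.
have zi0 : 0 < (z y)^-1 by rewrite invr_gt0.
have cB : (c y - 1)^-1 <= 8 * (z y)^-1.
  rewrite (_ : c y - 1 = (z y - 1) ^+ 2 / (2 * z y)); last first.
    by rewrite /c; field; rewrite gt_eqF.
  rewrite invf_div ler_pdivrMr; last by rewrite exprn_gt0 // subr_gt0 z_gt1.
  rewrite mulrAC -ler_pdivrMr ?invr_gt0 // invrK; nra.
have sB : s y <= z y / 2 by rewrite /s; lra.
have c10 : 0 < (c y - 1)^-1 by rewrite invr_gt0 subr_gt0 c_gt1.
have B2 : s y * (c y - 1)^-1 ^+ 2 <= 32 * (z y)^-1.
  have h1 : (c y - 1)^-1 ^+ 2 <= 64 * (z y)^-1 ^+ 2 by nra.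
  have h2 : s y * (c y - 1)^-1 ^+ 2 <= z y / 2 * (64 * (z y)^-1 ^+ 2).
    by apply: ler_pM => //; [exact: ltW|exact: sqr_ge0].
  by apply: le_trans h2 _; rewrite le_eqVlt; apply/orP; left; apply/eqP; field; rewrite gt_eqF.
have key (X : R) : `|X| <= 32 * (z y)^-1 * C * (2 * pi) ^+ 2 * (pi / 2) ->
   `|X| <= 32 * C * v * expR (- y).
  move=> h; apply: le_trans h _; rewrite -mulrA -/v.
  rewrite (_ : 32 * (z y)^-1 * C * v = 32 * C * v * (z y)^-1); last by ring.
  by apply: ler_wpM2l => //; rewrite mulr_ge0 // mulr_ge0 // ler0n.
split; apply: key; rewrite ?/A ?/Bb integral_S3E.
- apply: itg3_le.
    apply: cont3_mul (@cont_sc R); apply: cont3_mul (cont_C2 hY.1).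
    exact: cont_C2 (C2_bub hq (c_gt1 y)).
  move=> t a b; rewrite -mulrA normrM; apply: ler_pM => //; last exact: hC.
  by apply: le_trans (u_bound y t a b) _; lra.
- apply: itg3_le.
    apply: cont3_mul (@cont_sc R); apply: cont3_mul (cont_C2 hY.1).
    exact: (cont_C2 (C2_scale (s y) (C2_mul (C2_bub hq (c_gt1 y)) (C2_bub hq (c_gt1 y))))).
  move=> t a b; rewrite -mulrA normrM; apply: ler_pM => //; last exact: hC.
  apply: le_trans _ B2; rewrite normrM (gtr0_norm s0) normrX.
  by apply: ler_wpM2l; [exact: ltW|rewrite ler_sqr ?nnegrE ?(ltW c10) //; exact: u_bound].
Qed.

(** In terms of eta, A' = - B and B' = - lam A. If lam <= 0 then B^2 - lam A^2 is constant,
    otherwise with m = sqrt lam so is (m A - B) exp (- m eta). In both cases the constant is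
    0, by the decay at infinity. *)
Lemma pairing_param y : Bb y = Num.sqrt lam * A y.
Proof.
have [C hC] := decay.
have C0 : 0 <= C.
  by have [h _] := hC 0 (lexx _); rewrite oppr0 expR0 mulr1 in h; apply: le_trans h.
have e1 x : 0 <= x -> expR (- x) <= 1 :> R by move=> x0; rewrite -expR0 ler_expR oppr_le0.
have [l0|l0] := leP lam 0.
  pose L y := Bb y * Bb y - lam * (A y * A y).
  have L0 : forall y, L y = 0.
    apply: (@const_decay R L (C ^+ 2 + `|lam| * C ^+ 2)).
      move=> x; apply: is_derive_eq (is_deriveB (is_deriveM (dB x) (dB x))
        (is_deriveZ lam (is_deriveM (dA x) (dA x)))) _.
      by rewrite /GRing.scale /=; ring.
    move=> x x0; have [h1 h2] := hC x x0; have ep := expR_gt0 (- x).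
    have h3 (X : R) : `|X| <= C * expR (- x) -> `|X * X| <= C ^+ 2 * expR (- x).
      move=> h; rewrite normrM; apply: le_trans (ler_pM _ _ h h) _ => //.
      rewrite (_ : _ * _ * _ = C ^+ 2 * expR (- x) * expR (- x)); last by ring.
      by rewrite ler_piMr ?mulr_ge0 ?sqr_ge0 ?e1 // ltW.
    apply: le_trans (ler_normB _ _) _; rewrite mulrDl; apply: lerD; first exact: h3.
    by rewrite normrM -mulrA; apply: ler_wpM2l => //; exact: h3.
  have := L0 y; rewrite /L => h.
  rewrite ler0_sqrtr // mul0r; apply/eqP; rewrite -sqrf_eq0 eq_le sqr_ge0 andbT.
  by have := sqr_ge0 (A y); nra.
pose m := Num.sqrt lam.
have m0 : 0 < m by rewrite sqrtr_gt0.
have mm : m * m = lam by rewrite -expr2 sqr_sqrtr // ltW.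
pose L y := (m * A y - Bb y) * expR (- m * expR y).
have L0 : forall y, L y = 0.
  apply: (@const_decay R L (m * C + C)).
    move=> x.
    have d1 : is_derive x 1 (fun y => - m * expR y) (- m * expR x).
      have h := is_deriveM (is_derive_cst (- m) x 1) (is_derive_expR x).
      apply: is_derive_eq h _.
      by rewrite /GRing.scale /= mulr0 addr0.
    have d2 := @is_derive1_comp R expR (fun y => - m * expR y) x _ _
      (is_derive_expR (- m * expR x)) d1.
    apply: is_derive_eq (is_deriveM (is_deriveB (is_deriveZ m (dA x)) (dB x)) d2) _.
    rewrite /GRing.scale /= !fctE (_ : (m \*: A) x = m * A x) // -mm.
    by ring.
  move=> x x0; have [h1 h2] := hC x x0; have ep := expR_gt0 (- x).
  rewrite normrM (gtr0_norm (expR_gt0 _)).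
  apply: le_trans (_ : `|m * A x - Bb x| <= _).
    by rewrite ler_piMr // mulNr e1 // mulr_ge0 ?expR_ge0 // ltW.
  apply: le_trans (ler_normB _ _) _; rewrite mulrDl lerD //.
  rewrite (_ : `|m * A x| = m * `|A x|) ?normrM ?(gtr0_norm m0) //.
  by rewrite -[X in _ <= X]mulrA; exact: (ler_wpM2l (ltW m0) h1).
have := L0 y => /eqP; rewrite mulf_eq0 (gt_eqF (expR_gt0 _)) orbF subr_eq0.
by move=> /eqP <-.
Qed.

End Pairing.

Lemma psi_param y : is_Psigma (bub q (c y)) (fun x => s y * bub q (c y) x ^+ 2).
Proof.
split; last by move=> lam Y hY; exact: pairing_param.
apply: C2_within.
exact: (C2_scale (s y) (C2_mul (C2_bub hq (c_gt1 y)) (C2_bub hq (c_gt1 y)))).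
Qed.

Lemma psi_bubble (s0 : R) : 0 < s0 ->
  is_Psigma (bub q (Num.sqrt (1 + s0 ^+ 2)))
    (fun x => s0 * bub q (Num.sqrt (1 + s0 ^+ 2)) x ^+ 2).
Proof.
move=> s00; set c0 := Num.sqrt _.
have cc0 : c0 ^+ 2 = 1 + s0 ^+ 2 by rewrite sqr_sqrtr // addr_ge0 // sqr_ge0.
have c00 : 0 <= c0 by exact: sqrtr_ge0.
have c01 : 1 < c0 by rewrite ltNge; apply/negP => h; nra.
pose z0 := c0 + s0.
have z01 : 1 < z0 by rewrite /z0; lra.
have zi : z0^-1 = c0 - s0.
  have z0n : z0 != 0 by rewrite gt_eqF // (lt_trans ltr01).
  have prod : z0 * (c0 - s0) = 1.
    by rewrite /z0 mulrC -subr_sqr cc0 addrK.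
  by rewrite -[LHS]mulr1 -prod mulKf.
(* exp eta = cosh eta + sinh eta *)
have zE : z (ln (ln z0)) = z0.
  have l0 : 0 < ln z0 by rewrite ln_gt0.
  by rewrite /z !lnK ?posrE // (lt_trans ltr01).
have cE : c (ln (ln z0)) = c0 by rewrite /c zE zi /z0; field.
have sE : s (ln (ln z0)) = s0 by rewrite /s zE zi /z0; field.
by have := psi_param (ln (ln z0)); rewrite cE sE.
Qed.

End Family.
End Bubble.

(** * The background quadratic form *)

Section Norm.
Variable R : realType.
Local Notation E := 'rV[R]_4.
Implicit Types x y : E.

Lemma enormZ a x : enorm (a *: x) = `|a| * enorm x.
Proof. by rewrite /enorm dotZl dotZr mulrA -expr2 sqrtrM ?sqr_ge0 // sqrtr_sqr. Qed.

Lemma enormD x y : enorm (x + y) <= enorm x + enorm y.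
Proof.
rewrite -ler_sqr ?nnegrE ?addr_ge0 ?enorm_ge0 // sqr_enorm sqrrD !sqr_enorm.
rewrite !dotE (dotC y x); have := ler_norm (dot x y); have := cauchy x y; lra.
Qed.

Lemma enormN x : enorm (- x) = enorm x.
Proof. by rewrite -scaleN1r enormZ normrN1 mul1r. Qed.

Lemma enorm0 : enorm (0 : E) = 0.
Proof. by rewrite /enorm dot0l sqrtr0. Qed.

Lemma enormB x y : enorm (x - y) <= enorm x + enorm y.
Proof. by rewrite -(enormN y) enormD. Qed.

Lemma enorm_sum n (f : 'I_n -> E) (P : pred 'I_n) :
  enorm (\sum_(i | P i) f i) <= \sum_(i | P i) enorm (f i).
Proof.
elim/big_rec2: _ => [|i y x _ h]; first by rewrite enorm0.
by apply: le_trans (enormD _ _) _; rewrite lerD2l.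
Qed.

Lemma enorm_le x (a : R) : 0 <= a -> dot x x <= a ^+ 2 -> enorm x <= a.
Proof.
by move=> a0 h; rewrite -ler_sqr ?nnegrE ?enorm_ge0 // sqr_enorm.
Qed.

Lemma bil_hess_le (a b g h : E) :
  `|bil (Mhess a b) g h| <= enorm a * enorm b * (enorm g * enorm h).
Proof.
rewrite bil_hess normrM [`|2^-1|]gtr0_norm // ler_pdivrMr //.
apply: le_trans (ler_normD _ _) _; rewrite !normrM.
have h1 := ler_pM (normr_ge0 _) (normr_ge0 _) (cauchy a g) (cauchy b h).
have h2 := ler_pM (normr_ge0 _) (normr_ge0 _) (cauchy a h) (cauchy b g).
by apply: le_trans (lerD h1 h2) _; rewrite le_eqVlt; apply/orP; left; apply/eqP; ring.
Qed.

Lemma bil_lap_le (g h : E) : `|bil 1%:M g h| <= 3 * (enorm g * enorm h).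
Proof.
rewrite bil_lap; apply: le_trans (cauchy g h) _.
by rewrite ler_peMl ?mulr_ge0 ?enorm_ge0 // ler1n.
Qed.

(** beta is |a| |b| for the Hessian at (a, b) and 3 for the Laplacian. *)
Definition op2_bound (M : 'M[R]_4) x (N beta : R) :=
  [/\ S3 x, linear_trace M x N, 0 <= beta, `|N| <= beta &
    forall g h : E, `|bil M g h| <= beta * (enorm g * enorm h)].

Lemma op2_bound_hess x (a b : E) : S3 x -> tangent x a -> tangent x b ->
  op2_bound (Mhess a b) x (dot a b) (enorm a * enorm b).
Proof.
move=> hx ta tb; split => //.
- exact: linear_trace_hess.
- by rewrite mulr_ge0 ?enorm_ge0.
- exact: cauchy.
- exact: bil_hess_le.
Qed.

Lemma op2_bound_lap x : S3 x -> op2_bound 1%:M x 3 3.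
Proof.
move=> hx; split => //; first exact: linear_trace_lap.
- by rewrite gtr0_norm.
- exact: bil_lap_le.
Qed.

End Norm.

Section Quadratic.
Variable R : realType.
Local Notation E := 'rV[R]_4.

(** Distinct, so that the critical points are nondegenerate; nonzero, so that the Laplacian
    does not vanish there; of sum 0, so that [Quad] is a spherical harmonic; and small, so
    that 1 + Quad and 1 + 3 Quad stay close to 1. *)
Definition lam (l : 'I_4) : R := [:: - 3 / 100; - 1 / 100; 1 / 100; 3 / 100]`_l.

Definition frame (b : 'I_4 -> E) :=
  (forall x y, dot x y = \sum_l dot (b l) x * dot (b l) y) /\
  (forall m l, dot (b m) (b l) = (m == l)%:R).

(** One angle is enough to move the eigenvectors away from finitely many points. *)
Definition rot (C S : R) (l : 'I_4) : E :=
  [:: row4 C S 0 0; row4 (- S) C 0 0; row4 0 0 C (- S); row4 0 0 S C]`_l.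

Lemma rot_frame C S : C ^+ 2 + S ^+ 2 = 1 -> frame (rot C S).
Proof.
move=> h; split=> [x y|].
  rewrite /dot !sum4 /rot /= !mxE /=.
  have h' : S ^+ 2 = 1 - C ^+ 2 by rewrite -h; ring.
  ring: h'.
have h' : S ^+ 2 = 1 - C ^+ 2 by rewrite -h; ring.
by move=> m l; move: m; apply: forall_ord4; move: l; apply: forall_ord4;
  rewrite /dot !sum4 /rot /= !mxE /=; ring: h'.
Qed.

Variables (b : 'I_4 -> E) (hb : frame b).

Definition Quad (x : E) : R := \sum_l lam l * (dot (b l) x * dot (b l) x).

Lemma C2_Quad : C2_S3 Quad.
Proof. by apply: C2_sum => l; apply: C2_scale; apply: C2_mul; exact: C2_lin. Qed.

Lemma lam_le l : `|lam l| <= 3 / 100.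
Proof.
by move: l; apply: forall_ord4; rewrite /lam /= ler_norml; apply/andP; split; lra.
Qed.

Lemma Quad_le x : S3 x -> `|Quad x| <= 3 / 100.
Proof.
move=> /S3P; rewrite hb.1 => h; apply: le_trans (ler_norm_sum _ _ _) _.
have -> : 3 / 100 = \sum_l 3 / 100 * (dot (b l) x * dot (b l) x) by rewrite -mulr_sumr h mulr1.
apply: ler_sum => l _.
rewrite -expr2 normrM normrX real_normK ?num_real //.
by apply: ler_wpM2r; [exact: sqr_ge0|exact: lam_le].
Qed.

Lemma dot_sumr n (y : E) (f : 'I_n -> E) : dot y (\sum_l f l) = \sum_l dot y (f l).
Proof.
elim/big_rec2: _ => [|i z x _ <-]; first by rewrite dot0r.
by rewrite dotDr.
Qed.

Section At.
Variables (x : E) (hx : S3 x).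

Lemma grad_Quad : grad Quad x =
  \sum_l (2 * lam l * dot (b l) x) *: (b l - dot (b l) x *: x).
Proof.
rewrite /Quad grad_sum //; last first.
  by move=> l; apply: C2_scale; apply: C2_mul; exact: C2_lin.
apply: eq_bigr => l _.
rewrite (grad_scale hx (lam l) (C2_mul (C2_lin (b l)) (C2_lin (b l)))).
rewrite (grad_mul hx (C2_lin (b l)) (C2_lin (b l))) (grad_lin hx).
by rewrite -scalerDl scalerA; congr (_ *: _); ring.
Qed.

Lemma frame_grad_Quad m : dot (b m) (grad Quad x) = 2 * (lam m - Quad x) * dot (b m) x.
Proof.
rewrite grad_Quad dot_sumr.
rewrite (eq_bigr (fun l => 2 * lam l * dot (b l) x * (l == m)%:R -
   (2 * dot (b m) x) * (lam l * (dot (b l) x * dot (b l) x)))); last first.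
  by move=> l _; rewrite dotZr dotBr dotZr hb.2 eq_sym; ring.
by rewrite sumrB sum_dlt -mulr_sumr -/(Quad x); ring.
Qed.

Lemma sqr_grad_Quad : dot (grad Quad x) (grad Quad x) =
  4 * \sum_l (lam l - Quad x) ^+ 2 * dot (b l) x ^+ 2.
Proof.
rewrite hb.1 mulr_sumr; apply: eq_bigr => l _; rewrite frame_grad_Quad; ring.
Qed.

Lemma grad_Quad_le : enorm (grad Quad x) <= 12 / 100.
Proof.
apply: enorm_le; first by lra.
rewrite sqr_grad_Quad (_ : (12 / 100) ^+ 2 = 4 * (36 / 10000 * dot x x)); last first.
  by rewrite (S3P x).1 //; field.
rewrite ler_wpM2l // hb.1 mulr_sumr; apply: ler_sum => l _.
rewrite -expr2 ler_wpM2r ?sqr_ge0 //.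
move: (Quad_le hx) (lam_le l); rewrite !ler_norml => /andP[? ?] /andP[? ?].
by nra.
Qed.

Lemma op2_Quad M N : linear_trace M x N -> op2 M Quad x =
  \sum_l 2 * lam l * bil M (b l - dot (b l) x *: x) (b l - dot (b l) x *: x)
  - 2 * N * Quad x.
Proof.
move=> hM; rewrite {1}/Quad (op2_sum hx); last first.
  by move=> l; apply: C2_scale; apply: C2_mul; exact: C2_lin.
rewrite /Quad mulr_sumr -sumrB; apply: eq_bigr => l _.
rewrite (op2_scale hx M (lam l) (C2_mul (C2_lin (b l)) (C2_lin (b l)))).
rewrite (op2_mul hx M (C2_lin (b l)) (C2_lin (b l))) (grad_lin hx) hM.
ring.
Qed.

Lemma hessian_Quad u w : tangent x u -> tangent x w -> hessian Quad x u w =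
  2 * \sum_l (lam l - Quad x) * (dot (b l) u * dot (b l) w).
Proof.
move=> tu tw; rewrite hessianE (op2_Quad (linear_trace_hess hx tu tw)) (hb.1 u w).
rewrite -mulrA [X in _ - _ * X]mulr_suml !mulr_sumr -sumrB; apply: eq_bigr => l _.
rewrite bil_hess !dotBr !dotZr (dotC u x) (dotC w x) (tu : dot x u = 0) (tw : dot x w = 0).
by rewrite (dotC u) (dotC w); field.
Qed.

Lemma laplacian_Quad : laplacian Quad x = - 8 * Quad x.
Proof.
rewrite laplacianE (op2_Quad (linear_trace_lap hx)).
rewrite (eq_bigr (fun l => 2 * lam l - 2 * (lam l * (dot (b l) x * dot (b l) x)))); last first.
  move=> l _; rewrite bil_lap !dotE hb.2 eqxx (dotC x (b l)) (S3P x).1 //=; ring.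
rewrite sumrB -!mulr_sumr -/(Quad x) sum4 /lam /=; ring.
Qed.

Lemma op2_Quad_le M N beta : op2_bound M x N beta -> `|op2 M Quad x| <= beta / 4.
Proof.
move=> [_ hM b0 hN hB]; rewrite (op2_Quad hM).
have hg l : `|bil M (b l - dot (b l) x *: x) (b l - dot (b l) x *: x)| <= beta.
  apply: le_trans (hB _ _) _; rewrite -expr2 sqr_enorm ler_piMr //.
  rewrite !dotE hb.2 eqxx (dotC x (b l)) (S3P x).1 // /=.
  by have := sqr_ge0 (dot (b l) x); lra.
have hQ := Quad_le hx.
have hNQ : `|N * Quad x| <= beta * (3 / 100) by rewrite normrM; apply: ler_pM.
rewrite sum4 /lam /=; move: hNQ (hg (Ordinal (isT : (0 < 4)%N))) (hg (Ordinal (isT : (1 < 4)%N)))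
  (hg (Ordinal (isT : (2 < 4)%N))) (hg (Ordinal (isT : (3 < 4)%N))).
rewrite !ler_norml => /andP[? ?] /andP[? ?] /andP[? ?] /andP[? ?] /andP[? ?].
apply/andP; split; lra.
Qed.

End At.
End Quadratic.

(** * Critical points of a quotient under a bubble *)

Section Quotient.
Variable R : realType.
Local Notation E := 'rV[R]_4.
Variables (f v : E -> R) (hf : C2_S3 f) (hv : C2_S3 v).
Hypothesis v0 : forall x, S3 x -> v x != 0.

Definition quo (x : E) : R := f x / v x ^+ 2.

Let vv (x : E) := v x * v x.
Let C2_vv : C2_S3 vv := C2_mul hv hv.
Let vv0 x : S3 x -> vv x != 0. Proof. by move=> hx; rewrite mulf_neq0 ?v0. Qed.
Let C2_g := C2_inv C2_vv vv0.

Lemma C2_quo : C2_S3 quo.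
Proof. exact: C2_mul hf C2_g. Qed.

Section At.
Variables (x : E) (hx : S3 x) (hc : grad quo x = 0).

Let grad_vv : grad vv x = (2 * v x) *: grad v x.
Proof. by rewrite (grad_mul hx hv hv) -scalerDl mulr2n mulrDl mul1r. Qed.

Let gradE : grad quo x = (v x ^+ 2)^-1 *: grad f x - (2 * f x * (v x ^+ 3)^-1) *: grad v x.
Proof.
rewrite (grad_mul hx hf C2_g) (grad_inv hx C2_vv vv0) grad_vv !scalerA addrC.
rewrite -scaleNr; congr (_ + _ *: _); rewrite /vv.
by have := v0 hx; move: (v x) (f x) => a c a0; field.
Qed.

(** v^3 grad (f / v^2) = v grad f - 2 f grad v. *)
Lemma crit_grad : v x *: grad f x = (2 * f x) *: grad v x.
Proof.
have := congr1 (fun w => (v x ^+ 3) *: w) hc; rewrite gradE scaler0 scalerBr !scalerA.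
move=> /eqP; rewrite subr_eq0 => /eqP.
have -> : v x ^+ 3 / v x ^+ 2 = v x by field; exact: v0.
by have -> : v x ^+ 3 * (2 * f x / v x ^+ 3) = 2 * f x by field; exact: v0.
Qed.

Lemma crit_op2 M : v x ^+ 3 * op2 M quo x =
  v x * op2 M f x - 2 * f x * op2 M v x - 2 * f x / v x * bil M (grad v x) (grad v x).
Proof.
have gf : grad f x = (2 * f x / v x) *: grad v x.
  have := congr1 (fun w => (v x)^-1 *: w) crit_grad; rewrite !scalerA mulVf ?v0 // scale1r => ->.
  by rewrite mulrC.
rewrite (op2_mul hx M hf C2_g) (op2_inv hx M C2_vv vv0) (grad_inv hx C2_vv vv0) grad_vv gf.
rewrite (op2_mul hx M hv hv) !bilZl !bilZr /vv.
by have := v0 hx; set bb := bil _ _ _; set lf := op2 M f x; set lv := op2 M v x;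
  move: bb lf lv (v x) (f x) => bb lf lv a c a0; field.
Qed.

End At.
End Quotient.

Lemma sqrt_near_one (R : realType) (z c : R) : 0 < z -> z <= 1 / 1000 -> c ^+ 2 = 1 + z ^+ 8 ->
  1 < c -> z ^+ 8 / 3 <= c - 1 <= z ^+ 8 / 2.
Proof.
move=> z0 z1 hc c1; have h8 : 0 < z ^+ 8 by rewrite exprn_gt0.
have z8 : z ^+ 8 <= 1 by rewrite exprn_ile1 ?(ltW z0) //; lra.
have e : (c - 1) * (c + 1) = z ^+ 8 by rewrite -subr_sqr hc expr1n; ring.
by apply/andP; split; nra.
Qed.

Section Near.
Variable R : realType.
Local Notation E := 'rV[R]_4.

(** A critical point x of K = (F + s A u^2) / (V + A u)^2 at height u under one bubble, where
    A = z^7, s A = z^11 and (V, F) is the background made of everything else: tau is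
    <q, x>, p the tangential part of q, gV and gF the gradients of V and F. The background
    alone has v^3 grad K = [V *: gF - (2 * F) *: gV], and w0 bounds it below. *)
Record near_data (z w0 u c tau F V : R) (p gF gV : E) : Prop := NearData {
  nd_z : 0 < z; nd_z1 : z <= 1 / 1000;
  nd_w0 : z * 10 ^+ 7 <= w0;
  nd_V : 4 / 5 <= V <= 6 / 5; nd_F : 4 / 5 <= F <= 6 / 5;
  nd_gF : enorm gF <= 1; nd_gV : enorm gV <= 1 / 5;
  nd_c : c ^+ 2 = 1 + z ^+ 8; nd_c1 : 1 < c;
  nd_u : 1 <= u; nd_tau : tau = c - u^-1; nd_tau1 : - 1 <= tau <= 1;
  nd_p : dot p p = 1 - tau ^+ 2;
  nd_W : w0 <= enorm (V *: gF - (2 * F) *: gV);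
  nd_crit : (V + z ^+ 7 * u) *: (gF + (2 * z ^+ 11 * u ^+ 3) *: p) =
     (2 * (F + z ^+ 11 * u ^+ 2)) *: (gV + (z ^+ 7 * u ^+ 2) *: p) }.

Variables (z w0 u c tau F V : R) (p gF gV : E).
Hypothesis nd : near_data z w0 u c tau F V p gF gV.

Let Y := z ^+ 4 * u.
Let T := 2 * z ^+ 7 * u ^+ 2 * (Y * V - F).
Let P := enorm p.

Let z0 : 0 < z. Proof. by have [] := nd. Qed.
Let u0 : 0 < u. Proof. by have [] := nd => *; lra. Qed.
Let P0 : 0 <= P. Proof. exact: enorm_ge0. Qed.
Let zn n : 0 < z ^+ n. Proof. by rewrite exprn_gt0. Qed.

Lemma c_bounds : z ^+ 8 / 3 <= c - 1 <= z ^+ 8 / 2.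
Proof. by have [? ? _ _ _ _ _ ? ? _ _ _ _ _ _] := nd; exact: sqrt_near_one. Qed.

Lemma kappa : (1 - tau) * u = 1 - (c - 1) * u.
Proof. by rewrite (nd_tau nd); field; rewrite gt_eqF. Qed.

Lemma cu_le1 : (c - 1) * u <= 1.
Proof.
have /andP[_ t1] := nd_tau1 nd; have k := kappa.
have : 0 <= (1 - tau) * u by apply: mulr_ge0; [rewrite subr_ge0|exact: ltW].
by lra.
Qed.

Lemma P2u : P ^+ 2 * u <= 2.
Proof.
have /andP[t0 t1] := nd_tau1 nd; rewrite /P sqr_enorm (nd_p nd).
have k := kappa; have : 0 <= (c - 1) * u.
  by apply: mulr_ge0; apply: ltW => //; rewrite subr_gt0 (nd_c1 nd).
move=> h; have k1 : (1 - tau) * u <= 1 by lra.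
have k2 : 0 <= (1 - tau) * u by apply: mulr_ge0; [rewrite subr_ge0|exact: ltW].
by rewrite (_ : (1 - tau ^+ 2) * u = (1 + tau) * ((1 - tau) * u)); [nra|ring].
Qed.

(* the critical equation solved for p *)
Let crit_eq : T *: p = - (V *: gF - (2 * F) *: gV) - (z ^+ 7 * u) *: gF
  + (2 * z ^+ 11 * u ^+ 2) *: gV.
Proof.
have h := nd_crit nd; apply/rowP => i; move/rowP/(_ i): h; rewrite !mxE /T /Y => h.
apply/eqP; rewrite -subr_eq0; apply/eqP.
by move/eqP: h; rewrite -subr_eq0 => /eqP <-; ring.
Qed.

Let lowT : w0 <= `|T| * P + z ^+ 7 * u + z ^+ 11 * u ^+ 2.
Proof.
have [_ _ _ _ _ hF hV _ _ _ _ _ _ hW _] := nd.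
apply: le_trans hW _.
have -> : V *: gF - (2 * F) *: gV = - (T *: p) - (z ^+ 7 * u) *: gF + (2 * z ^+ 11 * u ^+ 2) *: gV.
  by rewrite crit_eq; apply/rowP => i; rewrite !mxE; ring.
have z7 := zn 7; have z11 := zn 11.
apply: le_trans (enormD _ _) _; apply: lerD.
  apply: le_trans (enormB _ _) _; rewrite enormN !enormZ.
  by rewrite lerD2l gtr0_norm ?mulr_gt0 // ler_piMr // ltW // mulr_gt0.
rewrite enormZ gtr0_norm ?mulr_gt0 ?exprn_gt0 //.
have : 0 <= z ^+ 11 * u ^+ 2 by rewrite mulr_ge0 ?sqr_ge0 // ltW.
by have := enorm_ge0 gV; nra.
Qed.

Let highT : `|T| * P <= 2 + z ^+ 7 * u + z ^+ 11 * u ^+ 2.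
Proof.
have [_ _ _ /andP[V1 V2] /andP[F1 F2] hF hV _ _ _ _ _ _ _ _] := nd.
rewrite -enormZ crit_eq; have z7 := zn 7; have z11 := zn 11.
have gF0 := enorm_ge0 gF; have gV0 := enorm_ge0 gV.
apply: le_trans (enormD _ _) _; apply: lerD.
  apply: le_trans (enormB _ _) _; rewrite enormN; apply: lerD.
    apply: le_trans (enormB _ _) _; rewrite !enormZ !gtr0_norm; [nra|lra|lra].
  by rewrite enormZ gtr0_norm ?mulr_gt0 // ler_piMr // ltW // mulr_gt0.
rewrite enormZ gtr0_norm ?mulr_gt0 ?exprn_gt0 //.
have : 0 <= z ^+ 11 * u ^+ 2 by rewrite mulr_ge0 ?sqr_ge0 // ltW.
by nra.
Qed.

(** Since |p|^2 u <= 2, if s u were at most 100 then T p would be of order z, while the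
    critical equation makes it almost as large as w0. *)
Lemma near_core : 100 <= Y.
Proof.
rewrite leNgt; apply/negP => Y100.
have [_ z1 zw /andP[V1 V2] /andP[F1 F2] _ _ _ _ _ _ _ _ _ _] := nd.
have Y0 : 0 < Y by rewrite mulr_gt0.
have a1 : z ^+ 7 * u = z ^+ 3 * Y by rewrite /Y; ring.
have a2 : z ^+ 11 * u ^+ 2 = z ^+ 3 * Y ^+ 2 by rewrite /Y; ring.
have z2 : z ^+ 2 <= 1 by rewrite exprn_ile1 ?(ltW z0) //; lra.
have z3 : z ^+ 3 <= z by rewrite exprS ler_piMr // ltW.
(* T^2 |p|^2 = 4 z^2 (s u)^3 (|p|^2 u) (s u V - F)^2 *)
have TP : `|T| * P <= 4 * z * 101 ^+ 3.
  rewrite -ler_sqr ?nnegrE ?mulr_ge0 // ?(ltW z0) // exprMn real_normK ?num_real //.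
  have Yb : (Y * V - F) ^+ 2 <= 36 / 25 * 101 ^+ 2.
    have y1 : 0 <= Y * V by nra.
    have y2 : Y * V <= 120 by nra.
    have d1 : - 2 <= Y * V - F by lra.
    have d2 : Y * V - F <= 120 by lra.
    move: (Y * V - F) d1 d2 => d d1 d2; nra.
  rewrite (_ : T ^+ 2 * P ^+ 2 = 4 * z ^+ 2 * Y ^+ 3 * (P ^+ 2 * u) * (Y * V - F) ^+ 2).
    have q1 : 0 <= z ^+ 2 * Y ^+ 3 by rewrite mulr_ge0 ?sqr_ge0 // exprn_ge0 // ltW.
    have q2 : z ^+ 2 * Y ^+ 3 <= z ^+ 2 * 100 ^+ 3.
      by rewrite ler_wpM2l ?sqr_ge0 // lerXn2r ?nnegrE ?(ltW Y0) // ltW.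
    have q3 : (P ^+ 2 * u) * (Y * V - F) ^+ 2 <= 2 * (36 / 25 * 101 ^+ 2).
      by apply: ler_pM => //; rewrite ?sqr_ge0 ?mulr_ge0 ?sqr_ge0 ?(ltW u0) // P2u.
    have q4 : 0 <= (P ^+ 2 * u) * (Y * V - F) ^+ 2.
      by rewrite mulr_ge0 ?sqr_ge0 // mulr_ge0 ?sqr_ge0 // ltW.
    have q5 := ler_pM q1 q4 q2 q3.
    have q6 := sqr_ge0 z.
    rewrite -!mulrA in q5 *; lra.
  by rewrite /T /Y; ring.
have Y2 : Y ^+ 2 <= 100 ^+ 2 by nra.
have := lowT; rewrite a1 a2 => h.
have h1 : z ^+ 3 * Y <= z * 100 by apply: ler_pM => //; rewrite ltW.
have h2 : z ^+ 3 * Y ^+ 2 <= z * 100 ^+ 2 by apply: ler_pM => //; rewrite ?sqr_ge0 // ltW.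
have : 10 ^+ 7 * z <= z * (4 * 101 ^+ 3 + 100 + 100 ^+ 2) by lra.
by have := z0; lra.
Qed.

Let Yh := near_core.
Let D := z ^+ 11 * u ^+ 3.

Let D0 : 0 < D. Proof. by rewrite mulr_gt0 // exprn_gt0. Qed.

Let u_big : 10 ^+ 6 <= u.
Proof.
have [_ z1 _ _ _ _ _ _ _ _ _ _ _ _ _] := nd; have h := Yh.
have t1 : 1000 * z <= 1 by lra.
have t0 : 0 <= 1000 * z by have := z0; lra.
have t2 := exprn_ile1 4 t0 t1.
have t3 : (1000 * z) ^+ 4 * u <= 1 * u by rewrite ler_pM2r.
have t4 : 10 ^+ 12 * Y <= u.
  by apply: le_trans (_ : (1000 * z) ^+ 4 * u <= _); [rewrite /Y; lra | lra].
lra.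
Qed.

Let D_big : 10 ^+ 6 <= D.
Proof.
have h : (100 : R) ^+ 3 <= Y ^+ 3 by rewrite lerXn2r ?nnegrE // ltW // mulr_gt0.
have [_ z1 _ _ _ _ _ _ _ _ _ _ _ _ _] := nd.
have e : D * z = Y ^+ 3 by rewrite /D /Y; ring.
have : D * z <= D * 1 by rewrite ler_pM2l //; lra.
by rewrite mulr1 e; lra.
Qed.

Let Au : z ^+ 7 * u * 100 * u <= D.
Proof.
have h := Yh; rewrite (_ : D = Y * (z ^+ 7 * u ^+ 2)); last by rewrite /D /Y; ring.
rewrite (_ : z ^+ 7 * u * 100 * u = 100 * (z ^+ 7 * u ^+ 2)); last by ring.
by rewrite ler_pM2r // mulr_gt0 // exprn_gt0.
Qed.

Let sAu2 : z ^+ 11 * u ^+ 2 * u = D. Proof. by rewrite /D; ring. Qed.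

Let Au_small : z ^+ 7 * u * 10 ^+ 6 <= D.
Proof.
apply: le_trans Au; have h := u_big; have : 0 < z ^+ 7 * u by rewrite mulr_gt0.
by move: (z ^+ 7 * u) => t t0; nra.
Qed.

Let sAu2_small : z ^+ 11 * u ^+ 2 * 10 ^+ 6 <= D.
Proof.
rewrite -sAu2 ler_pM2l ?mulr_gt0 ?exprn_gt0 //; have := u_big; lra.
Qed.

Let aE : D = z ^+ 7 * u ^+ 2 * Y. Proof. by rewrite /D /Y; ring. Qed.
Let a_gt0 : 0 < z ^+ 7 * u ^+ 2. Proof. by rewrite mulr_gt0 // exprn_gt0. Qed.
Let TE : T = z ^+ 7 * u ^+ 2 * (2 * (Y * V - F)). Proof. by rewrite /T; ring. Qed.

Lemma T_lower : 7 / 5 * D <= T.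
Proof.
have [_ _ _ /andP[V1 V2] /andP[F1 F2] _ _ _ _ _ _ _ _ _ _] := nd; have h := Yh.
rewrite TE aE [7 / 5 * _]mulrC -[_ * Y * _]mulrA ler_pM2l //.
have : Y * V >= Y * (4 / 5) by rewrite ler_wpM2l //; lra.
lra.
Qed.

Lemma T_gt0 : 0 < T.
Proof. by have := T_lower; have := D0; lra. Qed.

Lemma T_upper : T <= 12 / 5 * D.
Proof.
have [_ _ _ /andP[V1 V2] /andP[F1 F2] _ _ _ _ _ _ _ _ _ _] := nd; have h := Yh.
rewrite TE aE [12 / 5 * _]mulrC -[_ * Y * _]mulrA ler_pM2l //.
have : Y * V <= Y * (6 / 5) by rewrite ler_wpM2l //; lra.
lra.
Qed.

Let PD : D * P <= 2 + z ^+ 7 * u + z ^+ 11 * u ^+ 2.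
Proof.
apply: le_trans highT; rewrite gtr0_norm ?T_gt0 //; apply: ler_wpM2r => //.
by have := T_lower; have := D0; lra.
Qed.

Let P_small : P <= 1 / 1000.
Proof.
have [? ? ?] := And3 PD Au_small sAu2_small; have ? := D_big.
have h : D * P <= D * (1 / 1000) by lra.
by move: h; rewrite ler_pM2l.
Qed.

Lemma tau_big : 99 / 100 <= tau.
Proof.
have := u_big; rewrite (nd_tau nd) => h; have := nd_c1 nd.
have : u^-1 <= 1 / 100 by rewrite -[1 / 100]invrK lef_pV2 ?posrE ?invr_gt0 //; lra.
lra.
Qed.

Lemma u_le : u * z ^+ 8 <= 3.
Proof.
have /andP[h _] := c_bounds; have := cu_le1; have := u0; nra.
Qed.

(** (1 - tau) u + (c - 1) u = 1. If (c - 1) u >= 1/16 then u is comparable to its maximum,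
    of order z^-8, hence so large that T p = O (1) leaves only a tiny p; otherwise
    |p|^2 u = (1 + tau) (1 - tau) u with (1 - tau) u >= 15/16 and tau close to 1. *)
Lemma near_cases :
  (z ^+ 8 * u >= 1 / 8 /\ P <= 17 * z ^+ 8) \/ 9 / 5 <= P ^+ 2 * u.
Proof.
have [_ z1 _ _ _ _ _ _ _ _ _ _ _ _ _] := nd.
have /andP[_ cz] := c_bounds.
have [k|k] := leP (1 / 16) ((c - 1) * u); [left|right].
  have z8u : 1 / 8 <= z ^+ 8 * u.
    have : (c - 1) * u <= z ^+ 8 / 2 * u by rewrite ler_pM2r.
    lra.
  split => //.
  have ui : u^-1 <= 8 * z ^+ 8.
    rewrite -[u^-1]mul1r ler_pdivrMr //; lra.
  (* of the three terms, the last one, 1 / u, is the largest *)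
  have e : P <= D^-1 * 2 + z ^+ 7 * u / D + z ^+ 11 * u ^+ 2 / D.
    by rewrite [D^-1 * 2]mulrC -!mulrDl ler_pdivlMr // mulrC.
  have ui0 : 0 < u^-1 by rewrite invr_gt0.
  have i2 : u^-1 ^+ 2 <= 64 * z ^+ 16.
    rewrite (_ : 64 * z ^+ 16 = (8 * z ^+ 8) ^+ 2); last by ring.
    by rewrite lerXn2r ?nnegrE ?(ltW ui0) // mulr_ge0 // ltW.
  have i3 : u^-1 ^+ 3 <= 512 * z ^+ 24.
    rewrite (_ : 512 * z ^+ 24 = (8 * z ^+ 8) ^+ 3); last by ring.
    by rewrite lerXn2r ?nnegrE ?(ltW ui0) // mulr_ge0 // ltW.
  have e1 : D^-1 * 2 <= 1024 * z ^+ 13.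
    rewrite (_ : D^-1 * 2 = 2 / z ^+ 11 * u^-1 ^+ 3); last first.
      by rewrite /D; field; rewrite !gt_eqF.
    rewrite (_ : 1024 * z ^+ 13 = 2 / z ^+ 11 * (512 * z ^+ 24)); last first.
      by field; rewrite gt_eqF.
    by rewrite ler_pM2l // divr_gt0.
  have e2 : z ^+ 7 * u / D <= 64 * z ^+ 12.
    rewrite (_ : z ^+ 7 * u / D = z ^- 4 * u^-1 ^+ 2); last first.
      by rewrite /D; field; rewrite !gt_eqF.
    rewrite (_ : 64 * z ^+ 12 = z ^- 4 * (64 * z ^+ 16)); last first.
      by field; rewrite gt_eqF.
    by rewrite ler_pM2l // invr_gt0.
  have e3 : z ^+ 11 * u ^+ 2 / D <= 8 * z ^+ 8.
    by rewrite (_ : _ / D = u^-1) // /D; field; rewrite !gt_eqF.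
  have zz n : z ^+ n.+1 <= z ^+ n / 1000.
    by rewrite exprSr ler_pM2l //; lra.
  have := zz 8; have := zz 9; have := zz 10; have := zz 11; have := zz 12; have := zn 8; lra.
rewrite /P sqr_enorm (nd_p nd) (_ : _ * u = (1 + tau) * ((1 - tau) * u)); last by ring.
by rewrite kappa; have := tau_big; nra.
Qed.

Variables (M : 'M[R]_4) (x : E) (N beta lF lV lf lv : R).
Hypothesis hM : op2_bound M x N beta.
Hypothesis hlF : `|lF| <= beta.
Hypothesis hlV : `|lV| <= 3 / 10 * beta.
Hypothesis lfE : lf = lF + z ^+ 11 * (6 * u ^+ 4 * bil M p p - 2 * N * tau * u ^+ 3).
Hypothesis lvE : lv = lV + z ^+ 7 * (2 * u ^+ 3 * bil M p p - N * tau * u ^+ 2).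

Let f := F + z ^+ 11 * u ^+ 2.
Let v := V + z ^+ 7 * u.
Let gv := gV + (z ^+ 7 * u ^+ 2) *: p.
Let m := u * (3 * Y * V - 2 * F) / (Y * V - F) + z ^+ 7 * u ^+ 2 / v.

Let YVF : 0 < Y * V - F.
Proof.
have [_ _ _ /andP[V1 V2] /andP[F1 F2] _ _ _ _ _ _ _ _ _ _] := nd; have h := Yh; nra.
Qed.

Lemma v_gt0 : 0 < v.
Proof.
have [_ _ _ /andP[V1 V2] _ _ _ _ _ _ _ _ _ _ _] := nd.
by rewrite addr_gt0 ?mulr_gt0 //; lra.
Qed.

Lemma f_gt0 : 0 < f.
Proof.
have [_ _ _ _ /andP[F1 F2] _ _ _ _ _ _ _ _ _ _] := nd.
by rewrite addr_gt0 ?mulr_gt0 ?exprn_gt0 //; lra.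
Qed.

Lemma m_bounds : 3 * u <= m <= 21 / 5 * u.
Proof.
have [_ _ _ /andP[V1 V2] /andP[F1 F2] _ _ _ _ _ _ _ _ _ _] := nd; have h := Yh.
have h1 : 3 * u <= u * (3 * Y * V - 2 * F) / (Y * V - F).
  by rewrite ler_pdivlMr // [3 * u]mulrC -[u * 3 * _]mulrA ler_pM2l //; lra.
have h2 : u * (3 * Y * V - 2 * F) / (Y * V - F) <= 16 / 5 * u.
  by rewrite ler_pdivrMr // [16 / 5 * u]mulrC -[u * _ * (Y * V - F)]mulrA ler_pM2l //;
    have : Y * (4 / 5) <= Y * V; [rewrite ler_wpM2l //; lra|lra].
have h3 : 0 <= z ^+ 7 * u ^+ 2 / v.
  by rewrite divr_ge0 ?(ltW v_gt0) // mulr_ge0 ?sqr_ge0 // ltW.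
have h4 : z ^+ 7 * u ^+ 2 / v <= u.
  rewrite ler_pdivrMr ?v_gt0 // /v; have := u0; have : 0 < z ^+ 7 * u by rewrite mulr_gt0.
  rewrite (_ : z ^+ 7 * u ^+ 2 = u * (z ^+ 7 * u)); last by ring.
  by move=> *; rewrite ler_pM2l //; lra.
by apply/andP; split; rewrite /m; lra.
Qed.

Let Err := V * lF - 2 * F * lV + z ^+ 7 * u * lF - 2 * z ^+ 11 * u ^+ 2 * lV
  - 2 * f / v * (bil M gV gV + 2 * (z ^+ 7 * u ^+ 2) * bil M p gV).

(* m collects the coefficients of [bil M p p], and Err the terms with a factor gV, lF or lV *)
Let main_id : v * lf - 2 * f * lv - 2 * f / v * bil M gv gv =
  T * (- N * tau + m * bil M p p) + Err.
Proof.
have v0 := gt_eqF v_gt0; have YVF0 := gt_eqF YVF.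
rewrite lfE lvE /gv /Err /m /T !bilDl !bilDr !bilZl !bilZr (bilC M p gV).
move: (bil M gV gV) (bil M gV p) (bil M p p) => b1 b2 b3.
have vn : v != 0 by rewrite v0.
have yn : Y * V - F != 0 by rewrite YVF0.
rewrite /f; move: yn vn; rewrite /v /Y => yn vn.
by field; rewrite yn vn.
Qed.

Let Err_le : `|Err| <= T * beta / 100.
Proof.
have [_ _ _ /andP[V1 V2] /andP[F1 F2] _ hgV _ _ _ _ _ _ _ _] := nd; have hY := Yh.
have [hx _ b0 _ hB] := hM.
have v0 := v_gt0; have f0 := f_gt0.
have a0 : 0 < z ^+ 7 * u by rewrite mulr_gt0.
have s0 : 0 < z ^+ 11 * u ^+ 2 by rewrite mulr_gt0 ?exprn_gt0.
have gV0 := enorm_ge0 gV.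
have B1 : `|bil M gV gV| <= beta / 25.
  apply: le_trans (hB _ _) _; rewrite ler_wpM2l //.
  by move: (enorm gV) gV0 hgV => t t0 t1; nra.
have B2 : `|bil M p gV| <= beta * P / 5.
  apply: le_trans (hB _ _) _; rewrite -mulrA ler_wpM2l // -/P ler_wpM2l //; lra.
have fv1 : 2 * f / v <= 5 * (1 + z ^+ 11 * u ^+ 2).
  rewrite ler_pdivrMr // /f /v.
  have : 5 * (1 + z ^+ 11 * u ^+ 2) * (4 / 5) <= 5 * (1 + z ^+ 11 * u ^+ 2) * (V + z ^+ 7 * u).
    by rewrite ler_wpM2l //; lra.
  lra.
have fv2 : 2 * f / v * (z ^+ 7 * u ^+ 2) <= 2 * D.
  rewrite mulrAC ler_pdivrMr // (_ : 2 * D * v = 2 * (Y * v) * (z ^+ 7 * u ^+ 2)); last first.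
    by rewrite /D /Y; ring.
  rewrite ler_pM2r ?mulr_gt0 ?exprn_gt0 // /f /v.
  rewrite (_ : Y * (V + z ^+ 7 * u) = Y * V + z ^+ 11 * u ^+ 2); last by rewrite /Y; ring.
  nra.
have fv0 : 0 <= 2 * f / v by rewrite divr_ge0 ?mulr_ge0 ?ltW.
have E1 : `|V * lF| <= 6 / 5 * beta.
  rewrite normrM; apply: ler_pM => //; rewrite gtr0_norm; lra.
have E2 : `|2 * F * lV| <= 12 / 5 * (3 / 10 * beta).
  rewrite normrM; apply: ler_pM => //; rewrite gtr0_norm; lra.
have E3 : `|z ^+ 7 * u * lF| <= z ^+ 7 * u * beta.
  by rewrite normrM gtr0_norm // ler_pM2l.
have E4 : `|2 * z ^+ 11 * u ^+ 2 * lV| <= 2 * z ^+ 11 * u ^+ 2 * (3 / 10 * beta).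
  have h : 0 < 2 * z ^+ 11 * u ^+ 2 by lra.
  by rewrite normrM gtr0_norm // ler_wpM2l // ltW.
have E5 : `|2 * f / v * bil M gV gV| <= 5 * (1 + z ^+ 11 * u ^+ 2) * (beta / 25).
  by rewrite normrM ger0_norm //; apply: ler_pM.
have E6 : `|2 * f / v * (2 * (z ^+ 7 * u ^+ 2) * bil M p gV)| <= 4 * D * (beta * P / 5).
  rewrite (_ : _ * (2 * _ * _) = 2 * (2 * f / v * (z ^+ 7 * u ^+ 2)) * bil M p gV); last by ring.
  rewrite normrM ger0_norm; last first.
    by rewrite mulr_ge0 // mulr_ge0 // mulr_ge0 ?sqr_ge0 // ltW.
  apply: ler_pM => //; last lra.
  by rewrite mulr_ge0 // mulr_ge0 // mulr_ge0 ?sqr_ge0 // ltW.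
have tot : `|Err| <= beta * (3 + z ^+ 7 * u + 2 * (z ^+ 11 * u ^+ 2) + 4 / 5 * (D * P)).
  rewrite /Err mulrDr.
  move: E1 E2 E3 E4 E5 E6; rewrite !ler_norml.
  move=> /andP[? ?] /andP[? ?] /andP[? ?] /andP[? ?] /andP[? ?] /andP[? ?].
  by apply/andP; split; lra.
apply: le_trans tot _; rewrite (_ : T * beta / 100 = beta * (T / 100)); last by ring.
apply: ler_wpM2l => //.
have := T_lower; have [? ? ? ?] := And4 PD Au_small sAu2_small D_big.
have : D * P <= D * (1 / 1000) by rewrite ler_pM2l.
lra.
Qed.

(** The left side is v^3 [op2 M K]. The T of the critical equation comes out as a factor, and
    in what remains - N tau dominates at the top of the bubble, m' [bil M p p] below it. *)
Lemma near_op2 : exists m', [/\ 3 * u <= m' <= 21 / 5 * u &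
  `|v * lf - 2 * f * lv - 2 * f / v * bil M gv gv - T * (- N * tau + m' * bil M p p)|
   <= T * beta / 100].
Proof.
exists m; split; first exact: m_bounds.
by rewrite main_id addrC addKr; exact: Err_le.
Qed.

End Near.

(** * Bubbles of bounded height as a perturbation *)

Section Model.
Variable R : realType.
Local Notation E := 'rV[R]_4.

Definition nondeg (K : E -> R) x := forall u, tangent x u ->
  (forall w, tangent x w -> hessian K x u w = 0) -> u = 0.

Variables (b : 'I_4 -> E) (hb : frame b).
Variables (k : nat) (q : 'I_k -> E) (hq : forall j, S3 (q j)).
Variables (z : R).
Hypotheses (z0 : 0 < z) (z1 : z <= 1 / 1000).

Let zn n : 0 < z ^+ n. Proof. by rewrite exprn_gt0. Qed.

Definition cz : R := Num.sqrt (1 + z ^+ 8).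
Local Notation c := cz.

Lemma cz_sqr : c ^+ 2 = 1 + z ^+ 8.
Proof. by rewrite sqr_sqrtr // addr_ge0 // ltW. Qed.

Lemma cz_gt1 : 1 < c.
Proof.
rewrite ltNge; apply/negP => h; have := cz_sqr; have c0 : 0 <= c by exact: sqrtr_ge0.
have := zn 8; nra.
Qed.

Definition bubz i := bub (q i) c.
(** Arbitrary coefficients allow one bubble to be removed, see [off]. *)
Definition comb_v (al : 'I_k -> R) (x : E) : R := 1 + Quad b x + \sum_i al i * bubz i x.
Definition comb_f (al : 'I_k -> R) (x : E) : R := 1 + 3 * Quad b x +
  \sum_i (z ^+ 4 * al i) * (bubz i x * bubz i x).

Definition full (i : 'I_k) : R := z ^+ 7.
Definition off (j i : 'I_k) : R := if i == j then 0 else z ^+ 7.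

Let C2u i : C2_S3 (bubz i). Proof. rewrite /bubz; exact: (C2_bub (hq i) cz_gt1). Qed.
Let C2uu i : C2_S3 (fun x => bubz i x * bubz i x). Proof. exact: C2_mul (C2u i) (C2u i). Qed.
Let C2Q : C2_S3 (Quad b) := C2_Quad b.

Let C2s (al : 'I_k -> R) : C2_S3 (fun x => \sum_i al i * bubz i x).
Proof. by apply: C2_sum => i; exact: C2_scale _ (C2u i). Qed.
Let C2t (al : 'I_k -> R) : C2_S3 (fun x => \sum_i (z ^+ 4 * al i) * (bubz i x * bubz i x)).
Proof. by apply: C2_sum => i; exact: C2_scale _ (C2uu i). Qed.
Let C2Q1 : C2_S3 (fun x => 1 + Quad b x) := C2_add (C2_cst 1) C2Q.
Let C2Q3 : C2_S3 (fun x => 1 + 3 * Quad b x) := C2_add (C2_cst 1) (C2_scale 3 C2Q).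

Lemma C2_comb_v al : C2_S3 (comb_v al). Proof. exact: C2_add C2Q1 (C2s al). Qed.
Lemma C2_comb_f al : C2_S3 (comb_f al). Proof. exact: C2_add C2Q3 (C2t al). Qed.

Section At.
Variables (x : E) (hx : S3 x).

Local Notation p i := (q i - dot (q i) x *: x).

Lemma grad_comb_v al : grad (comb_v al) x = grad (Quad b) x + \sum_i (al i * bubz i x ^+ 2) *: p i.
Proof.
rewrite (grad_add hx C2Q1 (C2s al)) (grad_add hx (C2_cst 1) C2Q) (grad_cst hx) add0r.
rewrite (grad_sum hx (fun i => C2_scale (al i) (C2u i))).
congr (_ + _); apply: eq_bigr => i _.
by rewrite (grad_scale hx _ (C2u i)) (grad_bub (hq i) cz_gt1 hx) scalerA.
Qed.

Lemma grad_comb_f al : grad (comb_f al) x = 3 *: grad (Quad b) x +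
  \sum_i (z ^+ 4 * al i * (2 * bubz i x ^+ 3)) *: p i.
Proof.
rewrite (grad_add hx C2Q3 (C2t al)) (grad_add hx (C2_cst 1) (C2_scale 3 C2Q)) (grad_cst hx) add0r.
rewrite (grad_scale hx _ C2Q) (grad_sum hx (fun i => C2_scale (z ^+ 4 * al i) (C2uu i))).
congr (_ + _); apply: eq_bigr => i _.
rewrite (grad_scale hx _ (C2uu i)) (grad_mul hx (C2u i) (C2u i)) (grad_bub (hq i) cz_gt1 hx).
by rewrite -scalerDl !scalerA; congr (_ *: _); rewrite -/(bubz i x); ring.
Qed.

Section SecondOrder.
Variables (M : 'M[R]_4) (N beta : R) (hM : op2_bound M x N beta).

Let sM : linear_trace M x N. Proof. by have [] := hM. Qed.

Lemma op2_bubz i : op2 M (bubz i) x =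
  2 * bubz i x ^+ 3 * bil M (p i) (p i) - N * dot (q i) x * bubz i x ^+ 2.
Proof. exact: (op2_bub (hq i) cz_gt1 hx sM). Qed.

Lemma op2_bubz2 i : op2 M (fun x => bubz i x * bubz i x) x =
  6 * bubz i x ^+ 4 * bil M (p i) (p i) - 2 * N * dot (q i) x * bubz i x ^+ 3.
Proof.
rewrite (op2_mul hx M (C2u i) (C2u i)) (grad_bub (hq i) cz_gt1 hx) bilZl bilZr op2_bubz.
rewrite -/(bubz i x); set bb := bil _ _ _; move: bb (bubz i x) (dot (q i) x) => bb u t.
by ring.
Qed.

Lemma op2_comb_v al : op2 M (comb_v al) x = op2 M (Quad b) x + \sum_i al i * op2 M (bubz i) x.
Proof.
rewrite (op2_add hx M C2Q1 (C2s al)) (op2_add hx M (C2_cst 1) C2Q) (op2_cst hx) add0r.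
rewrite (op2_sum hx M (fun i => C2_scale (al i) (C2u i))).
by congr (_ + _); apply: eq_bigr => i _; rewrite (op2_scale hx M _ (C2u i)).
Qed.

Lemma op2_comb_f al : op2 M (comb_f al) x = 3 * op2 M (Quad b) x +
  \sum_i z ^+ 4 * al i * op2 M (fun x => bubz i x * bubz i x) x.
Proof.
rewrite (op2_add hx M C2Q3 (C2t al)) (op2_add hx M (C2_cst 1) (C2_scale 3 C2Q)) (op2_cst hx) add0r.
rewrite (op2_scale hx M _ C2Q) (op2_sum hx M (fun i => C2_scale (z ^+ 4 * al i) (C2uu i))).
by congr (_ + _); apply: eq_bigr => i _; rewrite (op2_scale hx M _ (C2uu i)).
Qed.

End SecondOrder.

Section Small.
Variables (U : R) (U1 : 1 <= U) (al : 'I_k -> R).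
Hypothesis al_le : forall i, 0 <= al i <= z ^+ 7.
Hypothesis uU : forall i, al i != 0 -> bubz i x <= U.

(** 8 U^4 bounds u, s u^2 and their first and second derivatives where u <= U, for U >= 1. *)
Definition bg_err : R := 8 * z ^+ 7 * U ^+ 4 * k%:R.

Let u0 i : 0 < bubz i x. Proof. by rewrite /bubz; exact: (bub_gt0 (hq i) cz_gt1 hx). Qed.

Let pow m n (t : R) : (m <= n)%N -> 0 <= t -> t <= U -> t ^+ m <= U ^+ n.
Proof.
move=> mn t0 tU; have U0 : 0 <= U by lra.
apply: le_trans (_ : U ^+ m <= _); first by rewrite lerXn2r.
by apply: ler_weXn2l.
Qed.

Let sum_small (t : 'I_k -> R) :
  (forall i, `|t i| <= 8 * z ^+ 7 * U ^+ 4) -> `|\sum_i t i| <= bg_err.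
Proof.
move=> h; apply: le_trans (ler_norm_sum _ _ _) _.
apply: le_trans (ler_sum _ (fun i _ => h i)) _.
by rewrite sumr_const card_ord /bg_err mulr_natr.
Qed.

Let sum_smallv (t : 'I_k -> E) :
  (forall i, enorm (t i) <= 8 * z ^+ 7 * U ^+ 4) -> enorm (\sum_i t i) <= bg_err.
Proof.
move=> h; apply: le_trans (enorm_sum _ _) _.
apply: le_trans (ler_sum _ (fun i _ => h i)) _.
by rewrite sumr_const card_ord /bg_err mulr_natr.
Qed.

Let term i (X B : R) : (bubz i x <= U -> `|X| <= 8 * U ^+ 4 * B) -> 0 <= B ->
  `|al i * X| <= 8 * z ^+ 7 * U ^+ 4 * B.
Proof.
move=> h B0; have [a0|a0] := eqVneq (al i) 0.
  rewrite a0 mul0r normr0; apply: mulr_ge0 => //; apply: mulr_ge0.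
    by have := zn 7; lra.
  by apply: exprn_ge0; exact: le_trans ler01 U1.
have /andP[al0 al1] := al_le i.
rewrite normrM ger0_norm // (_ : 8 * z ^+ 7 * U ^+ 4 * B = z ^+ 7 * (8 * U ^+ 4 * B)); last by ring.
by apply: ler_pM => //; apply/h/uU.
Qed.

Let z4 : z ^+ 4 <= 1. Proof. by have h := z1; rewrite exprn_ile1 ?(ltW z0) //; lra. Qed.

Let term4 i (X B : R) : (bubz i x <= U -> `|X| <= 8 * U ^+ 4 * B) -> 0 <= B ->
  `|z ^+ 4 * al i * X| <= 8 * z ^+ 7 * U ^+ 4 * B.
Proof.
move=> h B0; apply: le_trans (term h B0); rewrite -mulrA normrM (gtr0_norm (zn 4)).
by rewrite ler_piMl.
Qed.

Let U4 : 1 <= U ^+ 4. Proof. by rewrite exprn_ege1. Qed.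

Lemma small_v : `|comb_v al x - (1 + Quad b x)| <= bg_err.
Proof.
rewrite /comb_v addrAC subrr add0r; apply: sum_small => i; rewrite -[X in _ <= X]mulr1.
apply: term => // h; rewrite gtr0_norm //; have h4' := U4; have := pow (isT : (1 <= 4)%N) (ltW (u0 i)) h.
by rewrite expr1; lra.
Qed.

Lemma small_f : `|comb_f al x - (1 + 3 * Quad b x)| <= bg_err.
Proof.
rewrite /comb_f addrAC subrr add0r; apply: sum_small => i; rewrite -[X in _ <= X]mulr1.
have h4 := U4; apply: term4 => // h; rewrite gtr0_norm ?mulr_gt0 //.
have h4' := U4; have := pow (isT : (2 <= 4)%N) (ltW (u0 i)) h.
by rewrite expr2; lra.
Qed.

Let p_le i : enorm (p i) <= 1.
Proof.
apply: enorm_le => //; rewrite (sqr_proj (hq i)) // expr1n.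
by have := sqr_ge0 (dot (q i) x); lra.
Qed.

Lemma small_gv : enorm (grad (comb_v al) x - grad (Quad b) x) <= bg_err.
Proof.
rewrite grad_comb_v addrAC subrr add0r; apply: sum_smallv => i.
rewrite enormZ -[X in _ <= X]mulr1; apply: ler_pM; rewrite ?enorm_ge0 //.
rewrite -[X in _ <= X]mulr1; apply: term => // h.
rewrite ger0_norm ?sqr_ge0 //; have h4' := U4; have := pow (isT : (2 <= 4)%N) (ltW (u0 i)) h; lra.
Qed.

Lemma small_gf : enorm (grad (comb_f al) x - 3 *: grad (Quad b) x) <= bg_err.
Proof.
rewrite grad_comb_f addrAC subrr add0r; apply: sum_smallv => i.
rewrite enormZ -[X in _ <= X]mulr1; apply: ler_pM; rewrite ?enorm_ge0 //.
rewrite -[X in _ <= X]mulr1; apply: term4 => // h.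
rewrite gtr0_norm ?mulr_gt0 ?exprn_gt0 //.
have h4' := U4; have := pow (isT : (3 <= 4)%N) (ltW (u0 i)) h; lra.
Qed.

Section SecondOrder.
Variables (M : 'M[R]_4) (N beta : R) (hM : op2_bound M x N beta).

Let b0 : 0 <= beta. Proof. by have [] := hM. Qed.

Let sum_smallb (t : 'I_k -> R) :
  (forall i, `|t i| <= 8 * z ^+ 7 * U ^+ 4 * beta) -> `|\sum_i t i| <= bg_err * beta.
Proof.
move=> h; apply: le_trans (ler_norm_sum _ _ _) _.
apply: le_trans (ler_sum _ (fun i _ => h i)) _.
by rewrite sumr_const card_ord /bg_err -mulr_natr le_eqVlt; apply/orP; left; apply/eqP; ring.
Qed.

Let bpp i : `|bil M (p i) (p i)| <= beta.
Proof.
have [_ _ _ _ hB] := hM; apply: le_trans (hB _ _) _.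
rewrite ler_piMr // mulr_ile1 ?enorm_ge0 //.
Qed.

Let Nt i : `|N * dot (q i) x| <= beta.
Proof.
have [_ _ _ hN _] := hM; rewrite normrM -[X in _ <= X]mulr1; apply: ler_pM => //.
by rewrite ler_norml; exact: dot_unit_bound (hq i) hx.
Qed.

Lemma small_lv : `|op2 M (comb_v al) x - op2 M (Quad b) x| <= bg_err * beta.
Proof.
rewrite op2_comb_v // addrAC subrr add0r; apply: sum_smallb => i; apply: term => // h.
rewrite (op2_bubz hM); have h4' := U4; have h3 := pow (isT : (3 <= 4)%N) (ltW (u0 i)) h.
have h2 := pow (isT : (2 <= 4)%N) (ltW (u0 i)) h.
have e1 : `|2 * bubz i x ^+ 3 * bil M (p i) (p i)| <= 2 * U ^+ 4 * beta.
  rewrite normrM; apply: ler_pM => //; rewrite gtr0_norm ?mulr_gt0 ?exprn_gt0 //; lra.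
have e2 : `|N * dot (q i) x * bubz i x ^+ 2| <= beta * U ^+ 4.
  by rewrite normrM; apply: ler_pM => //; rewrite ger0_norm ?sqr_ge0.
apply: le_trans (ler_normB _ _) _; apply: le_trans (lerD e1 e2) _.
have : 0 <= U ^+ 4 * beta by rewrite mulr_ge0 //; lra.
lra.
Qed.

Lemma small_lf : `|op2 M (comb_f al) x - 3 * op2 M (Quad b) x| <= bg_err * beta.
Proof.
rewrite op2_comb_f // addrAC subrr add0r; apply: sum_smallb => i; apply: term4 => // h.
rewrite (op2_bubz2 hM); have h4' := U4; have h3 := pow (isT : (3 <= 4)%N) (ltW (u0 i)) h.
have h4 := pow (isT : (4 <= 4)%N) (ltW (u0 i)) h.
have e1 : `|6 * bubz i x ^+ 4 * bil M (p i) (p i)| <= 6 * U ^+ 4 * beta.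
  rewrite normrM; apply: ler_pM => //; rewrite gtr0_norm ?mulr_gt0 ?exprn_gt0 //; lra.
have e2 : `|2 * N * dot (q i) x * bubz i x ^+ 3| <= 2 * beta * U ^+ 4.
  rewrite normrM; apply: ler_pM => //; last by rewrite gtr0_norm ?exprn_gt0.
  by rewrite -mulrA normrM gtr0_norm // ler_wpM2l.
apply: le_trans (ler_normB _ _) _; apply: le_trans (lerD e1 e2) _.
have : 0 <= U ^+ 4 * beta by rewrite mulr_ge0 //; lra.
lra.
Qed.

End SecondOrder.
End Small.
End At.
End Model.

(** * Nondegeneracy of the background *)

Section Background.
Variable R : realType.
Local Notation E := 'rV[R]_4.

(** y is a unit vector almost along the first axis, and u orthogonal to y has most of its
    length along the other axes, where the d_i are not small. *)
Lemma hess_gap4 (d1 d2 d3 d4 y1 y2 y3 y4 u1 u2 u3 u4 : R) :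
  36 / 100 / 10 / 100 <= d2 ^+ 2 -> 36 / 100 / 10 / 100 <= d3 ^+ 2 -> 36 / 100 / 10 / 100 <= d4 ^+ 2 ->
  y1 ^+ 2 + y2 ^+ 2 + y3 ^+ 2 + y4 ^+ 2 = 1 ->
  y1 * u1 + y2 * u2 + y3 * u3 + y4 * u4 = 0 ->
  d1 ^+ 2 * y1 ^+ 2 + d2 ^+ 2 * y2 ^+ 2 + d3 ^+ 2 * y3 ^+ 2 + d4 ^+ 2 * y4 ^+ 2 <= 1 / 10 / 100 / 10 / 100 ->
  35 / 100 / 10 / 100 * (u1 ^+ 2 + u2 ^+ 2 + u3 ^+ 2 + u4 ^+ 2) <=
  d1 ^+ 2 * u1 ^+ 2 + d2 ^+ 2 * u2 ^+ 2 + d3 ^+ 2 * u3 ^+ 2 + d4 ^+ 2 * u4 ^+ 2.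
Proof.
move=> h2 h3 h4 hy hu hs.
have cs : (y1 * u1) ^+ 2 <= (y2 ^+ 2 + y3 ^+ 2 + y4 ^+ 2) * (u2 ^+ 2 + u3 ^+ 2 + u4 ^+ 2).
  have -> : y1 * u1 = - (y2 * u2 + y3 * u3 + y4 * u4) by clear -hu; lra.
  rewrite sqrrN -subr_ge0 (_ : _ - _ = (y2 * u3 - y3 * u2) ^+ 2 +
    (y2 * u4 - y4 * u2) ^+ 2 + (y3 * u4 - y4 * u3) ^+ 2); last by ring.
  by rewrite !addr_ge0 ?sqr_ge0.
rewrite exprMn in cs.
have sq (t : R) : 0 <= t ^+ 2 := sqr_ge0 t.
move: (sq d1) (sq y1) (sq y2) (sq y3) (sq y4) (sq u1) (sq u2) (sq u3) (sq u4).
move: (d1 ^+ 2) (d2 ^+ 2) (d3 ^+ 2) (d4 ^+ 2) h2 h3 h4 hs => e1 e2 e3 e4 h2 h3 h4 hs.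
move: (y1 ^+ 2) (y2 ^+ 2) (y3 ^+ 2) (y4 ^+ 2) hy hs cs => a1 a2 a3 a4 hy hs cs.
move: (u1 ^+ 2) (u2 ^+ 2) (u3 ^+ 2) (u4 ^+ 2) cs => v1 v2 v3 v4 cs e10 a10 a20 a30 a40 v10 v20 v30 v40.
clear hu sq d1 d2 d3 d4 y1 y2 y3 y4 u1 u2 u3 u4.
have p1 : 0 <= e1 * a1 by rewrite mulr_ge0.
have p1' : 0 <= e1 * v1 by rewrite mulr_ge0.
have t (d y : R) : 36 / 100 / 10 / 100 <= d -> 0 <= y -> 36 / 100 / 10 / 100 * y <= d * y.
  by move=> h y0; rewrite ler_wpM2r.
have t2 := t _ _ h2 a20; have t3 := t _ _ h3 a30; have t4 := t _ _ h4 a40.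
have w2 := t _ _ h2 v20; have w3 := t _ _ h3 v30; have w4 := t _ _ h4 v40.
have s_small : a2 + a3 + a4 <= 1 / 300 by clear -hs p1 t2 t3 t4; lra.
have r0 : 0 <= v2 + v3 + v4 by rewrite !addr_ge0.
have y1b : 299 / 300 <= a1 by clear -s_small hy; lra.
have u1b : v1 <= (v2 + v3 + v4) / 250.
  have e11 : 299 / 300 * v1 <= a1 * v1 by rewrite ler_wpM2r.
  have e22 : (a2 + a3 + a4) * (v2 + v3 + v4) <= 1 / 300 * (v2 + v3 + v4) by rewrite ler_wpM2r.
  have : 299 / 300 * v1 <= 1 / 300 * (v2 + v3 + v4).
    by apply: le_trans e22; apply: le_trans cs.
  clear -r0; lra.
clear -u1b w2 w3 w4 p1' r0; lra.
Qed.

Lemma hess_gap_perm (d y w : 'I_4 -> R) (i0 i1 i2 i3 : 'I_4) :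
  (forall F : 'I_4 -> R, \sum_l F l = F i0 + F i1 + F i2 + F i3) ->
  i1 != i0 -> i2 != i0 -> i3 != i0 ->
  (forall l, l != i0 -> 36 / 100 / 10 / 100 <= d l ^+ 2) ->
  \sum_l y l ^+ 2 = 1 -> \sum_l y l * w l = 0 ->
  \sum_l d l ^+ 2 * y l ^+ 2 <= 1 / 10 / 100 / 10 / 100 ->
  35 / 100 / 10 / 100 * \sum_l w l ^+ 2 <= \sum_l d l ^+ 2 * w l ^+ 2.
Proof.
by move=> hF n1 n2 n3 gap; rewrite !hF; apply: hess_gap4; exact: gap.
Qed.

Lemma lam_gap (i l : 'I_4) (t : R) : l != i -> `|lam R i - t| <= 1 / 10 / 100 ->
  19 / 10 / 100 <= `|lam R l - t|.
Proof.
rewrite ler_norml => li /andP[]; move: i li; apply: forall_ord4; move: l;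
  apply: forall_ord4; rewrite /lam //= => _ d1 d2; rewrite ler_normr; apply/orP;
  solve [left; lra | right; lra].
Qed.

Lemma norm_le_sqr (t a : R) : 0 <= a -> t ^+ 2 <= a ^+ 2 -> `|t| <= a.
Proof.
by move=> a0 h; rewrite -ler_sqr ?nnegrE // real_normK ?num_real.
Qed.

Variables (b : 'I_4 -> E) (hb : frame b).
Variables (x : E) (hx : S3 x).
Hypothesis small_grad : enorm (grad (Quad b) x) <= 1 / 5 / 100.

Let sum_small : \sum_l (lam R l - Quad b x) ^+ 2 * dot (b l) x ^+ 2 <= 1 / 10 / 100 / 10 / 100.
Proof.
have h := small_grad.
have : dot (grad (Quad b) x) (grad (Quad b) x) <= (1 / 5 / 100) ^+ 2.
  by rewrite -sqr_enorm !expr2; exact: (ler_pM (enorm_ge0 _) (enorm_ge0 _) h h).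
rewrite (sqr_grad_Quad hb hx); move: (\sum_l _) => t; lra.
Qed.

(** The components of grad Q in the frame are 2 (lam_l - Q) <b_l, x>, and the <b_l, x> form a
    unit vector. *)
Lemma near_eigenvalue : exists i, (lam R i - Quad b x) ^+ 2 <= 1 / 10 / 100 / 10 / 100.
Proof.
apply: contrapT => /forallNP h.
have hi i : 1 / 10 / 100 / 10 / 100 < (lam R i - Quad b x) ^+ 2 by rewrite ltNge; apply/negP/h.
have hsm := sum_small.
have [i yi] : exists i, dot (b i) x != 0.
  apply: contrapT => /forallNP h0; have := (S3P x).1 hx; rewrite hb.1 big1 => [/eqP|i _].
    by rewrite eq_sym oner_eq0.
  by move/negP: (h0 i); rewrite negbK => /eqP ->; rewrite mul0r.
have := sum_small; rewrite leNgt => /negP; apply.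
have -> : 1 / 10 / 100 / 10 / 100 = \sum_l 1 / 10 / 100 / 10 / 100 * dot (b l) x ^+ 2 :> R.
  rewrite -mulr_sumr; have := (S3P x).1 hx; rewrite hb.1.
  by under eq_bigr do rewrite -expr2; move=> ->; rewrite mulr1.
rewrite (bigD1 i) //= [X in _ < X](bigD1 i) //=; apply: ltr_leD.
  by rewrite ltr_pM2r // lt_neqAle eq_sym sqrf_eq0 yi sqr_ge0.
by apply: ler_sum => l _; rewrite ler_wpM2r ?sqr_ge0 // ltW.
Qed.

(** Q (x) is close to some lam_i, and no lam_i is 0. *)
Lemma Quad_away : 9 / 10 / 100 <= `|Quad b x|.
Proof.
have [i hi] := near_eigenvalue.
have hd : `|lam R i - Quad b x| <= 1 / 10 / 100.
  by apply: norm_le_sqr; [lra|move: hi; lra].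
have : 1 / 100 <= `|lam R i|.
  move: (i); apply: forall_ord4; rewrite /lam /=.
  - by rewrite ltr0_norm; lra.
  - by rewrite ltr0_norm; lra.
  - by rewrite gtr0_norm; lra.
  - by rewrite gtr0_norm; lra.
have := ler_normB (lam R i - Quad b x) (- Quad b x).
have := ler_normD (lam R i - Quad b x) (Quad b x); rewrite subrK; lra.
Qed.

Lemma hess_gap u : tangent x u ->
  35 / 100 / 10 / 100 * dot u u <= \sum_l (lam R l - Quad b x) ^+ 2 * dot (b l) u ^+ 2.
Proof.
move=> tu; have [i hi] := near_eigenvalue.
have hy : \sum_l dot (b l) x ^+ 2 = 1.
  have := (S3P x).1 hx; rewrite hb.1.
  by under eq_bigr do rewrite -expr2.
have hu : \sum_l dot (b l) x * dot (b l) u = 0 by rewrite -hb.1.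
have hs := sum_small.
have -> : dot u u = \sum_l dot (b l) u ^+ 2.
  by rewrite hb.1; apply: eq_bigr => l _; rewrite expr2.
have gap l : l != i -> 36 / 100 / 10 / 100 <= (lam R l - Quad b x) ^+ 2.
  have hd : `|lam R i - Quad b x| <= 1 / 10 / 100.
    by apply: norm_le_sqr; [lra|move: hi; lra].
  move: hd; rewrite ler_norml => /andP[d1 d2] li.
  have : 19 / 10 / 100 <= `|lam R l - Quad b x|.
    by apply: (lam_gap li); rewrite ler_norml; apply/andP.
  move=> h'; have : (19 / 10 / 100) ^+ 2 <= `|lam R l - Quad b x| ^+ 2.
    rewrite !expr2; apply: ler_pM; lra.
  rewrite real_normK ?num_real; lra.
pose o0 : 'I_4 := Ordinal (isT : (0 < 4)%N); pose o1 : 'I_4 := Ordinal (isT : (1 < 4)%N).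
pose o2 : 'I_4 := Ordinal (isT : (2 < 4)%N); pose o3 : 'I_4 := Ordinal (isT : (3 < 4)%N).
move: gap; move: (i); apply: forall_ord4 => gap.
- apply: (@hess_gap_perm (fun l => lam R l - Quad b x) _ _ o0 o1 o2 o3 _ isT isT isT gap hy hu hs).
  by move=> F; rewrite sum4.
- apply: (@hess_gap_perm (fun l => lam R l - Quad b x) _ _ o1 o0 o2 o3 _ isT isT isT gap hy hu hs).
  by move=> F; rewrite sum4 -/o0 -/o1 -/o2 -/o3; ring.
- apply: (@hess_gap_perm (fun l => lam R l - Quad b x) _ _ o2 o0 o1 o3 _ isT isT isT gap hy hu hs).
  by move=> F; rewrite sum4 -/o0 -/o1 -/o2 -/o3; ring.
- apply: (@hess_gap_perm (fun l => lam R l - Quad b x) _ _ o3 o0 o1 o2 _ isT isT isT gap hy hu hs).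
  by move=> F; rewrite sum4 -/o0 -/o1 -/o2 -/o3; ring.
Qed.

End Background.

(** * Critical points away from the bubbles *)

Section RealFacts.
Variable R : realType.

Lemma norm_sub3 (P Z L a c : R) : `|P - L| <= a -> `|Z| <= c -> `|P - Z - L| <= a + c.
Proof.
move=> h1 h2; rewrite (_ : P - Z - L = (P - L) - Z); last by ring.
exact: le_trans (ler_normB _ _) (lerD h1 h2).
Qed.

Lemma ratio_le3 (f v : R) : 96 / 100 <= v -> 0 <= f -> f <= 11 / 10 -> `|2 * f / v| <= 3.
Proof.
move=> hv hf0 hf; rewrite ger0_norm; last by rewrite divr_ge0; lra.
by rewrite ler_pdivrMr; lra.
Qed.

Lemma grad_final (e g : R) : 0 <= e -> 91 / 100 * g <= 5 * e -> g <= 6 * e.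
Proof. lra. Qed.

Lemma bounds_final (Qx v f e : R) : e <= 1 / 50 / 100 -> `|Qx| <= 3 / 100 ->
  `|v - (1 + Qx)| <= e -> `|f - (1 + 3 * Qx)| <= e ->
  [/\ 96 / 100 <= v, v <= 104 / 100, 9 / 10 <= f & f <= 11 / 10].
Proof.
by move=> he; rewrite !ler_norml => /andP[? ?] /andP[? ?] /andP[? ?]; split; lra.
Qed.

Lemma one_3Q (Qx : R) : `|Qx| <= 3 / 100 -> 91 / 100 <= 1 - 3 * Qx <= 109 / 100.
Proof. by rewrite ler_norml => /andP[? ?]; apply/andP; split; lra. Qed.

Lemma Lap_away (X Qx e : R) : e <= 1 / 50 / 100 -> `|Qx| <= 3 / 100 -> 9 / 10 / 100 <= `|Qx| ->
  `|X + 8 * ((1 - 3 * Qx) * Qx)| <= 18 * e -> 6 / 100 <= `|X| <= 27 / 100.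
Proof.
move=> he hQ Qa hX; have /andP[t1 t2] := one_3Q hQ.
have t0 : 0 <= 1 - 3 * Qx by lra.
have p1 : 91 / 100 * (9 / 10 / 100) <= (1 - 3 * Qx) * `|Qx| by apply: ler_pM; lra.
have p2 : (1 - 3 * Qx) * `|Qx| <= 109 / 100 * (3 / 100).
  by apply: ler_pM; [lra|exact: normr_ge0|lra|lra].
have n1 : `|8 * ((1 - 3 * Qx) * Qx)| = 8 * ((1 - 3 * Qx) * `|Qx|).
  by rewrite !normrM (ger0_norm t0) ger0_norm.
move: n1 p1 p2 hX; move: (8 * ((1 - 3 * Qx) * Qx)) ((1 - 3 * Qx) * `|Qx|) => m m' n1 p1 p2 hX.
have := ler_normB (X + m) X; have := ler_normB (X + m) m; rewrite addrK.
rewrite (_ : X + m - X = m); last by ring.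
by move=> ? ?; apply/andP; split; lra.
Qed.

Lemma acc_bounds (X v f : R) : 96 / 100 <= v -> v <= 104 / 100 -> 9 / 10 <= f -> f <= 11 / 10 ->
  6 / 100 <= `|X| <= 27 / 100 -> X < 0 -> 1 / 20 <= - X / (v * f) <= 1.
Proof.
move=> v1 v2 f1 f2 /[swap] X0; rewrite ltr0_norm // => /andP[X1 X2].
have vf1 : 96 / 100 * (9 / 10) <= v * f by apply: ler_pM; lra.
have vf2 : v * f <= 104 / 100 * (11 / 10) by apply: ler_pM; lra.
have vf0 : 0 < v * f by lra.
by rewrite ler_pdivlMr // ler_pdivrMr //; apply/andP; split; lra.
Qed.

(** d = |u|^2, S is the main term of the Hessian in the direction of the test vector, r2 its
    normal correction and n the size of the error. *)
Lemma hess_final (e S r2 n d t : R) : 0 <= e -> e <= 1 / 50 / 100 -> 0 <= d -> 0 <= n ->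
  91 / 100 <= t -> 35 / 100 / 10 / 100 * d <= S -> r2 <= 9 * e * e * d ->
  n <= 6 / 100 * d -> t * `|2 * (S - r2)| <= 6 * e * n -> d <= 0.
Proof.
move=> e0 e1 d0 n0 ht hS hr hn h.
have h1 : 9 * e * e * d <= 9 * (1 / 50 / 100) * (1 / 50 / 100) * d.
  by rewrite ler_wpM2r //; have := ler_pM e0 e0 e1 e1; lra.
have h2 : 6 * e * n <= 6 * (1 / 50 / 100) * (6 / 100 * d) by apply: ler_pM; lra.
have h3 : 91 / 100 * (2 * (S - r2)) <= t * `|2 * (S - r2)|.
  apply: le_trans (_ : 91 / 100 * `|2 * (S - r2)| <= _); last first.
    by apply: ler_wpM2r => //; exact: normr_ge0.
  by apply: ler_wpM2l; [lra|exact: ler_norm].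
lra.
Qed.

Lemma sqr_sub_le (s t : R) : `|s| <= 3 / 100 -> `|t| <= 3 / 100 ->
  (s - t) ^+ 2 <= (6 / 100) ^+ 2.
Proof.
move=> hs ht; rewrite -[X in X <= _]real_normK ?num_real // !expr2.
have h : `|s - t| <= 6 / 100.
  by apply: le_trans (ler_normB _ _) _; move: (`|s|) (`|t|) hs ht => s' t' hs ht; lra.
exact: (ler_pM (normr_ge0 _) (normr_ge0 _) h h).
Qed.

End RealFacts.

Section Critical.
Variable R : realType.
Local Notation E := 'rV[R]_4.
Variables (b : 'I_4 -> E) (hb : frame b).
Variables (k : nat) (q : 'I_k -> E) (hq : forall j, S3 (q j)).
Variables (z : R).
Hypotheses (z0 : 0 < z) (z1 : z <= 1 / 1000).

Let zn n : 0 < z ^+ n. Proof. by rewrite exprn_gt0. Qed.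

Definition vz : E -> R := comb_v b q z (full z).
Definition fz : E -> R := comb_f b q z (full z).
Definition Kz : E -> R := quo fz vz.

Let C2v : C2_S3 vz := C2_comb_v b hq z0 (full z).
Let C2f : C2_S3 fz := C2_comb_f b hq z0 (full z).

Lemma bubz_gt0 i x : S3 x -> 0 < bubz q z i x.
Proof. by move=> hx; rewrite /bubz; exact: (bub_gt0 (hq i) (cz_gt1 z0) hx). Qed.

Lemma vz_ge x : S3 x -> 97 / 100 <= vz x.
Proof.
move=> hx; have := Quad_le hb hx; rewrite ler_norml => /andP[h _].
have : 0 <= \sum_i full z i * bubz q z i x.
  by apply: sumr_ge0 => i _; rewrite mulr_ge0 ?(ltW (zn _)) // ltW // bubz_gt0.
by rewrite /vz /comb_v; lra.
Qed.

Lemma fz_ge x : S3 x -> 91 / 100 <= fz x.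
Proof.
move=> hx; have := Quad_le hb hx; rewrite ler_norml => /andP[h _].
have : 0 <= \sum_i (z ^+ 4 * full z i) * (bubz q z i x * bubz q z i x).
  apply: sumr_ge0 => i _; apply: mulr_ge0; last by rewrite -expr2 sqr_ge0.
  by apply: mulr_ge0; exact: ltW (zn _).
by rewrite /fz /comb_f; lra.
Qed.

Lemma vz_gt0 x : S3 x -> 0 < vz x.
Proof. by move=> /vz_ge; lra. Qed.

Lemma fz_gt0 x : S3 x -> 0 < fz x.
Proof. by move=> /fz_ge; lra. Qed.

Lemma vz_neq0 x : S3 x -> vz x != 0.
Proof. by move=> hx; rewrite gt_eqF // vz_gt0. Qed.

Lemma Kz_gt0 x : S3 x -> 0 < Kz x.
Proof. by move=> hx; rewrite divr_gt0 ?fz_gt0 // exprn_gt0 // vz_gt0. Qed.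

Lemma C2_Kz : C2_S3 Kz.
Proof. exact: (C2_quo C2f C2v vz_neq0). Qed.

(** The diagonal entry of the interaction matrix, up to the factor K^2. *)
Definition concav (x : E) : R := - (laplacian Kz x / Kz x).

Lemma concavE x : S3 x -> concav x = - (vz x ^+ 3 * laplacian Kz x) / (vz x * fz x).
Proof.
move=> hx; rewrite /concav /Kz /quo; have := vz_neq0 hx; have := fz_gt0 hx => /gt_eqF/negbT.
set L := laplacian _ _; move: L (vz x) (fz x) => L v f f0 v0; field.
by rewrite f0 v0.
Qed.

(** For v = 1 + Q and f = 1 + 3 Q, v grad f - 2 f grad v = (1 - 3 Q) grad Q. *)
Lemma grad_numerator_close (v f e : R) (gv gf g : E) (Qx : R) : `|Qx| <= 3 / 100 -> enorm g <= 12 / 100 ->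
  e <= 1 / 100 -> `|v - (1 + Qx)| <= e -> `|f - (1 + 3 * Qx)| <= e ->
  enorm (gv - g) <= e -> enorm (gf - 3 *: g) <= e ->
  enorm ((v *: gf - (2 * f) *: gv) - (1 - 3 * Qx) *: g) <= 5 * e.
Proof.
move=> hQ hg he hv hf hgv hgf.
have -> : (v *: gf - (2 * f) *: gv) - (1 - 3 * Qx) *: g = v *: (gf - 3 *: g) +
  (3 * (v - (1 + Qx))) *: g - (2 * f) *: (gv - g) - (2 * (f - (1 + 3 * Qx))) *: g.
  by apply/rowP => i; rewrite !mxE; ring.
have e0 : 0 <= e by apply: le_trans hv.
move: hQ (hv) (hf); rewrite !ler_norml => /andP[? ?] /andP[? ?] /andP[? ?].
have n1 : enorm (v *: (gf - 3 *: g)) <= 104 / 100 * e.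
  rewrite enormZ; apply: ler_pM; rewrite ?enorm_ge0 // ler_norml; apply/andP; split; lra.
have n2 : enorm ((3 * (v - (1 + Qx))) *: g) <= 3 * e * (12 / 100).
  by rewrite enormZ; apply: ler_pM; rewrite ?enorm_ge0 // normrM ger0_norm // ler_wpM2l.
have n3 : enorm ((2 * f) *: (gv - g)) <= 222 / 100 * e.
  rewrite enormZ; apply: ler_pM; rewrite ?enorm_ge0 // ler_norml; apply/andP; split; lra.
have n4 : enorm ((2 * (f - (1 + 3 * Qx))) *: g) <= 2 * e * (12 / 100).
  by rewrite enormZ; apply: ler_pM; rewrite ?enorm_ge0 // normrM ger0_norm // ler_wpM2l.
apply: le_trans (enormB _ _) _; apply: le_trans (lerD (enormB _ _) n4) _.
have := enormD (v *: (gf - 3 *: g)) ((3 * (v - (1 + Qx))) *: g).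
lra.
Qed.

Lemma op2_numerator_close (v f e be : R) (lv lf l : R) (Qx : R) : `|Qx| <= 3 / 100 -> `|l| <= be / 4 ->
  e <= 1 / 100 -> `|v - (1 + Qx)| <= e -> `|f - (1 + 3 * Qx)| <= e ->
  `|lv - l| <= e * be -> `|lf - 3 * l| <= e * be ->
  `|(v * lf - 2 * f * lv) - (1 - 3 * Qx) * l| <= 5 * e * be.
Proof.
move=> hQ hg he hv hf hlv hlf.
have -> : (v * lf - 2 * f * lv) - (1 - 3 * Qx) * l = v * (lf - 3 * l) +
  (3 * (v - (1 + Qx))) * l - (2 * f) * (lv - l) - (2 * (f - (1 + 3 * Qx))) * l by ring.
have e0 : 0 <= e by apply: le_trans hv.
have be0 : 0 <= be by have := normr_ge0 l; lra.
have eb0 : 0 <= e * be by rewrite mulr_ge0.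
move: hQ (hv) (hf); rewrite !ler_norml => /andP[? ?] /andP[? ?] /andP[? ?].
have n1 : `|v * (lf - 3 * l)| <= 104 / 100 * (e * be).
  rewrite normrM; apply: ler_pM => //; rewrite ler_norml; apply/andP; split; lra.
have n2 : `|(3 * (v - (1 + Qx))) * l| <= 3 * e * (be / 4).
  by rewrite normrM; apply: ler_pM => //; rewrite normrM ger0_norm // ler_wpM2l.
have n3 : `|(2 * f) * (lv - l)| <= 222 / 100 * (e * be).
  rewrite normrM; apply: ler_pM => //; rewrite ler_norml; apply/andP; split; lra.
have n4 : `|(2 * (f - (1 + 3 * Qx))) * l| <= 2 * e * (be / 4).
  by rewrite normrM; apply: ler_pM => //; rewrite normrM ger0_norm // ler_wpM2l.
move: n1 n2 n3 n4; rewrite -!ler_norml !ler_norml.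
clear -eb0; move=> /andP[? ?] /andP[? ?] /andP[? ?] /andP[? ?]; apply/andP; split; lra.
Qed.

Section At.
Variables (x : E) (hx : S3 x) (hc : grad Kz x = 0).
Variables (U : R) (U1 : 1 <= U).
Let e : R := bg_err k z U.
Hypothesis e_small : e <= 1 / 50 / 100.

Let fullP (i : 'I_k) : 0 <= full z i <= z ^+ 7.
Proof. by rewrite /full lexx ltW. Qed.

Let crit1 : vz x *: grad fz x = (2 * fz x) *: grad vz x := crit_grad C2f C2v vz_neq0 hx hc.

Let crit2 M : vz x ^+ 3 * op2 M Kz x = vz x * op2 M fz x - 2 * fz x * op2 M vz x -
  2 * fz x / vz x * bil M (grad vz x) (grad vz x) := crit_op2 C2f C2v vz_neq0 hx hc M.

Section Far.
Hypothesis far : forall i, bubz q z i x <= U.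

Let far' (i : 'I_k) : full z i != 0 -> bubz q z i x <= U. Proof. by []. Qed.
Let hv := small_v b hq z0 hx U1 fullP far'.
Let hf := small_f b hq z0 z1 hx U1 fullP far'.
Let hgv := small_gv b hq z0 hx U1 fullP far'.
Let hgf := small_gf b hq z0 z1 hx U1 fullP far'.
Let hQ := Quad_le hb hx.
Let hg := grad_Quad_le hb hx.

Let e0 : 0 <= e. Proof. exact: le_trans hv. Qed.

Let es1 : e <= 1 / 100. Proof. by apply: le_trans e_small _; lra. Qed.

Let gQ_small : enorm (grad (Quad b) x) <= 6 * e.
Proof.
have := grad_numerator_close hQ hg es1 hv hf hgv hgf.
rewrite -/vz -/fz crit1 subrr sub0r enormN enormZ => h.
apply: (grad_final e0); apply: le_trans h; rewrite ler_wpM2r ?enorm_ge0 //.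
by have /andP[h1 _] := one_3Q hQ; rewrite ger0_norm //; apply: le_trans h1; lra.
Qed.

Let vf_bounds : [/\ 96 / 100 <= vz x, vz x <= 104 / 100, 9 / 10 <= fz x & fz x <= 11 / 10].
Proof. exact: (bounds_final e_small hQ hv hf). Qed.

Let far_op2 M N beta : op2_bound M x N beta ->
  `|vz x ^+ 3 * op2 M Kz x - (1 - 3 * Quad b x) * op2 M (Quad b) x| <= 6 * e * beta.
Proof.
move=> hM.
have hlv := small_lv b hq z0 hx U1 fullP far' hM.
have hlf := small_lf b hq z0 z1 hx U1 fullP far' hM.
have h1 := op2_numerator_close hQ (op2_Quad_le hb hx hM) es1 hv hf hlv hlf.
have [v1 v2 f1 f2] := vf_bounds; have [_ _ b0 _ hB] := hM.
have h2 : `|2 * fz x / vz x * bil M (grad vz x) (grad vz x)| <= e * beta.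
  have gn : enorm (grad vz x) <= 7 * e.
    rewrite -[grad vz x](subrK (grad (Quad b) x)); apply: le_trans (enormD _ _) _.
    by apply: le_trans (lerD hgv gQ_small) _; rewrite -/e (_ : e + 6 * e = 7 * e) //; ring.
  have g2 : enorm (grad vz x) * enorm (grad vz x) <= 7 * e * (7 * e).
    by apply: ler_pM; rewrite ?enorm_ge0.
  have B1 : `|bil M (grad vz x) (grad vz x)| <= beta * (49 * (e * (1 / 50 / 100))).
    apply: le_trans (hB _ _) _; apply: ler_wpM2l => //; apply: le_trans g2 _.
    by rewrite (_ : 7 * e * (7 * e) = 49 * (e * e)); [rewrite ler_wpM2l // ler_wpM2l|ring].
  have f0 : 0 <= fz x by exact: ltW (fz_gt0 hx).
  rewrite normrM; apply: le_trans (ler_pM _ _ (ratio_le3 v1 f0 f2) B1) _ => //.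
  rewrite (_ : 3 * _ = (e * beta) * (147 / 50 / 100)); last by field.
  by apply: ler_piMr; [exact: mulr_ge0|lra].
rewrite crit2 (_ : 6 * e * beta = 5 * e * beta + e * beta); last by ring.
exact: (norm_sub3 h1 h2).
Qed.

(** The Hessian of K is a multiple of that of Q up to small errors, and the latter takes at
    u and w = (lam - Q) u, projected to the tangent space, a value which is at least a
    positive multiple of |u|^2 by [hess_gap]. *)
Lemma crit_far : [/\ nondeg Kz x, laplacian Kz x != 0 &
  laplacian Kz x < 0 -> 1 / 20 <= concav x <= 1].
Proof.
have gs' : enorm (grad (Quad b) x) <= 1 / 5 / 100.
  by apply: le_trans gQ_small _; apply: le_trans (ler_wpM2l _ e_small) _; lra.
have Qa := Quad_away hb hx gs'.
have [v1 v2 f1 f2] := vf_bounds.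
have Lb : `|vz x ^+ 3 * laplacian Kz x + 8 * ((1 - 3 * Quad b x) * Quad b x)| <= 18 * e.
  have := far_op2 (op2_bound_lap hx); rewrite -!laplacianE laplacian_Quad //.
  rewrite (_ : 6 * e * 3 = 18 * e); last by ring.
  by rewrite mulrCA mulNr opprK.
have v3 : 0 < vz x ^+ 3 by rewrite exprn_gt0 // vz_gt0.
have L0 := Lap_away e_small hQ Qa Lb.
split.
- move=> u tu hu.
  pose d l := lam R l - Quad b x.
  pose r := dot u (grad (Quad b) x) / 2.
  have rE : \sum_l d l * dot (b l) u * dot (b l) x = r.
    rewrite /r hb.1 mulr_suml; apply: eq_bigr => l _.
    by rewrite frame_grad_Quad // /d; field.
  pose w0 : E := \sum_l (d l * dot (b l) u) *: b l.
  have bw m : dot (b m) w0 = d m * dot (b m) u.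
    rewrite /w0 dot_sumr (eq_bigr (fun l => d l * dot (b l) u * (l == m)%:R)) ?sum_dlt //.
    by move=> l _; rewrite dotZr hb.2 eq_sym.
  have xw : dot x w0 = r.
    by rewrite hb.1 -rE; apply: eq_bigr => l _; rewrite bw mulrC.
  pose w := w0 - r *: x.
  have tw : tangent x w.
    by rewrite /tangent /= dotBr dotZr (S3P x).1 // xw mulr1 subrr.
  have bwm m : dot (b m) w = d m * dot (b m) u - r * dot (b m) x.
    by rewrite dotBr dotZr bw.
  have gap := hess_gap hb hx gs' tu.
  set S := \sum_l _ in gap.
  have SE : \sum_l (lam R l - Quad b x) * (dot (b l) u * dot (b l) w) = S - r * r.
    by rewrite -{1}rE mulr_suml -sumrB; apply: eq_bigr => l _; rewrite bwm /d; ring.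
  have := far_op2 (op2_bound_hess hx tu tw); rewrite -!hessianE (hu w tw) mulr0 sub0r normrN.
  rewrite (hessian_Quad hb hx tu tw) SE normrM (ger0_norm (x := 1 - _)); last first.
    by have /andP[h1 _] := one_3Q hQ; apply: le_trans h1; lra.
  have uu := dot_ge0 u.
  have r2 : r * r <= 9 * e * e * dot u u.
    have : dot u (grad (Quad b) x) ^+ 2 <= dot u u * (6 * e) ^+ 2.
      apply: le_trans (cauchy_sqr _ _) _; rewrite ler_wpM2l // -sqr_enorm !expr2.
      by apply: ler_pM; rewrite ?enorm_ge0.
    rewrite (_ : 9 * e * e * _ = dot u u * (6 * e) ^+ 2 / 4); last by field.
    by rewrite (_ : r * r = dot u (grad (Quad b) x) ^+ 2 / 4); [rewrite ler_pM2r|rewrite /r; field].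
  have S_up : S <= (6 / 100) ^+ 2 * dot u u.
    rewrite [dot u u]hb.1 mulr_sumr; apply: ler_sum => l _.
    rewrite -[dot _ _ * dot _ _]expr2; apply: ler_wpM2r; first exact: sqr_ge0.
    exact: sqr_sub_le (lam_le R l) hQ.
  have nw : enorm u * enorm w <= 6 / 100 * dot u u.
    have ww : dot w w <= S.
      have -> : dot w w = S - r * r; last by rewrite lerBlDr lerDl -expr2 sqr_ge0.
      rewrite /w dotBl !dotBr !dotZl !dotZr (dotC w0 x) xw (S3P x).1 // hb.1.
      under eq_bigr do rewrite bw.
      have -> : \sum_i d i * dot (b i) u * (d i * dot (b i) u) = S.
        by apply: eq_bigr => l _; rewrite /d; ring.
      ring.
    have hw : enorm w <= 6 / 100 * enorm u.
      apply: enorm_le; first by apply: mulr_ge0; [lra|exact: enorm_ge0].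
      by rewrite exprMn sqr_enorm; exact: le_trans ww S_up.
    apply: le_trans (ler_wpM2l (enorm_ge0 u) hw) _.
    by rewrite mulrCA -expr2 sqr_enorm.
  have n0 : 0 <= enorm u * enorm w by rewrite mulr_ge0 ?enorm_ge0.
  have /andP[h91 _] := one_3Q hQ.
  move=> /(hess_final e0 e_small uu n0 h91 gap r2 nw) u0.
  by apply/eqP; rewrite -dot_eq0 eq_le u0 uu.
- apply/eqP => L00; move: L0; rewrite L00 mulr0 normr0 => /andP[h _]; move: h; lra.
move=> Ln; rewrite concavE //; apply: acc_bounds => //.
by rewrite pmulr_rlt0.
Qed.

End Far.
End At.
End Critical.

(** * Peaks and saddles under a bubble *)

Section RealFacts.
Variable R : realType.

Lemma peak_main (X T N tau mm B be : R) : 0 < T -> 0 <= be ->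
  `|X - T * (- N * tau + mm * B)| <= T * be / 100 -> `|mm * B| <= be / 100 ->
  `|X + T * (N * tau)| <= T * be / 50.
Proof.
move=> T0 b0 h1 h2.
rewrite (_ : X + _ = (X - T * (- N * tau + mm * B)) + T * (mm * B)); last by ring.
apply: le_trans (ler_normD _ _) _; rewrite normrM (gtr0_norm T0).
have := ler_wpM2l (ltW T0) h2; lra.
Qed.

Lemma mB_small (z u mm B P be : R) : 0 < z -> z <= 1 / 10 / 100 -> 0 < u -> u * z ^+ 8 <= 3 ->
  3 * u <= mm <= 21 / 5 * u -> `|B| <= be * (P * P) -> 0 <= P -> P <= 17 * z ^+ 8 -> 0 <= be ->
  `|mm * B| <= be / 100.
Proof.
move=> z0 z1 u0 uz /andP[m1 m2] hB P0 P1 b0.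
rewrite normrM ger0_norm; last by lra.
have m0 : 0 <= mm by lra.
have PP : P * P <= (17 * z ^+ 8) * (17 * z ^+ 8) by exact: ler_pM.
have z8 : 0 < z ^+ 8 by rewrite exprn_gt0.
have z8s : z ^+ 8 <= 1 / 100 / 10 / 100 / 10.
  rewrite (_ : z ^+ 8 = z ^+ 2 * z ^+ 6); last by ring.
  have z6 : z ^+ 6 <= 1 by rewrite exprn_ile1 ?(ltW z0) //; lra.
  have z2 : z ^+ 2 <= 1 / 100 / 10 / 100 / 10.
    by rewrite expr2; apply: le_trans (ler_pM (ltW z0) (ltW z0) z1 z1) _; lra.
  rewrite -[_ / 10]mulr1; apply: ler_pM => //; rewrite ltW // exprn_gt0 //.
apply: le_trans (ler_pM m0 (normr_ge0 _) m2 (le_trans hB (ler_wpM2l b0 PP))) _.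
rewrite (_ : 21 / 5 * u * _ = be * (21 / 5 * (17 * 17) * (u * z ^+ 8) * z ^+ 8)); last first.
  by move: (z ^+ 8) => t; ring.
apply: ler_wpM2l => //.
have : (u * z ^+ 8) * z ^+ 8 <= 3 * z ^+ 8 by rewrite ler_pM2r.
lra.
Qed.

Lemma peak_acc (z u T V F X : R) : 0 < z -> z <= 1 / 10 / 100 -> 1 / 8 <= z ^+ 8 * u ->
  4 / 5 <= V <= 6 / 5 -> 4 / 5 <= F <= 6 / 5 ->
  7 / 5 * (z ^+ 11 * u ^+ 3) <= T <= 12 / 5 * (z ^+ 11 * u ^+ 3) ->
  291 / 100 * T <= - X <= 307 / 100 * T ->
  1 <= z ^+ 7 * (- X / ((V + z ^+ 7 * u) * (F + z ^+ 11 * u ^+ 2))) <= 8.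
Proof.
move=> z0 z1 hu /andP[V1 V2] /andP[F1 F2] /andP[T1 T2] /andP[X1 X2].
have z8 : 0 < z ^+ 8 by rewrite exprn_gt0.
have u0 : 0 < u by rewrite -(pmulr_rgt0 _ z8); lra.
set a := z ^+ 7 * u; have a0 : 0 < a by rewrite mulr_gt0 // exprn_gt0.
set d := z ^+ 11 * u ^+ 2; have d0 : 0 < d by rewrite mulr_gt0 // exprn_gt0.
have aE : z ^+ 8 * u = z * a by rewrite /a; ring.
have ah : 12 * 10 <= a.
  have : z * a <= 1 / 10 / 100 * a by rewrite ler_pM2r.
  lra.
have z3 : z ^+ 3 <= 1 by rewrite exprn_ile1 ?(ltW z0) //; lra.
have da : a ^+ 2 <= d.
  rewrite /d (_ : z ^+ 11 * _ = a ^+ 2 * z ^- 3); last first.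
    by rewrite /a; field; rewrite gt_eqF.
  rewrite ler_pMr ?exprn_gt0 //.
  by rewrite invf_ge1 // exprn_gt0.
have dh : 12 * 10 <= d.
  apply: le_trans da; rewrite expr2; apply: le_trans (_ : 12 * 10 * a <= _); first by lra.
  by rewrite ler_pM2r.
set D := z ^+ 11 * u ^+ 3 in T1 T2.
have ad : a * d = z ^+ 7 * D by rewrite /a /d /D; ring.
have D0 : 0 < D by rewrite mulr_gt0 // exprn_gt0.
clearbody a d D.
have ad0 : 0 < a * d by rewrite mulr_gt0.
have p1 : a * d <= (V + a) * (F + d) by apply: ler_pM; lra.
have p2 : (V + a) * (F + d) <= (101 / 100 * a) * (101 / 100 * d) by apply: ler_pM; lra.
have vf0 : 0 < (V + a) * (F + d) by lra.
have z7 : 0 < z ^+ 7 by rewrite exprn_gt0.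
rewrite mulrA ler_pdivlMr // ler_pdivrMr //.
have q1 : z ^+ 7 * (4 * D) <= z ^+ 7 * - X by rewrite ler_pM2l //; lra.
have q2 : z ^+ 7 * - X <= z ^+ 7 * (8 * D) by rewrite ler_pM2l //; lra.
have e4 : z ^+ 7 * (4 * D) = 4 * (a * d) by rewrite ad; ring.
have e8 : z ^+ 7 * (8 * D) = 8 * (a * d) by rewrite ad; ring.
by apply/andP; split; lra.
Qed.

Lemma zero_from (t T X : R) : 0 < T -> 0 <= t -> 99 / 100 * t <= X ->
  `|T * X| <= T * t / 50 -> t <= 0.
Proof.
move=> T0 t0 h1; rewrite normrM gtr0_norm // -mulrA ler_pM2l // => h2.
have := ler_norm X; lra.
Qed.

Lemma saddle_hess (tau ap2 aa pp u mm T : R) : 0 < T -> 99 / 100 <= tau <= 1 -> 0 <= ap2 ->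
  0 <= aa -> 0 < pp -> 9 / 5 <= pp * u -> 3 * u <= mm ->
  `|T * (- (2 * ap2 / pp - aa) * tau + mm * ap2)| <= T * aa / 100 -> aa <= 0.
Proof.
move=> T0 /andP[t1 t2] ap0 aa0 pp0 hu hm h.
have T1 := ltW T0.
apply: (zero_from T0 aa0 _ (le_trans h _)); last first.
  by rewrite -!mulrA ler_pM2l //; lra.
have e0 : 0 <= ap2 / pp by rewrite divr_ge0 // ltW.
have e1 : 27 / 5 * (ap2 / pp) <= mm * ap2.
  apply: le_trans (_ : 3 * u * ap2 <= _); last by rewrite ler_wpM2r.
  rewrite mulrA ler_pdivrMr // (_ : 3 * u * ap2 * pp = 3 * (pp * u) * ap2); last by ring.
  by rewrite ler_wpM2r //; lra.
have e2 : 99 / 100 * aa <= aa * tau by rewrite mulrC; apply: ler_wpM2l.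
have e3 : ap2 / pp * tau <= ap2 / pp by rewrite ler_piMr.
rewrite (_ : - _ * tau = aa * tau - 2 * (ap2 / pp * tau)); last by ring.
lra.
Qed.

Lemma saddle_lap (tau pp u mm T L : R) : 0 < T -> tau <= 1 -> 0 <= pp ->
  9 / 5 <= pp * u -> 3 * u <= mm ->
  `|L - T * (- 3 * tau + mm * pp)| <= T * 3 / 100 -> 0 < L.
Proof.
move=> T0 t2 pp0 hu hm.
rewrite ler_norml => /andP[h _].
have e1 : 3 * u * pp <= mm * pp by rewrite ler_wpM2r.
have : T * (2 : R) <= T * (- 3 * tau + mm * pp) by rewrite ler_pM2l //; lra.
lra.
Qed.

Lemma peak_lap (T X tau : R) : 0 < T -> 99 / 100 <= tau <= 1 ->
  `|X + T * (3 * tau)| <= T * 3 / 50 -> 291 / 100 * T <= - X <= 307 / 100 * T.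
Proof.
move=> T0 /andP[t1 t2]; rewrite ler_norml => /andP[h1 h2].
have a1 : T * (99 / 100) <= T * tau by rewrite ler_pM2l.
have a2 : T * tau <= T * 1 by rewrite ler_pM2l.
by apply/andP; split; lra.
Qed.

End RealFacts.

Section AtBubble.
Variable R : realType.
Local Notation E := 'rV[R]_4.
Variables (z w0 u c tau F V : R) (p gF gV : E).
Hypothesis nd : near_data z w0 u c tau F V p gF gV.
Variables (K : E -> R) (x : E).
Hypothesis hx : S3 x.
Hypothesis tp : tangent x p.
Let T := 2 * z ^+ 7 * u ^+ 2 * (z ^+ 4 * u * V - F).
Let v := V + z ^+ 7 * u.
Let f := F + z ^+ 11 * u ^+ 2.
Hypothesis hX : forall M N beta, op2_bound M x N beta ->
  exists m', [/\ 3 * u <= m' <= 21 / 5 * u &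
    `|v ^+ 3 * op2 M K x - T * (- N * tau + m' * bil M p p)| <= T * beta / 100].

Let T0 : 0 < T. Proof. exact: (T_gt0 nd). Qed.
Let v0 : 0 < v. Proof. exact: (v_gt0 nd). Qed.
Let tauP : 99 / 100 <= tau <= 1.
Proof. by rewrite (tau_big nd); have /andP[_ ->] := nd_tau1 nd. Qed.
Let u0 : 0 < u. Proof. by have h := nd_u nd; lra. Qed.
Let z1 : z <= 1 / 10 / 100. Proof. by have h := nd_z1 nd; lra. Qed.

(** Here m' [bil M p p] is at most 21/5 u |p|^2 beta, which is negligible, so that
    v^3 [op2 M K] is - T N tau up to T beta / 50. *)
Lemma peak_nondeg : 1 / 8 <= z ^+ 8 * u -> enorm p <= 17 * z ^+ 8 ->
  [/\ nondeg K x, laplacian K x < 0 &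
    1 <= z ^+ 7 * (- (v ^+ 3 * laplacian K x) / (v * f)) <= 8].
Proof.
move=> hu hp.
have main M N beta : op2_bound M x N beta ->
    `|v ^+ 3 * op2 M K x + T * (N * tau)| <= T * beta / 50.
  move=> hM; have [m' [hm h]] := hX hM; have [_ _ b0 _ hB] := hM.
  apply: (peak_main T0 b0 h).
  exact: (mB_small (nd_z nd) z1 u0 (u_le nd) hm (hB p p) (enorm_ge0 p) hp b0).
have L := main _ _ _ (op2_bound_lap hx); rewrite -laplacianE in L.
have L1 := peak_lap T0 tauP L.
split.
- move=> a ta ha; have := main _ _ _ (op2_bound_hess hx ta ta).
  rewrite -hessianE (ha a ta) mulr0 add0r -expr2 sqr_enorm => h.
  have aa := dot_ge0 a.
  apply/eqP; rewrite -dot_eq0 eq_le aa andbT.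
  apply: (zero_from T0 aa _ h); rewrite mulrC ler_wpM2l //.
  by have /andP[] := tauP.
- rewrite -(pmulr_rlt0 _ (exprn_gt0 3 v0)).
  by have /andP[h _] := L1; have := T0; lra.
apply: (peak_acc (nd_z nd) z1 hu (nd_V nd) (nd_F nd) _ L1).
by apply/andP; split; [exact: (T_lower nd)|exact: (T_upper nd)].
Qed.

(** The Laplacian has N = 3 and m' |p|^2 >= 27/5. For the Hessian at (a, w) take w to be the
    image of a under the symmetry that fixes p and is - 1 on its orthogonal complement: then
    |w| = |a|, [bil M p p] = <a, p>^2 and - N tau + m' [bil M p p] >= 99/100 |a|^2. *)
Lemma saddle_nondeg : 9 / 5 <= enorm p ^+ 2 * u -> nondeg K x /\ 0 < laplacian K x.
Proof.
move=> hp; rewrite sqr_enorm in hp.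
have pp0 : 0 < dot p p.
  by rewrite lt_neqAle dot_ge0 andbT eq_sym; apply/eqP => e; move: hp; rewrite e mul0r; lra.
have v3 := exprn_gt0 3 v0.
split.
- move=> a ta ha.
  pose w : E := (2 * dot a p / dot p p) *: p - a.
  have tw : tangent x w by rewrite /tangent /= dotBr dotZr tp ta mulr0 subr0.
  have aw : dot a w = 2 * dot a p ^+ 2 / dot p p - dot a a.
    by rewrite dotBr dotZr; field; rewrite gt_eqF.
  have wp : dot w p = dot a p by rewrite dotBl dotZl; field; rewrite gt_eqF.
  have ww : dot w w = dot a a.
    rewrite {2}/w dotBr dotZr wp (dotC w a) aw; field; by rewrite gt_eqF.
  have nw : enorm w = enorm a by rewrite /enorm ww.
  have [m' [/andP[m1 _]]] := hX (op2_bound_hess hx ta tw).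
  rewrite -hessianE (ha w tw) mulr0 sub0r normrN nw -expr2 sqr_enorm bil_hess wp aw.
  rewrite (_ : (_ + _) / 2 = dot a p ^+ 2); last by field.
  move=> /(saddle_hess T0 tauP (sqr_ge0 _) (dot_ge0 a) pp0 hp m1) h.
  by apply/eqP; rewrite -dot_eq0 eq_le dot_ge0 andbT.
have [m' [/andP[m1 _]]] := hX (op2_bound_lap hx).
rewrite -laplacianE bil_lap -(pmulr_rgt0 _ v3).
have /andP[_ t1] := tauP.
exact: (saddle_lap T0 t1 (ltW pp0) hp m1).
Qed.

End AtBubble.

(** * Critical points under a bubble *)

Section RealFacts.
Variable R : realType.

Lemma near_VF (Qx V F e : R) : e <= 1 / 50 / 100 -> `|Qx| <= 3 / 100 ->
  `|V - (1 + Qx)| <= e -> `|F - (1 + 3 * Qx)| <= e ->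
  4 / 5 <= V <= 6 / 5 /\ 4 / 5 <= F <= 6 / 5.
Proof.
by move=> he; rewrite !ler_norml => /andP[? ?] /andP[? ?] /andP[? ?]; split; apply/andP; split; lra.
Qed.

Lemma near_l (l lV be e : R) (a b : R) : e <= 1 / 50 / 100 -> 0 <= be -> `|l| <= be / 4 ->
  0 <= a -> `|lV - a * l| <= e * be -> a / 4 + 1 / 20 <= b -> `|lV| <= b * be.
Proof.
move=> he b0 hl a0 h hb.
rewrite -[lV](subrK (a * l)); apply: le_trans (ler_normD _ _) _.
rewrite [`|a * l|]normrM (ger0_norm a0).
have h1 := ler_wpM2l a0 hl; have h2 := ler_wpM2r b0 he; have h3 := ler_wpM2r b0 hb.
lra.
Qed.

Lemma near_lV (l lV be e : R) : e <= 1 / 50 / 100 -> 0 <= be -> `|l| <= be / 4 ->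
  `|lV - l| <= e * be -> `|lV| <= 3 / 10 * be.
Proof.
move=> he b0 hl h; apply: (near_l (a := 1) he b0 hl ler01); last by lra.
by rewrite mul1r.
Qed.

Lemma near_lF (l lF be e : R) : e <= 1 / 50 / 100 -> 0 <= be -> `|l| <= be / 4 ->
  `|lF - 3 * l| <= e * be -> `|lF| <= be.
Proof.
by move=> he b0 hl h; rewrite -[be]mul1r; apply: (near_l he b0 hl (ler0n _ 3) h); lra.
Qed.

Lemma near_gV (g e : R) : g <= 12 / 100 -> e <= 1 / 50 / 100 -> e + g <= 1 / 5.
Proof. by lra. Qed.

Lemma near_gF (g e : R) : g <= 12 / 100 -> e <= 1 / 50 / 100 -> e + 3 * g <= 1.
Proof. by lra. Qed.

Lemma ge0_91 : 0 <= 91 / 100 :> R. Proof. by lra. Qed.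

Lemma one_le_u (U u : R) : 1 <= U -> U < u -> 1 <= u /\ 0 < u.
Proof. by split; lra. Qed.

End RealFacts.

Section Near.
Variable R : realType.
Local Notation E := 'rV[R]_4.
Variables (b : 'I_4 -> E) (hb : frame b).
Variables (k : nat) (q : 'I_k -> E) (hq : forall j, S3 (q j)).
Variables (z : R).
Hypotheses (z0 : 0 < z) (z1 : z <= 1 / 1000).
Variables (x : E) (hx : S3 x) (hc : grad (Kz b q z) x = 0).
Variables (U : R) (U1 : 1 <= U).
Let e : R := bg_err k z U.
Hypothesis e_small : e <= 1 / 50 / 100.
Variables (w0 : R) (j : 'I_k).
Hypothesis hw0 : z * 10 ^+ 7 <= w0.
Hypothesis hg : 5 * e + w0 <= 91 / 100 * enorm (grad (Quad b) x).
Hypothesis hj : U < bubz q z j x.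
Hypothesis sep : forall i, i != j -> bubz q z i x <= U.

Let C2v := C2_comb_v b hq z0 (full z).
Let C2f := C2_comb_f b hq z0 (full z).
Let al := off z j.
Local Notation u := (bubz q z j x).
Local Notation tau := (dot (q j) x).
Local Notation p := (q j - tau *: x).
Local Notation V := (comb_v b q z al x).
Local Notation F := (comb_f b q z al x).

Let alP i : 0 <= al i <= z ^+ 7.
Proof. by rewrite /al /off; case: eqP => _; rewrite !lexx ?ltW // exprn_gt0. Qed.

Let alU i : al i != 0 -> bubz q z i x <= U.
Proof. by have [->|ij _] := eqVneq i j; [rewrite /al /off eqxx eqxx|exact: sep]. Qed.

Let split_sum (Z : zmodType) (G : R -> 'I_k -> Z) : (forall i, G 0 i = 0) ->
  \sum_i G (full z i) i = \sum_i G (al i) i + G (z ^+ 7) j.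
Proof.
move=> G0; have aj : al j = 0 by rewrite /al /off eqxx.
rewrite (bigD1 j) //= [X in _ = X + _](bigD1 j) //= aj G0 add0r addrC.
by congr (_ + _); apply: eq_bigr => i /negbTE ij; rewrite /al /off ij.
Qed.

Let vE : vz b q z x = V + z ^+ 7 * u.
Proof.
by rewrite /vz /comb_v (split_sum (G := fun a i => a * bubz q z i x)) ?addrA // => i; rewrite mul0r.
Qed.

Let fE : fz b q z x = F + z ^+ 11 * u ^+ 2.
Proof.
rewrite /fz /comb_f (split_sum (G := fun a i => (z ^+ 4 * a) * (bubz q z i x * bubz q z i x))).
  by rewrite addrA; congr (_ + _); ring.
by move=> i; rewrite mulr0 mul0r.
Qed.

Let gvE : grad (vz b q z) x = grad (comb_v b q z al) x + (z ^+ 7 * u ^+ 2) *: p.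
Proof.
rewrite /vz !(grad_comb_v b hq z0 hx).
rewrite (split_sum (G := fun a i => (a * bubz q z i x ^+ 2) *: (q i - dot (q i) x *: x))) ?addrA //.
by move=> i; rewrite mul0r scale0r.
Qed.

Let gfE : grad (fz b q z) x = grad (comb_f b q z al) x + (2 * z ^+ 11 * u ^+ 3) *: p.
Proof.
rewrite /fz !(grad_comb_f b hq z0 hx).
rewrite (split_sum (G := fun a i => (z ^+ 4 * a * (2 * bubz q z i x ^+ 3)) *: (q i - dot (q i) x *: x))).
  by rewrite addrA; congr (_ + _ *: _); ring.
by move=> i; rewrite mulr0 mul0r scale0r.
Qed.

Let lvE M N beta (hM : op2_bound M x N beta) : op2 M (vz b q z) x = op2 M (comb_v b q z al) x +
  z ^+ 7 * (2 * u ^+ 3 * bil M p p - N * tau * u ^+ 2).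
Proof.
rewrite /vz !(op2_comb_v b hq z0 hx) -(op2_bubz hq z0 hx hM).
by rewrite (split_sum (G := fun a i => a * op2 M (bubz q z i) x)) ?addrA // => i; rewrite mul0r.
Qed.

Let lfE M N beta (hM : op2_bound M x N beta) : op2 M (fz b q z) x = op2 M (comb_f b q z al) x +
  z ^+ 11 * (6 * u ^+ 4 * bil M p p - 2 * N * tau * u ^+ 3).
Proof.
rewrite /fz !(op2_comb_f b hq z0 hx) -(op2_bubz2 hq z0 hx hM).
rewrite (split_sum (G := fun a i => z ^+ 4 * a * op2 M (fun x => bubz q z i x * bubz q z i x) x)).
  by rewrite addrA; congr (_ + _ * _); ring.
by move=> i; rewrite mulr0 mul0r.
Qed.

Let hv := small_v b hq z0 hx U1 alP alU.
Let hf := small_f b hq z0 z1 hx U1 alP alU.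
Let hgv := small_gv b hq z0 hx U1 alP alU.
Let hgf := small_gf b hq z0 z1 hx U1 alP alU.
Let hQ := Quad_le hb hx.
Let hgQ := grad_Quad_le hb hx.
Let e1 : e <= 1 / 100. Proof. by apply: le_trans e_small _; lra. Qed.

Lemma near_crit_data :
  near_data z w0 u (cz z) tau F V p (grad (comb_f b q z al) x) (grad (comb_v b q z al) x).
Proof.
have [hV hF] := near_VF e_small hQ hv hf.
have [_ u0] := one_le_u U1 hj.
have hx1 := (S3P x).1 hx.
split=> //.
- rewrite -[grad (comb_f _ _ _ _) _](subrK (3 *: grad (Quad b) x)).
  apply: le_trans (enormD _ _) _; apply: le_trans (lerD hgf (lexx _)) _.
  rewrite enormZ (ger0_norm (ler0n _ 3)); exact: near_gF hgQ e_small.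
- rewrite -[grad (comb_v _ _ _ _) _](subrK (grad (Quad b) x)).
  apply: le_trans (enormD _ _) _; apply: le_trans (lerD hgv (lexx _)) _.
  exact: near_gV hgQ e_small.
- exact: cz_sqr.
- exact: cz_gt1.
- by have [] := one_le_u U1 hj.
- by rewrite /bubz /bub invrK opprB addrC subrK.
- exact: dot_unit_bound.
- by rewrite (sqr_proj (hq j)).
- have h := grad_numerator_close hQ hgQ e1 hv hf hgv hgf; rewrite -/e in h.
  have /andP[t1 t2] := one_3Q hQ.
  have n1 : enorm ((1 - 3 * Quad b x) *: grad (Quad b) x) <= enorm (V *: grad (comb_f b q z al) x -
    (2 * F) *: grad (comb_v b q z al) x) + 5 * e.
    apply: le_trans (_ : _ <= enorm (V *: grad (comb_f b q z al) x -
      (2 * F) *: grad (comb_v b q z al) x) + enorm ((V *: grad (comb_f b q z al) x -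
      (2 * F) *: grad (comb_v b q z al) x) - (1 - 3 * Quad b x) *: grad (Quad b) x)) _; last by rewrite lerD2l.
    rewrite -{1}[(1 - 3 * Quad b x) *: _](subKr (V *: grad (comb_f b q z al) x -
      (2 * F) *: grad (comb_v b q z al) x)).
    exact: enormB.
  have n2 : 91 / 100 * enorm (grad (Quad b) x) <= enorm ((1 - 3 * Quad b x) *: grad (Quad b) x).
    rewrite enormZ (ger0_norm (le_trans (ge0_91 R) t1)); exact: ler_wpM2r (enorm_ge0 _) _ _ t1.
  rewrite -(lerD2r (5 * e)); apply: le_trans n1; apply: le_trans n2; rewrite addrC; exact: hg.
rewrite -vE -fE -gvE -gfE.
exact: (crit_grad C2f C2v (vz_neq0 hb hq z0) hx hc).
Qed.

Let tp : tangent x p.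
Proof. by rewrite /tangent /= dotBr dotZr (S3P x).1 // mulr1 dotC subrr. Qed.

Let hX M N beta : op2_bound M x N beta ->
  exists m', [/\ 3 * u <= m' <= 21 / 5 * u &
    `|(V + z ^+ 7 * u) ^+ 3 * op2 M (Kz b q z) x - 2 * z ^+ 7 * u ^+ 2 * (z ^+ 4 * u * V - F) *
      (- N * tau + m' * bil M p p)| <=
    2 * z ^+ 7 * u ^+ 2 * (z ^+ 4 * u * V - F) * beta / 100].
Proof.
move=> hM.
have [_ _ b0 _ _] := hM.
have hlv := small_lv b hq z0 hx U1 alP alU hM.
have hlf := small_lf b hq z0 z1 hx U1 alP alU hM.
have hl := op2_Quad_le hb hx hM.
have hF : `|op2 M (comb_f b q z al) x| <= beta.
  exact: near_lF e_small b0 hl hlf.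
have hV : `|op2 M (comb_v b q z al) x| <= 3 / 10 * beta.
  exact: near_lV e_small b0 hl hlv.
have [m' [hm h]] := near_op2 near_crit_data hM hF hV (lfE hM) (lvE hM).
exists m'; split=> //.
rewrite -vE (crit_op2 C2f C2v (vz_neq0 hb hq z0) hx hc M).
rewrite -vE -fE -gvE in h.
exact: h.
Qed.

Lemma crit_near : [/\ nondeg (Kz b q z) x, laplacian (Kz b q z) x != 0 &
  laplacian (Kz b q z) x < 0 ->
    enorm p <= 17 * z ^+ 8 /\ 1 <= z ^+ 7 * concav b q z x <= 8].
Proof.
have nd := near_crit_data.
have [[h1 h2]|h] := near_cases nd.
  have [n1 n2 n3] := peak_nondeg nd hx hX h1 h2.
  split=> //; first by rewrite lt_eqF.
  move=> _; split=> //.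
  by rewrite (concavE hb hq z0 hx) vE fE.
have [n1 n2] := saddle_nondeg nd hx tp hX h.
by split=> //; [rewrite gt_eqF|move=> /lt_trans/(_ n2); rewrite ltxx].
Qed.

End Near.

(** * Interaction matrices *)

Section Interaction.
Variable R : realType.
Variables (n : nat) (hn : (0 < n)%N).
Variables (a s : 'I_n -> R) (g : 'I_n -> 'I_n -> R).
Hypothesis a0 : forall i, 0 < a i.
Hypothesis s0 : forall i, 0 < s i.
Hypothesis gC : forall i j, g i j = g j i.

Let A : 'M[R]_n := \matrix_(i, j)
  if i == j then a i / s i ^+ 2 else - 6 * (g i j / (s i * s j)).

Let symA i j : A i j = A j i.
Proof.
rewrite !mxE eq_sym; case: eqP => [-> //|_].
by rewrite gC [s i * _]mulrC.
Qed.

(** After the congruence by s, the test vector minimises a_i x^2 - 12 g_ij x y + a_j y^2 for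
    fixed y. *)
Lemma interaction_neg i j : i != j -> a i * a j < 36 * g i j ^+ 2 -> min_eigenvalue A < 0.
Proof.
move=> ij h.
pose x : 'rV[R]_n := (6 * g i j * s i) *: delta_mx 0 i + (a i * s j) *: delta_mx 0 j.
apply: (min_eigenvalue_neg hn symA (x := x)).
have ej l m : qf A (delta_mx 0 l) (delta_mx 0 m) = A l m.
  rewrite qf_mul (bigD1 m) //= big1 => [|r rm]; last by rewrite !mxE eqxx (negbTE rm) mulr0.
  by rewrite -rowE !mxE !eqxx mulr1 addr0.
rewrite /x qfDl !(qfDr symA) !qfZl !(qfZr symA) !ej (symA j i) !mxE !eqxx (negbTE ij).
have := s0 i; have := s0 j; have := a0 i.
move: (s i) (s j) (g i j) (a i) (a j) h => si sj t ai aj h p1 p2 p3.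
rewrite (_ : _ + _ = ai * (ai * aj - 36 * t ^+ 2)).
  by rewrite pmulr_rlt0 // subr_lt0.
by field; rewrite !gt_eqF.
Qed.

(** Each off-diagonal term 12 g_ij |t_i t_j| is at most (a_i t_i^2 + a_j t_j^2) / n, and each
    index occurs in n - 1 pairs. *)
Lemma interaction_pos : (forall i j, i != j -> 36 * (n%:R * g i j) ^+ 2 <= a i * a j) ->
  0 < min_eigenvalue A.
Proof.
move=> h; apply: (min_eigenvalue_pos hn symA) => x x0.
pose t i := x 0 i / s i.
pose S := \sum_i a i * t i ^+ 2.
have S0 : 0 < S.
  rewrite lt_neqAle; apply/andP; split; last first.
    by apply: sumr_ge0 => i _; rewrite mulr_ge0 ?sqr_ge0 // ltW.
  rewrite eq_sym psumr_eq0 => [|i _]; last by rewrite mulr_ge0 ?sqr_ge0 // ltW.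
  apply/negP => /allP z; move/negP: x0; apply; apply/eqP/rowP => i; rewrite mxE.
  have := z i (mem_index_enum _); rewrite /= mulf_eq0 (gt_eqF (a0 i)) /= sqrf_eq0 mulf_eq0.
  by rewrite invr_eq0 (gt_eqF (s0 i)) orbF => /eqP.
have n0 : 0 < n%:R :> R by rewrite ltr0n.
rewrite -(pmulr_rgt0 _ n0); apply: lt_le_trans S0 _.
have key i j : - (a i * t i ^+ 2 + a j * t j ^+ 2) / 2 + (n%:R + 1) * (a i * t i ^+ 2 * (j == i)%:R)
    <= n%:R * (x 0 i * A i j * x 0 j).
  have [->|ji] := eqVneq j i; rewrite /A !mxE ?eqxx.
    rewrite mulr1 /t; have si := s0 i; rewrite le_eqVlt; apply/orP; left; apply/eqP.
    by field; rewrite gt_eqF.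
  rewrite eq_sym (negbTE ji) !mulr0 addr0.
  rewrite (_ : n%:R * _ = - (6 * (n%:R * g i j) * (t i * t j))); last first.
    by rewrite /t; field; rewrite !gt_eqF.
  rewrite mulNr lerN2.
  have := h i j; rewrite eq_sym ji => /(_ isT).
  have := a0 i; have := a0 j; move: (n%:R * g i j) (a i) (a j) (t i) (t j) => G ai aj ti tj p1 p2 hG.
  have q0 : 0 <= (ai * ti ^+ 2 + aj * tj ^+ 2) / 2.
    apply: divr_ge0 => //; apply: addr_ge0; apply: mulr_ge0; rewrite ?sqr_ge0 ?(ltW p1) ?(ltW p2) //.
  apply: le_trans (ler_norm _) _; apply: norm_le_sqr => //.
  have h1 : 0 <= (ti * tj) ^+ 2 * (ai * aj - 36 * G ^+ 2) by rewrite mulr_ge0 ?sqr_ge0 // subr_ge0.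
  have h2 := sqr_ge0 (ai * ti ^+ 2 - aj * tj ^+ 2).
  by move: h1 h2; rewrite !expr2; lra.
apply: (@le_trans _ _ (\sum_i \sum_j (- (a i * t i ^+ 2 + a j * t j ^+ 2) / 2 +
    (n%:R + 1) * (a i * t i ^+ 2 * (j == i)%:R)))); last first.
  by rewrite /qf mulr_sumr; apply: ler_sum => i _; rewrite mulr_sumr; apply: ler_sum => j _; exact: key.
have row_sum i : \sum_j (- (a i * t i ^+ 2 + a j * t j ^+ 2) / 2 +
    (n%:R + 1) * (a i * t i ^+ 2 * (j == i)%:R)) = (n%:R / 2 + 1) * (a i * t i ^+ 2) - S / 2.
  have d1 : \sum_j (j == i)%:R = 1 :> R.
    by rewrite (bigD1 i) //= eqxx big1 ?addr0 // => j /negbTE ->.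
  rewrite big_split /= -mulr_sumr -mulr_sumr d1.
  rewrite -mulr_suml sumrN big_split /= sumr_const card_ord -[_ *+ n]mulr_natl -/S.
  by field.
rewrite (eq_bigr _ (fun i _ => row_sum i)) big_split /= -mulr_sumr sumr_const card_ord.
rewrite -[_ *+ n]mulr_natl -/S le_eqVlt; apply/orP; left; apply/eqP; by field.
Qed.

End Interaction.

(** * Distances between critical points *)

Section Green.
Variable R : realType.
Local Notation E := 'rV[R]_4.

Lemma greenE (x y : E) : S3 x -> S3 y -> green x y = (1 - dot x y)^-1.
Proof.
move=> hx hy; rewrite /green /gdist acosK // in_itv /=; exact: dot_unit_bound.
Qed.

Lemma greenC (x y : E) : green x y = green y x.
Proof. by rewrite /green /gdist dotC. Qed.

Lemma dist_dot (x y : E) : S3 x -> S3 y -> dot (x - y) (x - y) = 2 * (1 - dot x y).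
Proof.
move=> hx hy; rewrite !dotBl !dotBr (S3P x).1 // (S3P y).1 // (dotC y x); ring.
Qed.

Lemma dot_lt1 (x y : E) : S3 x -> S3 y -> x != y -> dot x y < 1.
Proof.
move=> hx hy xy; have := dist_dot hx hy; have : 0 < dot (x - y) (x - y) by rewrite dot_gt0 subr_eq0.
lra.
Qed.

Lemma dist_triangle (x y q : E) :
  dot (x - y) (x - y) <= 2 * dot (q - x) (q - x) + 2 * dot (q - y) (q - y).
Proof.
have h := dot_ge0 ((q - x) + (q - y)).
have e : dot (x - y) (x - y) + dot ((q - x) + (q - y)) ((q - x) + (q - y)) =
  2 * dot (q - x) (q - x) + 2 * dot (q - y) (q - y).
  rewrite (_ : x - y = (q - y) - (q - x)); last by apply/rowP => i; rewrite !mxE; ring.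
  move: (q - x) (q - y) => u w; rewrite !dotBl !dotBr !dotDl !dotDr (dotC w u); ring.
lra.
Qed.

Lemma green_ge_half (x y : E) : S3 x -> S3 y -> x != y -> 1 / 2 <= green x y.
Proof.
move=> hx hy xy; rewrite greenE //; have h := dot_lt1 hx hy xy.
have /andP[h1 _] := dot_unit_bound hx hy.
rewrite -[1 / 2]invrK lef_pV2 ?posrE ?subr_gt0 // ?invr_gt0; lra.
Qed.

Lemma green_near (x y : E) (r : R) : S3 x -> S3 y -> x != y -> 0 < r ->
  dot (x - y) (x - y) <= r -> 2 / r <= green x y.
Proof.
move=> hx hy xy r0; rewrite dist_dot // greenE // => h; have h1 := dot_lt1 hx hy xy.
rewrite ler_pdivrMr // mulrC ler_pdivlMr ?subr_gt0 //; lra.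
Qed.

Lemma green_far (x y : E) (r : R) : S3 x -> S3 y -> 0 < r ->
  r <= dot (x - y) (x - y) -> green x y <= 2 / r.
Proof.
move=> hx hy r0; rewrite dist_dot // greenE // => h.
have h1 : 0 < 1 - dot x y by lra.
rewrite ler_pdivlMr // mulrC ler_pdivrMr //; lra.
Qed.

Lemma close_of_proj (q x : E) (r : R) : S3 q -> S3 x -> 0 <= dot q x ->
  enorm (q - dot q x *: x) <= r -> dot (q - x) (q - x) <= 2 * (r * r).
Proof.
move=> hq hx t0 hr; rewrite dist_dot //.
have h : enorm (q - dot q x *: x) ^+ 2 <= r * r by rewrite expr2; apply: ler_pM; rewrite ?enorm_ge0.
move: h; rewrite sqr_enorm sqr_proj //; have /andP[_ t1] := dot_unit_bound hq hx.
move: (dot q x) t0 t1 => t t0 t1.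
have := mulr_ge0 t0 (_ : 0 <= 1 - t); rewrite subr_ge0 => /(_ t1); rewrite expr2; lra.
Qed.

End Green.

Section RealFacts.
Variable R : realType.

Lemma pow_small (z : R) (m n : nat) : 0 < z -> z <= 1 / 1000 -> (n <= m)%N -> z ^+ m <= z ^+ n.
Proof. by move=> z0 z1 mn; apply: ler_wiXn2l => //; [exact: ltW|lra]. Qed.

Lemma same_far (a a' g : R) : 1 / 20 <= a <= 1 -> 1 / 20 <= a' <= 1 -> 1 / 2 <= g ->
  a * a' < 36 * g ^+ 2.
Proof.
move=> /andP[a1 a2] /andP[b1 b2] g1.
have h1 : a * a' <= 1 * 1 by apply: ler_pM; lra.
have h2 : 1 / 2 * (1 / 2) <= g ^+ 2 by rewrite expr2; apply: ler_pM; lra.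
lra.
Qed.

(** Both points are within a distance of order z^8 of the centre, so g is at least of order
    z^-16, against z^-14 for a a'. *)
Lemma same_peak (z a a' g : R) : 0 < z -> z <= 1 / 1000 ->
  1 <= z ^+ 7 * a <= 8 -> 1 <= z ^+ 7 * a' <= 8 ->
  2 / (8 * ((17 * z ^+ 8) * (17 * z ^+ 8))) <= g -> a * a' < 36 * g ^+ 2.
Proof.
move=> z0 z1 /andP[a1 a2] /andP[b1 b2] hg.
have z7 : 0 < z ^+ 7 by rewrite exprn_gt0.
have z14 : 0 < z ^+ 14 by rewrite exprn_gt0.
have r0 : 0 < 8 * ((17 * z ^+ 8) * (17 * z ^+ 8)) by rewrite !mulr_gt0 // exprn_gt0.
move: hg; rewrite ler_pdivrMr //.
rewrite (_ : g * _ = 2 * ((34 * z) ^+ 2 * (z ^+ 14 * g))); last by ring.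
move=> hg.
have w1 : (34 * z) ^+ 2 <= 1 / 20.
  rewrite expr2; apply: le_trans (_ : 1 / 20 * 1 <= _); last by lra.
  by apply: ler_pM; rewrite ?mulr_ge0 // ?(ltW z0) //; have := z1; lra.
have g0 : 0 < z ^+ 14 * g.
  have h : 0 < (34 * z) ^+ 2 * (z ^+ 14 * g) by lra.
  by move: h; rewrite pmulr_rgt0 // exprn_gt0 // mulr_gt0.
have G2 : 20 <= z ^+ 14 * g by have := ler_wpM2r (ltW g0) w1; lra.
rewrite -(ltr_pM2l z14).
have aa : z ^+ 14 * (a * a') <= 8 * 8.
  rewrite (_ : _ * _ = (z ^+ 7 * a) * (z ^+ 7 * a')); last by ring.
  by apply: ler_pM; lra.
have GG : 20 * 20 <= (z ^+ 14 * g) * (z ^+ 14 * g) by apply: ler_pM.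
have z141 : z ^+ 14 <= 1 by rewrite -(expr0 z); exact: pow_small.
have gz : (z ^+ 14 * g) * (z ^+ 14 * g) <= z ^+ 14 * g ^+ 2.
  rewrite (_ : _ * _ = z ^+ 14 * (z ^+ 14 * g ^+ 2)); last by ring.
  by rewrite ler_piMl // mulr_ge0 ?sqr_ge0 // ltW.
rewrite (_ : _ * (36 * _) = 36 * (z ^+ 14 * g ^+ 2)); last by ring.
lra.
Qed.

Lemma other_peak (z a a' g G n : R) : 0 < z -> z <= 1 / 1000 -> 1 / 20 <= a -> 1 <= z ^+ 7 * a' ->
  0 <= n -> 0 <= g -> g <= G -> 36 * (n * G) ^+ 2 * 20 * z ^+ 7 <= 1 -> 36 * (n * g) ^+ 2 <= a * a'.
Proof.
move=> z0 z1 ha ha' n0 g0 gG h.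
have z7 : 0 < z ^+ 7 by rewrite exprn_gt0.
have h1 : 1 / 20 * 1 <= a * (z ^+ 7 * a') by apply: ler_pM; lra.
rewrite -(ler_pM2r z7).
have h2 : (n * g) ^+ 2 <= (n * G) ^+ 2.
  by rewrite !expr2; apply: ler_pM; rewrite ?mulr_ge0 // ler_wpM2l.
have h3 : (n * g) ^+ 2 * z ^+ 7 <= (n * G) ^+ 2 * z ^+ 7 by rewrite ler_pM2r.
rewrite (_ : a * a' * _ = a * (z ^+ 7 * a')); last by ring.
lra.
Qed.

(** d, dx and dy are the squared distances between x and y and from the centre to x and y. *)
Lemma apart_bound (z U dx dy d c : R) : 0 < z -> z <= 1 / 1000 -> 1 <= U -> 2 * U * z <= 1 ->
  c - 1 <= z ^+ 8 / 2 -> 2 * (1 / U - (c - 1)) <= dx ->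
  dy <= 2 * ((17 * z ^+ 8) * (17 * z ^+ 8)) -> dx <= 2 * d + 2 * dy -> 1 / (2 * U) <= d.
Proof.
move=> z0 z1 U1 hU hc h1 h2 h3.
have U0 : 0 < U by lra.
have i : 2 * z <= 1 / U by rewrite ler_pdivlMr //; lra.
have e : 1 / (2 * U) = (1 / U) / 2 by field; rewrite gt_eqF.
have z8 : z ^+ 8 <= z by rewrite -{2}(expr1 z); exact: pow_small.
have z16 : (17 * z ^+ 8) * (17 * z ^+ 8) <= z / 10.
  rewrite (_ : _ * _ = (17 * z) ^+ 2 * z ^+ 14); last by ring.
  have h14 : z ^+ 14 <= z by rewrite -{2}(expr1 z); exact: pow_small.
  rewrite [z / 10]mulrC; apply: ler_pM => //; rewrite ?sqr_ge0 ?exprn_ge0 ?(ltW z0) //.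
  rewrite expr2; apply: le_trans (_ : 1 / 10 * 1 <= _); last by lra.
  by apply: ler_pM; rewrite ?mulr_ge0 // ?(ltW z0) //; have := z1; lra.
rewrite e; lra.
Qed.

End RealFacts.

(** * The class A *)

Lemma cz_near_one (R : realType) (z : R) : 0 < z -> z <= 1 / 1000 ->
  z ^+ 8 / 3 <= cz z - 1 <= z ^+ 8 / 2.
Proof. by move=> z0 z1; exact: sqrt_near_one (cz_sqr z0) (cz_gt1 z0). Qed.

Section Classes.
Variable R : realType.
Local Notation E := 'rV[R]_4.
Variables (b : 'I_4 -> E) (hb : frame b).
Variables (k : nat) (q : 'I_k -> E) (hq : forall j, S3 (q j)).
Variables (z : R).
Hypotheses (z0 : 0 < z) (z1 : z <= 1 / 1000).
Variables (U : R) (U1 : 1 <= U).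
Hypothesis e_small : bg_err k z U <= 1 / 50 / 100.
Variables (w0 : R).
Hypothesis hw0 : z * 10 ^+ 7 <= w0.
Hypothesis hsep : forall x i j, S3 x -> i != j -> U < bubz q z j x -> bubz q z i x <= U.
Hypothesis hg : forall x j, S3 x -> U < bubz q z j x ->
  5 * bg_err k z U + w0 <= 91 / 100 * enorm (grad (Quad b) x).
Hypothesis hU : 2 * U * z <= 1.
Hypothesis hn : 36 * (k.+1%:R * (4 * U)) ^+ 2 * 20 * z ^+ 7 <= 1.

Local Notation K := (Kz b q z).
Local Notation a := (concav b q z).

Lemma some_near x : (exists j, U < bubz q z j x) \/ forall i, bubz q z i x <= U.
Proof.
have [h|h] := pselect (exists j, U < bubz q z j x); [by left|right=> i].
by rewrite leNgt; apply/negP => hi; apply: h; exists i.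
Qed.

Let near_sep x j : S3 x -> U < bubz q z j x -> forall i, i != j -> bubz q z i x <= U.
Proof. by move=> hx hj i ij; exact: hsep hx ij hj. Qed.

Lemma crit_nondeg x : crit K x -> nondeg K x /\ laplacian K x != 0.
Proof.
move=> [hx hc]; have [[j hj]|h] := some_near x.
  by have [] := crit_near hb hq z0 z1 hx hc U1 e_small hw0 (hg hx hj) hj (near_sep hx hj).
by have [] := crit_far hb hq z0 z1 hx hc U1 e_small h.
Qed.

(** [Some j] for the peaks under the j-th bubble, [None] for the points far from all. *)
Definition kind (o : option 'I_k) (x : E) : Prop :=
  if o is Some j then
    [/\ U < bubz q z j x, enorm (q j - dot (q j) x *: x) <= 17 * z ^+ 8 & 1 <= z ^+ 7 * a x <= 8]
  else (forall i, bubz q z i x <= U) /\ 1 / 20 <= a x <= 1.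

Lemma crit_neg_kind x : crit_neg K x -> exists o, kind o x.
Proof.
move=> [[hx hc] hl]; have [[j hj]|h] := some_near x.
  have [_ _ /(_ hl) [h1 h2]] :=
    crit_near hb hq z0 z1 hx hc U1 e_small hw0 (hg hx hj) hj (near_sep hx hj).
  by exists (Some j).
by have [_ _ /(_ hl) h1] := crit_far hb hq z0 z1 hx hc U1 e_small h; exists None.
Qed.

Let z7 : 0 < z ^+ 7. Proof. by rewrite exprn_gt0. Qed.

Lemma kind_concav o x : kind o x -> 1 / 20 <= a x.
Proof.
case: o => [j [_ _ /andP[h _]]|[_ /andP[] //]].
have h1 : 0 < z ^+ 7 * a x by lra.
have a0 : 0 < a x by move: h1; rewrite pmulr_rgt0.
have h2 : z ^+ 7 * a x <= a x by rewrite ler_piMl ?(ltW a0) // -(expr0 z); exact: pow_small.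
lra.
Qed.

Let cb := cz_near_one z0 z1.

Let dist_center j x : S3 x -> dot (q j - x) (q j - x) = 2 * ((bubz q z j x)^-1 - (cz z - 1)).
Proof. by move=> hx; rewrite dist_dot // /bubz /bub invrK; ring. Qed.

Let tau_ge0 j x : S3 x -> U < bubz q z j x -> 0 <= dot (q j) x.
Proof.
move=> hx hu; have c1 := cz_gt1 z0.
have : (bubz q z j x)^-1 <= 1.
  by rewrite invf_le1; [exact: le_trans U1 (ltW hu)|exact: lt_trans (lt_le_trans ltr01 U1) hu].
by rewrite /bubz /bub invrK; move: (dot _ _) (cz z) c1 => t c c1 h; lra.
Qed.

Let peak_close j x : S3 x -> kind (Some j) x ->
  dot (q j - x) (q j - x) <= 2 * ((17 * z ^+ 8) * (17 * z ^+ 8)).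
Proof. by move=> hx [hu hp _]; exact: close_of_proj (tau_ge0 hx hu) hp. Qed.

Lemma green_apart j x y : S3 x -> S3 y -> bubz q z j x <= U -> kind (Some j) y ->
  green x y <= 4 * U.
Proof.
move=> hx hy hu ky.
have U0 : 0 < U by exact: lt_le_trans ltr01 U1.
have u0 := bubz_gt0 hq z0 j hx.
have -> : 4 * U = 2 / (1 / (2 * U)) by field; rewrite gt_eqF.
apply: green_far => //; first by rewrite divr_gt0 // mulr_gt0.
have h3 : dot (q j - x) (q j - x) <= 2 * dot (x - y) (x - y) + 2 * dot (q j - y) (q j - y).
  have dC (t t' : E) : dot (t - t') (t - t') = dot (t' - t) (t' - t).
    by rewrite -opprB dotNl dotNr opprK.
  by rewrite (dC x y) (dC (q j) y) [leRHS]addrC; exact: dist_triangle.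
have /andP[_ hc] := cb.
apply: (apart_bound z0 z1 U1 hU hc _ (peak_close hy ky) h3).
rewrite dist_center // ler_pM2l // lerD2r mul1r lef_pV2 // posrE.
Qed.

Lemma same_kind o x y : crit_neg K x -> crit_neg K y -> x != y -> kind o x -> kind o y ->
  a x * a y < 36 * green x y ^+ 2.
Proof.
move=> [[hx _] _] [[hy _] _] xy; case: o => [j|] kx ky.
  have [_ _ ax] := kx; have [_ _ ay] := ky.
  apply: (same_peak z0 z1 ax ay); apply: green_near => //.
    by rewrite !mulr_gt0 // exprn_gt0.
  apply: le_trans (dist_triangle x y (q j)) _.
  have := peak_close hx kx; have := peak_close hy ky.
  by move: (dot (q j - x) _) (dot (q j - y) _) (17 * z ^+ 8 * (17 * z ^+ 8)) => d1 d2 d3; lra.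
have [_ ax] := kx; have [_ ay] := ky.
exact: same_far ax ay (green_ge_half hx hy xy).
Qed.

Let G0 (x y : E) : S3 x -> S3 y -> x != y -> 0 <= green x y.
Proof. by move=> hx hy xy; apply: le_trans (green_ge_half hx hy xy); lra. Qed.

(** One of the two points is a peak and the other is far from the same bubble, which bounds
    the Green function by 4 U; the peak makes the product of the diagonal terms large. *)
Lemma diff_kind (n : nat) o o' x y : (n <= k.+1)%N -> crit_neg K x -> crit_neg K y -> x != y ->
  kind o x -> kind o' y -> o != o' -> 36 * (n%:R * green x y) ^+ 2 <= a x * a y.
Proof.
move=> nk; wlog: o o' x y / exists j, o' = Some j => [hw|[j ->]].
  case: o' => [j|] hx hy xy kx ky oo; first by apply: hw kx ky oo => //; exists j.
  case: o kx oo => [j|//] kx oo.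
  rewrite greenC [a x * _]mulrC; apply: (hw None (Some j)) => //; first by exists j.
  by rewrite eq_sym.
move=> [[hx _] _] [[hy _] _] xy kx ky oj.
have g0 := G0 hx hy xy.
have uj : bubz q z j x <= U.
  case: o kx oj => [i|] kx ij; last by case: kx.
  by have [hu _ _] := kx; apply: (hsep hx _ hu); apply: contra_neq ij => ->.
have [_ _ /andP[ay _]] := ky.
have nk' : n%:R <= k.+1%:R :> R by rewrite ler_nat.
apply: le_trans (other_peak z0 z1 (kind_concav kx) ay (ler0n _ k.+1) g0 (green_apart hx hy uj ky) hn).
rewrite ler_pM2l // !expr2; apply: ler_pM; rewrite ?mulr_ge0 // ler_wpM2r //.
Qed.

Lemma Kz_classA : classA K.
Proof.
split; first exact: (C2_Kz hb hq z0).
- by move=> x hx; exact: (Kz_gt0 hb hq z0).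
- by move=> x /crit_nondeg[].
move=> n y n2 yi yc.
have n0 : (0 < n)%N by exact: leq_trans n2.
have [ o ho] := choice (fun i => crit_neg_kind (yc i)).
have Sy i : S3 (y i) by case: (yc i) => -[].
pose AA : 'M[R]_n := \matrix_(i, j) if i == j then a (y i) / K (y i) ^+ 2
  else - 6 * (green (y i) (y j) / (K (y i) * K (y j))).
have -> : Mmx K y = AA.
  apply/matrixP => i j; rewrite !mxE; case: eqP => // _; rewrite /concav.
  have := Kz_gt0 hb hq z0 (Sy i); move: (K (y i)) (laplacian K (y i)) => t l t0.
  by field; rewrite gt_eqF.
have a0 i : 0 < a (y i) by apply: lt_le_trans (kind_concav (ho i)); lra.
have K0 i : 0 < K (y i) by exact: (Kz_gt0 hb hq z0).
have gC i j : green (y i) (y j) = green (y j) (y i) by exact: greenC.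
have yn i j : i != j -> y i != y j by apply: contra_neq; exact: yi.
have [oi|/existsNP[i /existsNP[j /not_implyP[oij ij]]]] := pselect (injective o).
  apply: lt0r_neq0; apply: (interaction_pos n0 a0 K0 gC) => i j ij.
  apply: (diff_kind _ (yc i) (yc j) (yn i j ij) (ho i) (ho j)).
    by have := leq_card o oi; rewrite card_option !card_ord.
  by apply: contra_neq ij; exact: oi.
apply: ltr0_neq0.
have ij' : i != j by exact/eqP.
apply: (interaction_neg n0 a0 K0 gC ij').
by apply: (same_kind (yc i) (yc j) (yn i j ij') (ho i)); rewrite oij.
Qed.

Lemma Kz_morse : morse K.
Proof.
split; first exact: (C2_Kz hb hq z0).
by move=> x /crit_nondeg[].
Qed.

End Classes.

(** * The solutions *)

Section Solution.
Variable R : realType.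
Local Notation E := 'rV[R]_4.

Lemma psi_ext (v w w' : E -> R) : (forall x, S3 x -> w x = w' x) ->
  is_Psigma v w -> is_Psigma v w'.
Proof.
move=> h [cw p]; split.
  have e : {in S3 (R := R), w =1 w'} by move=> x /set_mem /h.
  exact: subspace_eq_continuous e cw.
move=> lam Y hY; rewrite -(p lam Y hY); apply: eq_integral_S3 => x hx; congr (_ * _).
exact: esym (h x hx).
Qed.

Lemma psi_sum n (v w : 'I_n -> E -> R) : (forall i, C2_S3 (v i)) -> (forall i, C2_S3 (w i)) ->
  (forall i, is_Psigma (v i) (w i)) ->
  is_Psigma (fun x => \sum_i v i x) (fun x => \sum_i w i x).
Proof.
elim: n v w => [|n IH] v w hv hw h.
  have e : (fun x : E => \sum_(i < 0) v i x) = fun=> 0 by apply/funext => x; rewrite big_ord0.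
  have e' : (fun x : E => \sum_(i < 0) w i x) = fun x => 1 * 0 by apply/funext => x; rewrite big_ord0 mulr0.
  rewrite e e'; apply: (psi_eigen ler01 (C2_cst 0)) => x hx.
  by rewrite laplacianE op2_cst // oppr0 addr0 mulr0.
have e (t : 'I_n.+1 -> E -> R) : (fun x : E => \sum_i t i x) =
    fun x => \sum_(i < n) t (widen_ord (leqnSn n) i) x + t ord_max x.
  by apply/funext => x; rewrite big_ord_recr.
rewrite !e; apply: psi_add => //.
- by apply: C2_sum => i.
- by apply: C2_sum => i.
by apply: IH.
Qed.

Variables (b : 'I_4 -> E) (hb : frame b).
Variables (k : nat) (q : 'I_k -> E) (hq : forall j, S3 (q j)).
Variables (z : R).
Hypotheses (z0 : 0 < z).

Let z4 : 0 < z ^+ 4. Proof. by rewrite exprn_gt0. Qed.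

Let C2u i : C2_S3 (bubz q z i). Proof. rewrite /bubz; exact: (C2_bub (hq i) (cz_gt1 z0)). Qed.

Let psi_bubz i : is_Psigma (bubz q z i) (fun x => z ^+ 4 * (bubz q z i x * bubz q z i x)).
Proof.
have := psi_bubble (hq i) z4; rewrite -exprM -[Num.sqrt _]/(cz z).
by apply: psi_ext => x _; rewrite expr2.
Qed.

Lemma psi_vz : is_Psigma (vz b q z) (fz b q z).
Proof.
have C2uu i : C2_S3 (fun x => bubz q z i x * bubz q z i x) := C2_mul (C2u i) (C2u i).
have C2Q : C2_S3 (Quad b) := C2_Quad b.
have p1 : is_Psigma (fun=> 1 : R) (fun _ : E => 1 * 1).
  by apply: (psi_eigen ler01 (C2_cst 1)) => x hx; rewrite laplacianE op2_cst // oppr0 add0r expr1n mulr1.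
have pQ : is_Psigma (Quad b) (fun x => 3 * Quad b x).
  apply: psi_eigen => // x hx; rewrite laplacian_Quad //; ring.
have pu : is_Psigma (fun x => \sum_i z ^+ 7 * bubz q z i x)
    (fun x => \sum_i z ^+ 7 * (z ^+ 4 * (bubz q z i x * bubz q z i x))).
  apply: psi_sum => i.
  - exact: C2_scale _ (C2u i).
  - exact: C2_scale _ (C2_scale _ (C2uu i)).
  exact: psi_scale (C2u i) (C2_scale _ (C2uu i)) (psi_bubz i).
have h1 := psi_add (C2_cst 1) (C2_cst (1 * 1)) C2Q (C2_scale 3 C2Q) p1 pQ.
have h2 := psi_add (C2_add (C2_cst 1) C2Q) (C2_add (C2_cst (1 * 1)) (C2_scale 3 C2Q))
  (C2_sum (fun i => C2_scale (z ^+ 7) (C2u i)))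
  (C2_sum (fun i => C2_scale (z ^+ 7) (C2_scale (z ^+ 4) (C2uu i)))) h1 pu.
apply: psi_ext h2 => x _; rewrite /fz /comb_f mulr1; congr (_ + _).
by apply: eq_bigr => i _; rewrite /full; ring.
Qed.

Lemma vz_solution : solutions (Kz b q z) (vz b q z).
Proof.
split; first exact: (C2_comb_v b hq z0).
- by move=> x hx; exact: (vz_gt0 hb hq z0).
apply: psi_ext psi_vz => x hx; rewrite /Kz /quo divfK // expf_eq0 /=.
exact: (vz_neq0 hb hq z0).
Qed.

End Solution.

(** * Blow-up *)

Section Blowup.
Variable R : realType.
Local Notation E := 'rV[R]_4.

Lemma dotl_cont (q : E) : continuous (dot q).
Proof.
move=> x; apply: sum_cont => i.
apply: (@continuousM _ _ (fun=> q 0 i) (fun y : E => y 0 i)); first exact: cst_continuous.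
exact: coord_continuous.
Qed.

Variables (b : 'I_4 -> E) (hb : frame b).
Variables (k : nat) (q : 'I_k -> E) (hq : forall j, S3 (q j)).
Variables (z : nat -> R).
Hypotheses (z0 : forall i, 0 < z i) (z1 : forall i, z i <= 1 / 1000).
Hypothesis zV : forall i : nat, i%:R <= (z i)^-1.

Lemma vz_peak i j : i%:R <= vz b q (z i) (q j).
Proof.
have hx := hq j; have := Quad_le hb hx; rewrite ler_norml => /andP[h _].
have /andP[_ hc] := cz_near_one (z0 i) (z1 i).
have c1 := cz_gt1 (z0 i).
have z8 : 0 < z i ^+ 8 by rewrite exprn_gt0 // z0.
have u1 : 2 / z i ^+ 8 <= bubz q (z i) j (q j).
  rewrite /bubz /bub (S3P (q j)).1 // ler_pdivrMr // mulrC ler_pdivlMr ?subr_gt0 //; lra.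
have : z i ^+ 7 * bubz q (z i) j (q j) <= \sum_l full (z i) l * bubz q (z i) l (q j).
  rewrite (bigD1 j) //= lerDl; apply: sumr_ge0 => l _.
  by rewrite mulr_ge0 ?exprn_ge0 ?(ltW (z0 i)) // ltW // (bubz_gt0 hq).
have : z i ^+ 7 * (2 / z i ^+ 8) <= z i ^+ 7 * bubz q (z i) j (q j).
  by rewrite ler_pM2l // exprn_gt0 // z0.
have -> : z i ^+ 7 * (2 / z i ^+ 8) = 2 * (z i)^-1 by field; rewrite gt_eqF // z0.
have := zV i; have : 0 < (z i)^-1 by rewrite invr_gt0.
rewrite /vz /comb_v; move: ((z i)^-1) (\sum_l _) (z i ^+ 7 * bubz q (z i) j (q j)) (Quad _ _) h => w S T Qx h; lra.
Qed.

Lemma vz_away i (d : 'I_k -> R) x : S3 x -> (forall j, 0 < d j) ->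
  (forall j, d j <= 1 - dot (q j) x) -> vz b q (z i) x <= 2 + \sum_j (d j)^-1.
Proof.
move=> hx d0 hd; have := Quad_le hb hx; rewrite ler_norml => /andP[_ h].
have : \sum_l full (z i) l * bubz q (z i) l x <= \sum_j (d j)^-1.
  apply: ler_sum => j _; rewrite -[leRHS]mul1r; apply: ler_pM.
  - by rewrite exprn_ge0 // ltW.
  - by rewrite ltW // (bubz_gt0 hq).
  - by rewrite -(expr0 (z i)); exact: pow_small.
  have c1 := cz_gt1 (z0 i); have h1 := hd j; have h2 := d0 j.
  by rewrite /bubz /bub lef_pV2 ?posrE //; lra.
rewrite /vz /comb_v; move: (\sum_j _) (\sum_l _) (Quad _ _) h => S T Qx; lra.
Qed.

Lemma blowup_vz : blowup_points (fun i => vz b q (z i)) = range q.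
Proof.
apply/seteqP; split => x /=.
  move=> [hx [y [hy yx vy]]]; apply: contrapT => nx.
  have qx j : q j != x by apply/eqP => e; apply: nx; exists j.
  pose d j := (1 - dot (q j) x) / 2.
  have d0 j : 0 < d j by rewrite divr_gt0 // subr_gt0 (dot_lt1 (hq j) hx (qx j)).
  have hd : \forall i \near \oo, forall j, dot (q j) (y i) <= 1 - d j.
    apply: filter_forall => j.
    have c : dot (q j) (y i) @[i --> \oo] --> dot (q j) x.
      by apply: (cvg_comp _ _ yx); exact: dotl_cont.
    have := @cvgr_le R nat \oo _ _ _ c (1 - d j); apply.
    have := d0 j; rewrite /d; lra.
  move/cvgryPge/(_ (3 + \sum_j (d j)^-1)) : vy => hv.
  have [i [h1 h2]] := filter_ex (filterI hd hv).
  have := vz_away i (hy i) d0 (fun j => _ : d j <= 1 - dot (q j) (y i)).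
  move=> /(_ _)/(le_trans h2) h3.
  have : 3 + \sum_j (d j)^-1 <= 2 + \sum_j (d j)^-1.
    by apply: h3 => j; have := h1 j; lra.
  by rewrite lerD2r; lra.
move=> [j _ <-]; split => //; exists (fun=> q j); split => //.
  exact: cvg_cst.
apply/cvgryPge => A; near=> i; apply: le_trans (vz_peak i j).
near: i; exact: nbhs_infty_ger.
Unshelve. all: by end_near.
Qed.

End Blowup.

(** * Choice of the parameters *)

Section Choices.
Variable R : realType.
Local Notation E := 'rV[R]_4.
Local Notation o0 := (Ordinal (isT : (0 < 4)%N)).
Local Notation o1 := (Ordinal (isT : (1 < 4)%N)).
Local Notation o2 := (Ordinal (isT : (2 < 4)%N)).
Local Notation o3 := (Ordinal (isT : (3 < 4)%N)).

Lemma near0_neq (a : R) : \forall t \near 0^'+, t != a.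
Proof.
have [a0|a0] := leP a 0; near=> t.
  by rewrite gt_eqF //; apply: le_lt_trans a0 _; near: t; exact: nbhs_right_gt.
by rewrite lt_eqF //; near: t; exact: nbhs_right_lt.
Unshelve. all: by end_near.
Qed.

Lemma near0_scale (a : R) : \forall t \near 0^'+, a * t <= 1.
Proof.
have m0 : 0 < (Num.max 1 a)^-1 by rewrite invr_gt0 lt_max ltr01.
near=> t.
have t0 : 0 < t by near: t; exact: nbhs_right_gt.
have : t <= (Num.max 1 a)^-1 by near: t; exact: nbhs_right_le.
move=> h; apply: le_trans (_ : Num.max 1 a * t <= _).
  by rewrite ler_pM2r // le_max lexx orbT.
by rewrite mulrC -ler_pdivlMr ?mul1r // lt_max ltr01.
Unshelve. all: by end_near.
Qed.

(** Each coordinate of each q_j excludes one value of C^2. *)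
Lemma generic_angle (k : nat) (q : 'I_k -> E) : exists C S : R, C ^+ 2 + S ^+ 2 = 1 /\
  forall j i, q j 0 i ^+ 2 != C ^+ 2.
Proof.
have : \forall t \near (0 : R)^'+, [/\ 0 < t, t < 1 & forall ji : 'I_k * 'I_4, t != q ji.1 0 ji.2 ^+ 2].
  have h := @filter_forall R ('I_k * 'I_4)%type _ _ _ (fun ji => near0_neq (q ji.1 0 ji.2 ^+ 2)).
  near=> t; split.
  - by near: t; exact: nbhs_right_gt.
  - by near: t; exact: nbhs_right_lt.
  by near: t; exact: h.
move=> /filter_ex[t [t0 t1 h]].
exists (Num.sqrt t), (Num.sqrt (1 - t)).
rewrite !sqr_sqrtr ?subr_ge0 ?(ltW t1) ?(ltW t0) //; split; first by rewrite addrC subrK.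
by move=> j i; have := h (j, i); rewrite eq_sym.
Unshelve. all: by end_near.
Qed.

(** A zero of grad Q is one of the vectors b_l or its opposite, and each of these has a
    coordinate of square C^2. *)
Lemma grad_Quad_neq0 (C S : R) (x : E) : C ^+ 2 + S ^+ 2 = 1 -> S3 x ->
  (forall i, x 0 i ^+ 2 != C ^+ 2) -> 0 < dot (grad (Quad (rot C S)) x) (grad (Quad (rot C S)) x).
Proof.
move=> CS hx hC; have hb := rot_frame CS.
rewrite lt_neqAle dot_ge0 andbT eq_sym; apply/negP => /eqP.
rewrite (sqr_grad_Quad hb hx) => /eqP; rewrite mulf_eq0 pnatr_eq0 /=.
rewrite psumr_eq0 => [/allP h|l _]; last by rewrite mulr_ge0 ?sqr_ge0.
have hl l : lam R l = Quad (rot C S) x \/ dot (rot C S l) x = 0.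
  have := h l (mem_index_enum _); rewrite /= mulf_eq0 !sqrf_eq0 subr_eq0.
  by move=> /orP[] /eqP; [left|right].
have := (S3P x).1 hx; rewrite hb.1 sum4.
have CS' : S ^+ 2 = 1 - C ^+ 2 by rewrite -CS; ring.
have [e0 e1 e2 e3] : [/\ x 0 o0 = C * dot (rot C S o0) x - S * dot (rot C S o1) x,
    x 0 o1 = S * dot (rot C S o0) x + C * dot (rot C S o1) x,
    x 0 o2 = C * dot (rot C S o2) x + S * dot (rot C S o3) x &
    x 0 o3 = C * dot (rot C S o3) x - S * dot (rot C S o2) x].
  by split; rewrite /dot !sum4 /rot /= !mxE /=; ring: CS'.
have [h0 h1 h2 h3] := And4 (hC o0) (hC o1) (hC o2) (hC o3); move: h0 h1 h2 h3.
have [g0 g1 g2 g3] := And4 (hl o0) (hl o1) (hl o2) (hl o3); move: g0 g1 g2 g3.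
rewrite e0 e1 e2 e3 /lam /=.
move: (dot (rot C S o0) x) (dot (rot C S o1) x) (dot (rot C S o2) x)
  (dot (rot C S o3) x) (Quad _ _) => y0 y1 y2 y3 Qx.
have sq (a s : R) : s * s = 1 -> (a * s) ^+ 2 != a ^+ 2 -> False.
  by move=> hs /eqP; apply; rewrite exprMn [s ^+ 2]expr2 hs mulr1.
move=> [m0|z0'] [m1|z1'] [m2|z2'] [m3|z3']; try (exfalso; lra);
  rewrite ?z0' ?z1' ?z2' ?z3' ?mulr0 ?addr0 ?add0r ?subr0 ?sub0r ?oppr0 => k0 k1 k2 k3 d.
- exact: sq d k0.
- exact: sq d k1.
- exact: sq d k2.
- exact: sq d k3.
by move: d => /eqP; rewrite eq_sym oner_eq0.
Qed.

(** 2 (1 - <q, x>) is the squared distance from x to q. *)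
Lemma near_of_dot (f : E -> R) (q : E) : S3 q -> {for q, continuous f} -> 0 < f q ->
  \forall t \near 0^'+, forall x, S3 x -> 1 - dot q x < t -> t <= f x.
Proof.
move=> hq cf fq.
have h : \forall x \near q, f q / 2 < f x.
  apply: (@cvgr_gt R E (nbhs q) _ f (f q) cf); lra.
have /nbhs_ballP[d /= d0 hd] := h.
near=> t; move=> x hx hxt.
apply: le_trans (ltW (hd x _)).
  by near: t; apply: nbhs_right_le; rewrite divr_gt0.
have t2 : 2 * t <= d ^+ 2.
  have : t <= d ^+ 2 / 2 by near: t; apply: nbhs_right_le; rewrite divr_gt0 // exprn_gt0.
  lra.
have dd : dot (q - x) (q - x) < d ^+ 2 by rewrite dist_dot //; lra.
split => // i0 i; rewrite ord1 /ball /=.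
rewrite -ltr_sqr ?nnegrE ?(ltW d0) // real_normK ?num_real //; apply: le_lt_trans dd.
have -> : q 0 i - x 0 i = (q - x) 0 i by rewrite !mxE.
by rewrite /dot (bigD1 i) //= -expr2 lerDl; apply: sumr_ge0 => l _; rewrite -expr2 sqr_ge0.
Unshelve. all: by end_near.
Qed.

Lemma Quad_cont (b : 'I_4 -> E) : continuous (Quad b).
Proof.
move=> x; apply: sum_cont => l; apply: (@continuousM _ _ (fun=> lam R l)).
  exact: cst_continuous.
exact: continuousM (@dotl_cont R (b l) x) (@dotl_cont R (b l) x).
Qed.

Lemma grad_Quad_near (b : 'I_4 -> E) (q : E) : frame b -> S3 q ->
  0 < dot (grad (Quad b) q) (grad (Quad b) q) ->
  \forall t \near 0^'+, forall x, S3 x -> 1 - dot q x < t -> t <= enorm (grad (Quad b) x).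
Proof.
move=> hb hq.
pose f (x : E) := 4 * \sum_l ((lam R l - Quad b x) * (lam R l - Quad b x)) * (dot (b l) x * dot (b l) x).
have fE x : S3 x -> dot (grad (Quad b) x) (grad (Quad b) x) = f x.
  by move=> hx; rewrite (sqr_grad_Quad hb hx).
have cf : {for q, continuous f}.
  apply: (@continuousM _ _ (fun=> 4)); first exact: cst_continuous.
  apply: sum_cont => l.
  have c1 : {for q, continuous (fun x => lam R l - Quad b x)}.
    apply: (continuousB (f := fun=> lam R l)); first exact: cst_continuous.
    exact: Quad_cont.
  exact: continuousM (continuousM c1 c1) (continuousM (dotl_cont (x := q)) (dotl_cont (x := q))).
rewrite (fE _ hq) => f0.
have h := near_of_dot hq cf f0.
near=> t; move=> x hx hxt.
have t0 : 0 <= t by near: t; exact: nbhs_right_ge.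
have t1 : t <= 1 by near: t; exact: nbhs_right_le.
rewrite -ler_sqr ?nnegrE ?enorm_ge0 // sqr_enorm (fE _ hx).
have tf : t <= f x.
  by move: x hx hxt; near: t; exact: h.
apply: le_trans tf; rewrite expr2 ler_piMl //.
Unshelve. all: by end_near.
Qed.

(** The same t serves as the width of the neighbourhoods of the centres and as the lower bound
    of |grad Q| there; 1 / t is then the height at which a bubble counts as large. *)
Lemma scale_exists (k : nat) (q : 'I_k -> E) (b : 'I_4 -> E) : (forall j, S3 (q j)) ->
  injective q -> frame b -> (forall j, 0 < dot (grad (Quad b) (q j)) (grad (Quad b) (q j))) ->
  exists t : R, [/\ 0 < t, t <= 1,
    forall i j, i != j -> 4 * t <= 1 - dot (q i) (q j) &
    forall j x, S3 x -> 1 - dot (q j) x < t -> t <= enorm (grad (Quad b) x)].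
Proof.
move=> hq hinj hb hg.
have h1 : \forall t \near (0 : R)^'+, forall ij : 'I_k * 'I_k, ij.1 != ij.2 ->
    4 * t <= 1 - dot (q ij.1) (q ij.2).
  apply: filter_forall => -[i j] /=.
  have [->|ij] := eqVneq i j; first by near=> t; move=> /eqP[].
  have d0 : 0 < 1 - dot (q i) (q j).
    by rewrite subr_gt0 dot_lt1 //; apply: contra_neq ij; exact: hinj.
  near=> t => _.
  have : t <= (1 - dot (q i) (q j)) / 4 by near: t; apply: nbhs_right_le; rewrite divr_gt0.
  lra.
have h2 : \forall t \near (0 : R)^'+, forall j x, S3 x -> 1 - dot (q j) x < t ->
    t <= enorm (grad (Quad b) x).
  by apply: filter_forall => j; exact: grad_Quad_near hb (hq j) (hg j).
have : \forall t \near (0 : R)^'+, [/\ 0 < t, t <= 1,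
    forall i j, i != j -> 4 * t <= 1 - dot (q i) (q j) &
    forall j x, S3 x -> 1 - dot (q j) x < t -> t <= enorm (grad (Quad b) x)].
  near=> t; split.
  - by near: t; exact: nbhs_right_gt.
  - by near: t; exact: nbhs_right_le.
  - move=> i j ij.
    have h : forall ij : 'I_k * 'I_k, ij.1 != ij.2 ->
        4 * t <= 1 - dot (q ij.1) (q ij.2) by near: t; exact: h1.
    exact: (h (i, j)).
  by near: t; exact: h2.
by move=> /filter_ex.
Unshelve. all: by end_near.
Qed.

(** The smallness of z that the location of the critical points and the comparison of their
    interactions require, for bubbles cut off at height U = 1 / t and with w0 = t / 2. *)
Definition admissible (k : nat) (t z : R) := [/\ z <= 1 / 1000,
  bg_err k z t^-1 <= 1 / 50 / 100, z * 10 ^+ 7 <= t / 2, 2 * t^-1 * z <= 1 &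
  5 * bg_err k z t^-1 + t / 2 <= 91 / 100 * t /\
  36 * (k.+1%:R * (4 * t^-1)) ^+ 2 * 20 * z ^+ 7 <= 1].

(** Every condition follows from one of the form [a * z <= 1], so all z below some z0 do. *)
Lemma admissible_exists (k : nat) (t : R) : 0 < t -> t <= 1 ->
  exists z0 : R, [/\ 0 < z0, z0 <= 1 & forall z, 0 < z -> z <= z0 -> admissible k t z].
Proof.
move=> t0 t1.
pose c1 : R := 10 * 10 * 10.
pose ce : R := 50 * 100 * 8 * t^-1 ^+ 5 * k%:R.
pose c2 : R := 2 * 10 ^+ 7 * t^-1.
pose c3 : R := 2 * t^-1.
pose c4 : R := 36 * (k.+1%:R * (4 * t^-1)) ^+ 2 * 20.
have : \forall z \near (0 : R)^'+, [/\ 0 < z, z <= 1, c1 * z <= 1, ce * z <= 1 &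
    c2 * z <= 1 /\ c3 * z <= 1 /\ c4 * z <= 1].
  near=> z; split.
  - by near: z; exact: nbhs_right_gt.
  - by near: z; exact: nbhs_right_le.
  - by near: z; exact: near0_scale.
  - by near: z; exact: near0_scale.
  by split; [|split]; near: z; exact: near0_scale.
move=> /filter_ex[s [s0 s1 h1 he [h2 [h3 h4]]]].
exists s; split=> // z z0 zs.
have tV : 1 <= t^-1 by rewrite invf_ge1.
have tV0 : 0 < t^-1 by rewrite invr_gt0.
have mono c : 0 <= c -> c * s <= 1 -> c * z <= 1.
  by move=> c0; apply: le_trans; rewrite ler_wpM2l.
have k0 : 0 <= k%:R :> R by [].
have pe : 0 <= ce.
  have v5 : 0 <= t^-1 ^+ 5 by rewrite exprn_ge0 // ltW.
  have n0 : 0 <= 50 * 100 * 8 :> R by lra.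
  exact: mulr_ge0 (mulr_ge0 n0 v5) k0.
have g1 : c1 * z <= 1 by apply: mono => //; rewrite /c1; lra.
have ge : ce * z <= 1 by apply: mono.
have g2 : c2 * z <= 1 by apply: mono => //; rewrite /c2 !mulr_ge0 ?exprn_ge0 // ltW.
have g3 : c3 * z <= 1 by apply: mono => //; rewrite /c3 mulr_ge0 // ltW.
have pc : 0 <= 36 * (k.+1%:R * (4 * t^-1)) ^+ 2 by rewrite mulr_ge0 ?sqr_ge0.
have g4 : c4 * z <= 1 by apply: mono => //; exact: mulr_ge0 pc (ler0n _ 20).
have z1 : z <= 1 by exact: le_trans zs s1.
have z7 : z ^+ 7 <= z.
  by rewrite exprS ler_piMr ?(ltW z0) // exprn_ile1 ?(ltW z0).
have eE : bg_err k z t^-1 * t^-1 * (50 * 100) <= 1.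
  apply: le_trans ge; rewrite (_ : _ * (50 * 100) = ce * z ^+ 7).
    exact: ler_wpM2l.
  rewrite /ce /bg_err; move: (t^-1) (z ^+ 7) => v w; ring.
have e0 : 0 <= bg_err k z t^-1.
  by rewrite /bg_err !mulr_ge0 ?exprn_ge0 // ltW.
have et : bg_err k z t^-1 * (50 * 100) <= t.
  rewrite -(ler_pM2r tV0) mulfV ?gt_eqF // mulrAC; exact: eE.
split.
- by move: g1; rewrite /c1; lra.
- by move: et; move: (bg_err _ _ _) => e et; lra.
- move: g2; rewrite /c2 (_ : 2 * 10 ^+ 7 * t^-1 * z = (2 * (z * 10 ^+ 7)) / t); last by ring.
  rewrite ler_pdivrMr // mul1r; move: (z * _) => w; lra.
- exact: g3.
split; first by move: et; move: (bg_err _ _ _) => e et; lra.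
apply: le_trans g4; exact: ler_wpM2l (mulr_ge0 pc (ler0n _ 20)) _ _ z7.
Unshelve. all: by end_near.
Qed.

End Choices.

(** * The sequence *)

Section Assembly.
Variable R : realType.
Local Notation E := 'rV[R]_4.
Variables (b : 'I_4 -> E) (hb : frame b).
Variables (k : nat) (q : 'I_k -> E) (hq : forall j, S3 (q j)).
Variables (t z : R).
Hypotheses (t0 : 0 < t) (t1 : t <= 1) (z0 : 0 < z).

Lemma high_close j x : S3 x -> t^-1 < bubz q z j x -> 1 - dot (q j) x < t.
Proof.
move=> hx; have u0 := bubz_gt0 hq z0 j hx.
have uV : 0 < (bubz q z j x)^-1 by rewrite invr_gt0.
rewrite -[bubz q z j x]invrK (ltf_pV2 (t0 : t \in Num.pos) (uV : _ \in Num.pos)).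
by rewrite /bubz /bub invrK; have := cz_gt1 z0; move: (cz z) (dot _ _) => c d; lra.
Qed.

(** Two distinct centres are too far apart for both bubbles to be large. *)
Lemma high_sep (hs : forall i j, i != j -> 4 * t <= 1 - dot (q i) (q j)) x i j :
  S3 x -> i != j -> t^-1 < bubz q z j x -> bubz q z i x <= t^-1.
Proof.
move=> hx ij hj; rewrite leNgt; apply/negP => hi.
have h1 := high_close hx hi; have h2 := high_close hx hj; have h3 := hs i j ij.
have := dist_triangle (q i) (q j) x; rewrite !dist_dot // !(dotC x); lra.
Qed.

End Assembly.

Theorem corollary1p2 (R : realType) (k : nat) (hk : (1 <= k)%N)
    (q : 'I_k -> 'rV[R]_4) (hq : forall j, S3 (q j)) (hinj : injective q) :
  exists K : nat -> 'rV[R]_4 -> R,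
    (forall i, morse (K i) /\ classA (K i)) /\
    exists v : nat -> 'rV[R]_4 -> R,
      (forall i, solutions (K i) (v i)) /\
      blowup_points v = range q.
Proof.
have [C [S [CS hC]]] := generic_angle q.
have hb := rot_frame CS; set b := rot C S in hb.
have hg j := grad_Quad_neq0 CS (hq j) (hC j).
have [t [t0 t1 hs ht]] := scale_exists hq hinj hb hg.
have [s [s0 s1 hz]] := admissible_exists k t0 t1.
pose z (i : nat) : R := s / i.+1%:R.
have z0 i : 0 < z i by rewrite divr_gt0.
have zs i : z i <= s by rewrite ler_pdivrMr // ler_peMr ?ler1n // ltW.
have tV : 1 <= t^-1 by rewrite invf_ge1.
have sep i := high_sep hq t0 (z0 i) hs.
have gradb i x j (hx : S3 x) (hu : t^-1 < bubz q (z i) j x) :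
    5 * bg_err k (z i) t^-1 + t / 2 <= 91 / 100 * enorm (grad (Quad b) x).
  have [_ _ _ _ [h _]] := hz _ (z0 i) (zs i); apply: le_trans h _.
  by apply: ler_wpM2l; [lra|exact: ht hx (high_close hq t0 (z0 i) hx hu)].
exists (fun i => Kz b q (z i)); split.
  move=> i; have [h1 h2 h3 h4 [_ h6]] := hz _ (z0 i) (zs i); split.
    exact: (Kz_morse hb hq (z0 i) h1 tV h2 h3 (sep i) (gradb i)).
  exact: (Kz_classA hb hq (z0 i) h1 tV h2 h3 (sep i) (gradb i) h4 h6).
exists (fun i => vz b q (z i)); split; first by move=> i; exact: vz_solution.
apply: (blowup_vz hb hq z0).
  by move=> i; have [] := hz _ (z0 i) (zs i).
move=> i; rewrite /z invf_div ler_pdivlMr //.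
by apply: le_trans (_ : i%:R * 1 <= _); [rewrite ler_wpM2l|rewrite mulr1 ler_nat].
Qed.
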